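(* Consider two interacting particles $X^{1,N},X^{2,N}$ taking values in $\mathbb{R}$ (with $N=2$), given by $$dX^{1,N}_t=\big(Q(X^{1,N}_t)-K(X^{2,N}_t-X^{1,N}_t)\big)dt+dW^1_t,\qquad X^{1,N}_0=x^1_0,$$ $$dX^{2,N}_t=\big(Q(X^{2,N}_t)+K(X^{2,N}_t-X^{1,N}_t)\big)dt+dW^2_t,\qquad X^{2,N}_0=x^2_0,$$ where $x^1_0<x^2_0$, $Q:\mathbb{R}\to\mathbb{R}$ is Lipschitz, and $K:(0,\infty)\to\mathbb{R}$ is an interaction kernel such that there exist $c,l>0$ with, for all $x,y>0$, $$(K(x)-K(y))(x-y)\le c|x-y|^2,\qquad |K(x)-K(y)|\le c(1+x^{-l}+y^{-l})|x-y|.$$ Assume additionally that there exist $h_1,h_2,h_3,h_4>0$ and $0<\beta<\alpha-1$ such that for every $x>0$ $$K(x)\ge h_1x^{-\alpha}-h_2x^{-\beta}-h_3-h_4x.$$ Then there exists $D\subset\mathbb{R}^2$ such that the diffusion $X=(X^{1,N},X^{2,N})$, i.e. the drift $$b(x)=\big(Q(x^1)-K(x^2-x^1),\;Q(x^2)+K(x^2-x^1)\big),\qquad x=(x^1,x^2),\ x^1<x^2$$ (extended measurably to $\mathbb{R}^2$), together with the initial condition $x_0=(x^1_0,x^2_0)$, satisfies the Assumptions (A) stated in the context with $d=2$. Therefore the conclusion (C) stated in the context holds for this system.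
   Context: $W=(W^1,W^2)$ is a two-dimensional Wiener process; superscripts on vectors denote components. $|\cdot|$ is the Euclidean norm on $\mathbb{R}^d$ and the Frobenius norm on matrices; $\langle\cdot,\cdot\rangle$ is the inner product on $\mathbb{R}^d$; $\mathrm{dist}(x,A):=\inf\{|x-y|:y\in A\}$; $\partial D$ is the boundary of $D$. Assumptions (A), for a measurable drift $b:\mathbb{R}^d\to\mathbb{R}^d$, an initial condition $x_0$ and a set $D$: $D\subset\mathbb{R}^d$ is open, and there is a measurable set $S\subset\mathbb{R}^d$ such that $x_0\in D$, $D\cap S=\emptyset$, $\partial D\subset S$. The function $\rho:D\to[0,\infty)$, $\rho(x):=\mathrm{dist}(x,S)$, is twice continuously differentiable on $D$. There exist constants (not necessarily those of the claim, and denoted here with tildes) $\tilde c,\tilde\alpha,\tilde l,\tilde h_1,\tilde h_2,\tilde h_3,\tilde h_4>0$ and $1<\tilde\beta<\tilde\alpha$ such that for all $x,y\in D$: (i) $\langle b(x)-b(y),x-y\rangle\le\tilde c|x-y|^2$; (ii) $\langle\nabla\rho(x),b(x)\rangle\ge\tilde h_1\rho(x)^{-\tilde\alpha}-\tilde h_2\rho(x)^{-\tilde\beta}-\tilde h_3-\tilde h_4\rho(x)$; (iii) $|\nabla^2\rho(x)|\le\tilde c(1+\rho(x)^{-\tilde\beta})$; (iv) $|b(x)-b(y)|\le\tilde c(1+\rho(x)^{-\tilde l}+\rho(y)^{-\tilde l})|x-y|$. Conclusion (C): For any $\delta>0$ and $w\in[0,\frac1{3\tilde l}]$, with $b_n(x)=b(x)1_{\{x\in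 D\}\cap\{\rho(x)\ge\delta n^{-w}\}}$ for $n\in\mathbb{N}$, $n\ge1$, and $\kappa_n(t):=\lfloor nt\rfloor/n$, the SDE $dX_t=b(X_t)dt+dW_t$, $X_0=x_0$, has a unique strong solution $(X_t)_{t\ge0}$, the scheme $dX^n_t=b_n(X^n_{\kappa_n(t)})dt+dW_t$, $X^n_0=x_0$, is uniquely well defined for all $t\ge0$, and for any $T>0$ and $p>0$ there exists $C>0$ independent of $n\ge1$ such that $E\sup_{t\in[0,T]}|X^n_t-X_t|^p\le Cn^{-p/2}$.
   Formalization: The error estimate in (C) is proved for 0 < w ≤ 1/(3l̃) only: at w = 0 the truncated drift does not depend on n and the rate n^{-p/2} fails; well-posedness of the scheme is kept for w = 0 too. *)

(* Defs.v *)
From HB Require Import structures.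
From mathcomp Require Export all_boot all_order all_algebra.
From mathcomp Require Export all_classical all_reals all_analysis.

Set Implicit Arguments.
Unset Strict Implicit.
Unset Printing Implicit Defensive.

Import Order.TTheory GRing.Theory Num.Theory.
Import numFieldNormedType.Exports.

Local Open Scope classical_set_scope.
Local Open Scope ring_scope.

Section euclidean_space.
Context {R : realType}.

(* Frobenius norm; on row vectors it is the Euclidean norm. The library norm
   `|A| on matrices is the sup norm: it induces the same topology, but it is
   not the norm meant in the estimates below. *)
Definition fnorm m n (A : 'M[R]_(m, n)) : R :=
  Num.sqrt (\sum_i \sum_j A i j ^+ 2).

Definition dotp d (x y : 'rV[R]_d) : R := \sum_i x 0 i * y 0 i.

Definition vec2 (u v : R) : 'rV[R]_2 := \row_i [:: u; v]`_i.

(* [inf] of the empty set is 0 in the library: only used for A nonempty. *)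
Definition dist d (A : set 'rV[R]_d) (x : 'rV[R]_d) : R :=
  inf [set fnorm (x - y) | y in A].

Definition boundary d (A : set 'rV[R]_d) : set 'rV[R]_d :=
  closure A `\` A°.

Definition borel d : set (set 'rV[R]_d) := <<s open >>.

Definition borel_fun d e (f : 'rV[R]_d -> 'rV[R]_e) : Prop :=
  forall A, borel A -> borel (f @^-1` A).

Definition partial d (f : 'rV[R]_d -> R) (i : 'I_d) (x : 'rV[R]_d) : R :=
  'D_(delta_mx 0 i) f x.

Definition grad d (f : 'rV[R]_d -> R) (x : 'rV[R]_d) : 'rV[R]_d :=
  \row_i partial f i x.

Definition hess d (f : 'rV[R]_d -> R) (x : 'rV[R]_d) : 'M[R]_d :=
  \matrix_(i, j) partial (partial f i) j x.

Definition C1_on d (D : set 'rV[R]_d) (f : 'rV[R]_d -> R) : Prop :=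
  forall x, D x -> differentiable f x /\
    forall i, {for x, continuous (partial f i)}.

Definition C2_on d (D : set 'rV[R]_d) (f : 'rV[R]_d -> R) : Prop :=
  C1_on D f /\ forall i, C1_on D (partial f i).

End euclidean_space.

(* [S_nonempty] expresses that dist(., S) is real-valued on D (inf over the
   empty set being +oo). *)
Record singular_drift (R : realType) d (b : 'rV[R]_d -> 'rV[R]_d)
    (x0 : 'rV[R]_d) (D S : set 'rV[R]_d)
    (c alpha beta l h1 h2 h3 h4 : R) : Prop := SingularDrift {
  drift_borel : borel_fun b ;
  D_open : open D ;
  S_borel : borel S ;
  S_nonempty : S !=set0 ;
  D_x0 : D x0 ;
  DS_disjoint : D `&` S = set0 ;
  boundary_D_S : boundary D `<=` S ;
  rho_C2 : C2_on D (dist S) ;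
  constants_gt0 : [/\ 0 < c, 0 < alpha & 0 < l] /\
    [/\ 0 < h1, 0 < h2, 0 < h3 & 0 < h4] ;
  exponents : 1 < beta < alpha ;
  one_sided_lipschitz : forall x y, D x -> D y ->
    dotp (b x - b y) (x - y) <= c * fnorm (x - y) ^+ 2 ;
  repulsion : forall x, D x ->
    h1 * dist S x `^ (- alpha) - h2 * dist S x `^ (- beta)
      - h3 - h4 * dist S x
    <= dotp (grad (dist S) x) (b x) ;
  hess_bound : forall x, D x ->
    fnorm (hess (dist S) x) <= c * (1 + dist S x `^ (- beta)) ;
  local_lipschitz : forall x y, D x -> D y ->
    fnorm (b x - b y) <=
    c * (1 + dist S x `^ (- l) + dist S y `^ (- l)) * fnorm (x - y) }.

Section additive_noise_sde.
Context {R : realType} {disp : measure_display} {Omega : measurableType disp}.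
Context (P : probability Omega R) {d : nat}.

(* A process is indexed by R, only the times t >= 0 being meaningful;
   likewise for filtrations. *)
Definition process := R -> Omega -> 'rV[R]_d.

Definition filtration (F : R -> set (set Omega)) : Prop :=
  (forall t, 0 <= t -> sigma_algebra setT (F t) /\ F t `<=` measurable) /\
  (forall s t, 0 <= s -> s <= t -> F s `<=` F t).

Definition adapted (F : R -> set (set Omega)) (X : process) : Prop :=
  forall t, 0 <= t -> forall A, borel A -> F t (X t @^-1` A).

Definition continuous_paths (X : process) : Prop :=
  forall w, {within `[0, +oo[, continuous (fun t => X t w)}.

(* [wiener_increments]: W_t - W_s is independent of F_s and has law
   N(0, (t - s) I_d), tested on boxes; the second parameter of [normal_prob]
   is the standard deviation. *)
Record wiener (F : R -> set (set Omega)) (W : process) : Prop := Wiener {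
  wiener_adapted : adapted F W ;
  wiener_continuous : continuous_paths W ;
  wiener0 : {ae P, forall w, W 0 w = 0} ;
  wiener_increments : forall s t (A : set Omega) (B : 'I_d -> set R),
    0 <= s -> s < t -> F s A ->
    (forall i, measurable (B i : set (measurableTypeR R))) ->
    P (A `&` [set w | forall i, B i (W t w 0 i - W s w 0 i)]) =
    (P A * \prod_(i < d) normal_prob 0%R (Num.sqrt (t - s)%R) (B i))%E }.

(* The filtration generated by W, augmented with the P-null events. *)
Definition augmented_filtration (W : process) (t : R) : set (set Omega) :=
  <<s [set A | (exists s B, [/\ 0 <= s <= t, borel B & A = W s @^-1` B]) \/
               (measurable A /\ P A = 0%E)] >>.

(* X solves dX_t = a(X)_t dt + dW_t, X_0 = x0, where the drift functional a
   maps a process to its drift process; since the noise is additive, no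
   stochastic integral is involved. *)
Definition solution (F : R -> set (set Omega)) (W : process) (x0 : 'rV[R]_d)
    (a : process -> process) (X : process) : Prop :=
  [/\ adapted F X, continuous_paths X &
   {ae P, forall w, forall t, 0 <= t -> forall i,
     lebesgue_measure.-integrable `[0, t] (fun s => (a X s w 0 i)%:E) /\
     X t w 0 i = x0 0 i + \int[lebesgue_measure]_(s in `[0, t]) a X s w 0 i
                 + W t w 0 i}].

(* Existence of a solution that is a functional of the noise, and uniqueness
   up to indistinguishability among all F-adapted solutions. *)
Definition unique_strong_solution (F : R -> set (set Omega)) (W : process)
    (x0 : 'rV[R]_d) (a : process -> process) (X : process) : Prop :=
  solution (augmented_filtration W) W x0 a X /\
  forall Y, solution F W x0 a Y ->
    {ae P, forall w, forall t, 0 <= t -> Y t w = X t w}.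

Definition sde_drift (b : 'rV[R]_d -> 'rV[R]_d) (X : process) : process :=
  fun t w => b (X t w).

Definition grid (n : nat) (t : R) : R :=
  (Num.floor (n%:R * t))%:~R / n%:R.

Definition euler_drift (n : nat) (b : 'rV[R]_d -> 'rV[R]_d) (X : process)
    : process :=
  fun t w => b (X (grid n t) w).

End additive_noise_sde.

Definition truncated_drift (R : realType) d (b : 'rV[R]_d -> 'rV[R]_d)
    (D S : set 'rV[R]_d) (delta w : R) (n : nat) (x : 'rV[R]_d) : 'rV[R]_d :=
  \1_(D `&` [set y | delta * n%:R `^ (- w) <= dist S y]) x *: b x.

(* For w = 0 the truncated drift does not depend on n: it is cut off below the
   fixed level delta, and the scheme does not converge to X when delta is large.
   Hence the rate is asserted for w > 0 only; well-posedness of the scheme is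
   asserted for w = 0 too. *)
Definition euler_convergence (R : realType) d (b : 'rV[R]_d -> 'rV[R]_d)
    (x0 : 'rV[R]_d) (D S : set 'rV[R]_d) (l : R) : Prop :=
  forall (disp : measure_display) (Omega : measurableType disp)
    (P : probability Omega R) (F : R -> set (set Omega))
    (W : @process R disp Omega d),
  filtration F -> wiener P F W ->
  exists X : @process R disp Omega d,
    unique_strong_solution P F W x0 (sde_drift b) X /\
    forall delta w : R, 0 < delta -> 0 <= w <= 1 / (3 * l) ->
    exists Xn : nat -> @process R disp Omega d,
      (forall n, (1 <= n)%N ->
        unique_strong_solution P F W x0
          (euler_drift n (truncated_drift b D S delta w n)) (Xn n)) /\
      (0 < w -> forall T p : R, 0 < T -> 0 < p ->
        exists2 C : R, 0 < C & forall n, (1 <= n)%N ->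
          (\int[P]_om ereal_sup
             [set (fnorm (Xn n t om - X t om) `^ p)%:E | t in `[0%R, T]]
           <= (C * n%:R `^ (- (p / 2)))%:E)%E).

(* Main.v *)
(* D = {x1 < x2} is a half-space, and for every admissible S the distance to S is on D the linear
   function rho x = <v, x> with v = (-1, 1) / sqrt 2: the foot of the perpendicular from x lies on
   the boundary of D, hence in S. So grad rho = v and hess rho = 0.

   The noise is additive, and the rest is an argument along single paths w with
   |w t - w s| <= H |t - s|^(1/theta), where 2 < theta < min(3, 1 + alpha).
   - One explicit Euler step with time step h is stable under the one-sided Lipschitz condition up
     to a factor 1 + h (c + M) when h L^2 <= M. Comparing the scheme with a path that follows the
     noise and is pushed away from the boundary bounds it by C H.
   - Near the boundary the repulsion beats the noise: a descent of rho from 2 eps to eps is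
     impossible for eps = c0 H^-q. So for n above a power of H the scheme stays in
     {rho >= eps}, where b is Lipschitz with a constant polynomial in H.
   - Hence the schemes form a Cauchy sequence; the limit solves the equation, and any solution
     coincides with it, by comparison with the schemes up to the first time rho = eps / 4.
   - The same comparison gives |X^n - X| <= C H^Q (n^(-1/2) + (1/n) sum_j M_j), with M_j the
     oscillation of w over the j-th step.

   H and M_j are bounded through sums of 2m-th powers of dyadic increments (Kolmogorov chaining),
   whose expectation over an interval of length tau is O(tau^m); a large m gives the rate in L^p. *)
Require Import Defs.
From mathcomp Require Import ring lra measurable_realfun.

Set Implicit Arguments.
Unset Strict Implicit.
Unset Printing Implicit Defensive.

Import Order.TTheory GRing.Theory Num.Theory.
Import numFieldNormedType.Exports.

Local Open Scope classical_set_scope.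
Local Open Scope ring_scope.

(** The obstacle is that an explicit scheme meets a drift which is singular at the boundary, and
    that the scheme may jump over the boundary. Estimates must therefore be available before the
    position of the scheme is known. The bound w <= 1 / (3 l) makes this possible: above the level
    delta n^(-w) the drift has a Lipschitz constant L of order n^(1/3), so n^-1 L^2 stays bounded
    and the drift moves the scheme by order n^(-2/3) in one step.

    Two requirements meet in the Hoelder exponent 1 / theta. Wiener paths force theta > 2, and the
    repulsion beats the noise when theta < 1 + alpha; alpha > 1 leaves room for both. But n^(-1 /
    theta) is worse than n^(-1/2). Hoelder bounds therefore serve to locate the scheme and to
    construct the solution, while the rate comes from the oscillations M_j, whose moments have the
    right order.

    All constants depend polynomially on H, and all thresholds for n are powers of H. So nothing is
    lost when H, which has moments of all orders, is integrated at the end. *)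

Section euclidean_algebra.
Context {R : realType} {d : nat}.
Implicit Types x y z : 'rV[R]_d.

Lemma dotpC x y : dotp x y = dotp y x.
Proof. by apply: eq_bigr => i _; rewrite mulrC. Qed.

Lemma dotpDl x y z : dotp (x + y) z = dotp x z + dotp y z.
Proof. by rewrite -big_split; apply: eq_bigr => i _; rewrite mxE mulrDl. Qed.

Lemma dotpZl a x y : dotp (a *: x) y = a * dotp x y.
Proof. by rewrite /dotp mulr_sumr; apply: eq_bigr => i _; rewrite mxE mulrA. Qed.

Lemma dotpNl x y : dotp (- x) y = - dotp x y.
Proof. by rewrite -scaleN1r dotpZl mulN1r. Qed.

Lemma dotpDr x y z : dotp x (y + z) = dotp x y + dotp x z.
Proof. by rewrite dotpC dotpDl !(dotpC x). Qed.

Lemma dotpZr a x y : dotp x (a *: y) = a * dotp x y.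
Proof. by rewrite dotpC dotpZl dotpC. Qed.

Lemma dotpNr x y : dotp x (- y) = - dotp x y.
Proof. by rewrite dotpC dotpNl dotpC. Qed.

Lemma dotpBl x y z : dotp (x - y) z = dotp x z - dotp y z.
Proof. by rewrite dotpDl dotpNl. Qed.

Lemma dotpBr x y z : dotp x (y - z) = dotp x y - dotp x z.
Proof. by rewrite dotpDr dotpNr. Qed.

Lemma dotpr0 x : dotp x 0 = 0.
Proof. by rewrite /dotp big1// => i _; rewrite mxE mulr0. Qed.

Lemma dotp_ge0 x : 0 <= dotp x x.
Proof. by apply: sumr_ge0 => i _; rewrite -expr2 sqr_ge0. Qed.

Lemma fnormE x : fnorm x = Num.sqrt (dotp x x).
Proof.
by rewrite /fnorm big_ord1; congr Num.sqrt; apply: eq_bigr => i _; rewrite expr2.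
Qed.

Lemma sqr_fnorm x : fnorm x ^+ 2 = dotp x x.
Proof. by rewrite fnormE sqr_sqrtr// dotp_ge0. Qed.

Lemma fnorm_ge0 x : 0 <= fnorm x.
Proof. by rewrite sqrtr_ge0. Qed.

Lemma fnorm0 : fnorm (0 : 'rV[R]_d) = 0.
Proof. by rewrite fnormE /dotp big1 ?sqrtr0// => i _; rewrite mxE mul0r. Qed.

Lemma fnorm_eq0 x : fnorm x = 0 -> x = 0.
Proof.
move=> /eqP; rewrite fnormE sqrtr_eq0 => x0.
have /eqP : dotp x x = 0 by apply/eqP; rewrite eq_le x0 dotp_ge0.
rewrite psumr_eq0; last by move=> i _; rewrite -expr2 sqr_ge0.
move=> /allP x00; apply/rowP => i; rewrite mxE.
have := x00 i; rewrite mem_index_enum => /(_ isT) /=.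
by rewrite mulf_eq0 orbb => /eqP.
Qed.

Lemma fnormZ a x : fnorm (a *: x) = `|a| * fnorm x.
Proof.
by rewrite !fnormE dotpZl dotpZr mulrA -expr2 sqrtrM ?sqr_ge0// sqrtr_sqr.
Qed.

Lemma fnormN x : fnorm (- x) = fnorm x.
Proof. by rewrite -scaleN1r fnormZ normrN1 mul1r. Qed.

Lemma fnormB x y : fnorm (x - y) = fnorm (y - x).
Proof. by rewrite -fnormN opprB. Qed.

Lemma dotp_le x y : dotp x y <= fnorm x * fnorm y.
Proof.
have [y0|y0] := eqVneq (fnorm y) 0.
  by rewrite y0 mulr0 (fnorm_eq0 y0) dotpr0.
have {}y0 : 0 < fnorm y by rewrite lt_neqAle eq_sym y0 fnorm_ge0.
have := dotp_ge0 (fnorm y ^+ 2 *: x - dotp x y *: y).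
rewrite dotpBl !dotpBr !dotpZl !dotpZr -!sqr_fnorm (dotpC y x) => H.
have {}H : 0 <= fnorm y ^+ 2 * ((fnorm x * fnorm y) ^+ 2 - dotp x y ^+ 2).
  apply: (le_trans H); rewrite le_eqVlt; apply/orP; left; apply/eqP; ring.
rewrite pmulr_rge0 ?exprn_gt0// subr_ge0 in H.
rewrite real_leNgt ?num_real//; apply/negP => lt.
have : (fnorm x * fnorm y) ^+ 2 < dotp x y ^+ 2.
  by rewrite ltr_pXn2r// nnegrE ?(le_trans _ (ltW lt))// ?mulr_ge0 ?fnorm_ge0.
by rewrite ltNge H.
Qed.

Lemma normr_dotp x y : `|dotp x y| <= fnorm x * fnorm y.
Proof. by rewrite ler_norml lerNl -dotpNl -{1}(fnormN x) !dotp_le. Qed.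

Lemma fnormD x y : fnorm (x + y) <= fnorm x + fnorm y.
Proof.
rewrite -(@ler_pXn2r _ 2)// ?nnegrE ?addr_ge0 ?fnorm_ge0//.
rewrite sqr_fnorm dotpDl !dotpDr (dotpC y x) -!sqr_fnorm.
have := dotp_le x y; lra.
Qed.

Lemma fnorm_triangle y x z : fnorm (x - z) <= fnorm (x - y) + fnorm (y - z).
Proof. by rewrite -[x - z](subrKA y) fnormD. Qed.

Lemma fnorm_leD x y : fnorm x <= fnorm y + fnorm (x - y).
Proof. by rewrite -[x in fnorm x](subrKC y) fnormD. Qed.

Lemma fnorm_sum (I : Type) (r : seq I) (F : I -> 'rV[R]_d) :
  fnorm (\sum_(i <- r) F i) <= \sum_(i <- r) fnorm (F i).
Proof.
elim/big_ind2 : _ => [|u a v b ua vb|//]; first by rewrite fnorm0.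
by rewrite (le_trans (fnormD _ _)) ?lerD.
Qed.

Lemma normr_coord_le x i : `|x 0 i| <= fnorm x.
Proof.
rewrite fnormE -sqrtr_sqr ler_wsqrtr// /dotp (bigD1 i)//= -expr2 lerDl.
by apply: sumr_ge0 => j _; rewrite -expr2 sqr_ge0.
Qed.

Lemma fnorm_le_sum x : fnorm x <= \sum_i `|x 0 i|.
Proof.
rewrite {1}[x]row_sum_delta.
apply: le_trans (fnorm_sum _ _) _; apply: ler_sum => i _.
rewrite fnormZ ler_piMr//.
rewrite fnormE /dotp (bigD1 i)//= big1 ?addr0 ?mxE ?eqxx ?mulr1 ?sqrtr1//.
by move=> j ji; rewrite !mxE (negPf ji) mulr0.
Qed.

End euclidean_algebra.

(** * One explicit step and the discrete Gronwall inequality *)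

Section discrete_estimates.
Context {R : realType}.

(** Expanding the square leaves h^2 |p - q|^2, which the one-sided condition does not control; h L^2
    <= M turns it into h M |x - y|^2. So L may grow like h^(-1/2). *)
Lemma one_step_stability d (c h L M : R) (x y p q : 'rV[R]_d) :
  0 <= c -> 0 <= h -> 0 <= M -> h * L ^+ 2 <= M ->
  dotp (p - q) (x - y) <= c * fnorm (x - y) ^+ 2 ->
  fnorm (p - q) <= L * fnorm (x - y) ->
  fnorm (x - y + h *: (p - q)) <= (1 + h * (c + M)) * fnorm (x - y).
Proof.
move: (x - y) (p - q) => u z c0 h0 M0 hL osl lip.
have f0 := fnorm_ge0 u; have g0 := fnorm_ge0 z.
rewrite -(@ler_pXn2r _ 2)// ?nnegrE ?fnorm_ge0//; last first.
  by rewrite mulr_ge0// addr_ge0// mulr_ge0// addr_ge0.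
rewrite sqr_fnorm dotpDl !dotpDr !dotpZl !dotpZr (dotpC u) -!sqr_fnorm.
move: osl lip f0 g0; set s := dotp _ _; set f := fnorm _; set g := fnorm _.
move=> osl lip f0 g0.
have g2 : g ^+ 2 <= L ^+ 2 * f ^+ 2 by rewrite -exprMn ler_pXn2r// nnegrE (le_trans g0).
have hs : h * s <= h * (c * f ^+ 2) by rewrite ler_wpM2l.
have h1 : h * g ^+ 2 <= M * f ^+ 2.
  apply: (@le_trans _ _ (h * (L ^+ 2 * f ^+ 2))); first by rewrite ler_wpM2l.
  by rewrite mulrA ler_wpM2r// sqr_ge0.
have h2 : h * (h * g ^+ 2) <= h * (M * f ^+ 2) by rewrite ler_wpM2l.
have h3 : 0 <= h * M * f ^+ 2 by rewrite !mulr_ge0// sqr_ge0.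
have h4 : 0 <= (h * (c + M) * f) ^+ 2 by rewrite sqr_ge0.
nra.
Qed.

Lemma discrete_gronwall (C h : R) (a r : nat -> R) (K : nat) :
  0 <= h -> 0 <= C -> (forall k, (k < K)%N -> 0 <= r k) ->
  (forall k, (k < K)%N -> a k.+1 <= (1 + h * C) * a k + r k) -> 0 <= a 0 ->
  forall k, (k <= K)%N ->
    a k <= expR (C * (k%:R * h)) * (a 0 + \sum_(j < k) r j).
Proof.
move=> h0 C0 r0 step a0 k kK.
have hC : 1 <= 1 + h * C by rewrite lerDl mulr_ge0.
have pow i : 1 <= (1 + h * C) ^+ i by rewrite exprn_ege1.
suff aux : a k <= (1 + h * C) ^+ k * (a 0 + \sum_(j < k) r j).
  apply: (le_trans aux); rewrite ler_wpM2r//.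
    by rewrite addr_ge0// sumr_ge0// => j _; rewrite r0// (leq_trans _ kK).
  rewrite (_ : C * (k%:R * h) = k%:R * (h * C)); last by ring.
  rewrite expRM_natl lerXn2r ?nnegrE ?expR_ge0 ?expR_ge1Dx//.
  exact: le_trans hC.
elim: k kK => [_|k IH kK]; first by rewrite big_ord0 expr0 mul1r addr0.
apply: (le_trans (step _ kK)); rewrite big_ord_recr /= addrA mulrDr lerD//.
- by rewrite exprS -mulrA ler_wpM2l ?(le_trans _ hC)// IH// ltnW.
- by rewrite ler_peMl// r0.
Qed.

End discrete_estimates.

(* The half-space [0 < dotp v x] plays the role of D and [dotp v] that of rho. *)
Record repulsive_drift (R : realType) d (v : 'rV[R]_d)
    (b : 'rV[R]_d -> 'rV[R]_d) (x0 : 'rV[R]_d) (c l al eta kap : R) : Prop :=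
  RepulsiveDrift {
  rd_unit : fnorm v = 1 ;
  rd_x0 : 0 < dotp v x0 ;
  rd_c : 0 < c ;
  rd_l : 0 < l ;
  rd_eta : 0 < eta ;
  rd_kap : 0 < kap ;
  rd_al : 1 < al ;
  rd_osl : forall x y, 0 < dotp v x -> 0 < dotp v y ->
    dotp (b x - b y) (x - y) <= c * fnorm (x - y) ^+ 2 ;
  rd_rep : forall x, 0 < dotp v x <= eta ->
    kap * dotp v x `^ (- al) <= dotp v (b x) ;
  rd_lip : forall x y, 0 < dotp v x -> 0 < dotp v y ->
    fnorm (b x - b y) <=
    c * (1 + dotp v x `^ (- l) + dotp v y `^ (- l)) * fnorm (x - y) }.

Section euler_grid.
Context {R : realType} {d : nat}.
Implicit Types (v x : 'rV[R]_d) (b : 'rV[R]_d -> 'rV[R]_d) (w : R -> 'rV[R]_d).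

(** For tau > 0 this is [truncated_drift] on the half-space: a point with tau <= dotp v x already
    lies in D. *)
Definition cutoff v (tau : R) b x : 'rV[R]_d :=
  if tau <= dotp v x then b x else 0.

Fixpoint euler_grid b x0 w (n k : nat) : 'rV[R]_d :=
  if k is k'.+1 then
    let e := euler_grid b x0 w n k' in
    e + n%:R^-1 *: b e + (w (k'.+1%:R / n%:R) - w (k'%:R / n%:R))
  else x0.

Lemma ler_powRN (l s t : R) : 0 < l -> 0 < s -> s <= t -> t `^ (- l) <= s `^ (- l).
Proof.
move=> l0 s0 st; have t0 := lt_le_trans s0 st.
by rewrite !powRN lef_pV2 ?posrE ?powR_gt0// ge0_ler_powR ?nnegrE// ?ltW.
Qed.

Lemma normr_dotp_unit v x : fnorm v = 1 -> `|dotp v x| <= fnorm x.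
Proof. by move=> v1; rewrite (le_trans (normr_dotp _ _))// v1 mul1r. Qed.

End euler_grid.

(** * A priori bounds and lower barrier for the scheme on the grid *)

Section grid_estimates.
Context {R : realType} {d : nat} {v : 'rV[R]_d} {b : 'rV[R]_d -> 'rV[R]_d}.
Context {x0 : 'rV[R]_d} {c l al eta kap : R}.
Context (hb : repulsive_drift v b x0 c l al eta kap).

Let r0 := dotp v x0.

(* Lipschitz constant of b between {rho >= t} and {rho >= rho x0}. *)
Definition lip_at (t : R) := c * (1 + t `^ (- l) + r0 `^ (- l)).

(** Bounds b along the reference path [y] below, which stays within 2 S of x0 and no closer to the
    boundary than x0. *)
Definition ref_bound (S : R) := fnorm (b x0) + lip_at r0 * (2 * S).

Lemma lip_at_ge0 t : 0 <= lip_at t.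
Proof.
by rewrite mulr_ge0 ?(ltW (rd_c hb))// !addr_ge0// powR_ge0.
Qed.

Lemma ref_bound_ge0 S : 0 <= S -> 0 <= ref_bound S.
Proof.
by move=> S0; rewrite addr_ge0 ?fnorm_ge0// mulr_ge0 ?lip_at_ge0// mulr_ge0.
Qed.

Section a_priori.
Context (w : R -> 'rV[R]_d) (n K : nat) (tau S M N : R).
Context (n0 : (0 < n)%N) (tau0 : 0 < tau) (M0 : 0 <= M).
Context (wS : forall k, (k <= K)%N -> fnorm (w (k%:R / n%:R)) <= S).
Context (w0 : w 0 = 0) (hM : n%:R^-1 * lip_at tau ^+ 2 <= M) (KN : K%:R / n%:R <= N).

Let X := euler_grid (cutoff v tau b) x0 w n.
(* The reference path follows the noise but is pushed away from the boundary, so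
   that b stays bounded along it. *)
Let y k := x0 + w (k%:R / n%:R) + S *: v.

Let S0 : 0 <= S. Proof. exact: le_trans (fnorm_ge0 _) (wS (leq0n K)). Qed.

(** The noise lowers rho by at most S, and the shift by S v gives this back. *)
Let y_D k : (k <= K)%N -> r0 <= dotp v (y k).
Proof.
move=> kK; rewrite /y !dotpDr dotpZr -sqr_fnorm (rd_unit hb) expr1n mulr1.
have := le_trans (normr_dotp_unit (w (k%:R / n%:R)) (rd_unit hb)) (wS kK).
by rewrite ler_norml => /andP[]; rewrite /r0; lra.
Qed.

Let y_dist k : (k <= K)%N -> fnorm (y k - x0) <= 2 * S.
Proof.
move=> kK; rewrite (_ : _ - x0 = w (k%:R / n%:R) + S *: v); last first.
  by rewrite /y; apply/rowP => i; rewrite !mxE; ring.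
rewrite (le_trans (fnormD _ _))//.
by rewrite fnormZ (rd_unit hb) mulr1 (ger0_norm S0) mulr2n mulrDl mul1r lerD// wS.
Qed.

Let by_le k : (k <= K)%N -> fnorm (b (y k)) <= ref_bound S.
Proof.
move=> kK; apply: (le_trans (fnorm_leD _ (b x0))); rewrite lerD2l.
have r00 := rd_x0 hb; have yD := y_D kK.
apply: (le_trans (rd_lip hb (lt_le_trans r00 yD) r00)).
rewrite ler_pM ?fnorm_ge0 ?y_dist//.
  by rewrite mulr_ge0 ?(ltW (rd_c hb))// !addr_ge0// powR_ge0.
by rewrite ler_wpM2l ?(ltW (rd_c hb))// lerD2r lerD2l ler_powRN ?(rd_l hb).
Qed.

Let lip_y x k : tau <= dotp v x -> (k <= K)%N ->
  fnorm (b x - b (y k)) <= lip_at tau * fnorm (x - y k).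
Proof.
move=> tx kK; have r00 := rd_x0 hb; have yD := y_D kK.
apply: (le_trans (rd_lip hb (lt_le_trans tau0 tx) (lt_le_trans r00 yD))).
rewrite ler_wpM2r ?fnorm_ge0// ler_wpM2l ?(ltW (rd_c hb))//.
by rewrite -!addrA lerD2l lerD// ler_powRN ?(rd_l hb).
Qed.

(** Gronwall's bound for the distance to the reference path: it starts at S, the length of S v, and
    grows by at most [ref_bound S] per unit time, up to time N. *)
Definition apriori_bound (S M N : R) := expR ((c + M) * N) * (S + N * ref_bound S).

(** Both paths carry the same noise, which cancels. Above tau, write b(X) = (b(X) - b(y)) + b(y):
    stability of one step handles the first part, boundedness of b along y the second. *)
Lemma euler_grid_near_ref k : (k <= K)%N -> fnorm (X k - y k) <= apriori_bound S M N.
Proof.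
move=> kK; have c0 := rd_c hb.
have h0 : 0 <= n%:R^-1 :> R by rewrite invr_ge0.
pose a k := fnorm (X k - y k).
have stp j : (j < K)%N -> a j.+1 <= (1 + n%:R^-1 * (c + M)) * a j + n%:R^-1 * ref_bound S.
  move=> jK; rewrite /a /X /= -/X -/(X j).
  rewrite (_ : _ - y j.+1 = X j - y j + n%:R^-1 *: cutoff v tau b (X j)); last first.
    by rewrite /y; apply/rowP => i; rewrite !mxE; ring.
  (* Below tau the scheme follows the noise alone, as [y] does, so the distance does not change. *)
  rewrite /cutoff; case: ifP => tX; last first.
    rewrite scaler0 addr0 -[leLHS]addr0 lerD//.
      by rewrite ler_peMl ?fnorm_ge0// lerDl mulr_ge0// addr_ge0// ltW.
    by rewrite mulr_ge0// ref_bound_ge0.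
  rewrite -[b (X j)](subrK (b (y j))) scalerDr addrA (le_trans (fnormD _ _))//.
  rewrite lerD//.
    apply: (one_step_stability (ltW c0) h0 M0 hM).
    - by apply: (rd_osl hb); rewrite (lt_le_trans _ tX, lt_le_trans (rd_x0 hb) (y_D (ltnW jK))).
    - by apply: lip_y => //; exact: ltnW.
  by rewrite fnormZ ger0_norm// ler_wpM2l// by_le// ltnW.
have := @discrete_gronwall R (c + M) n%:R^-1 a (fun=> n%:R^-1 * ref_bound S) K h0
  (addr_ge0 (ltW c0) M0) _ stp (fnorm_ge0 _) k kK.
move=> /(_ (fun _ _ => mulr_ge0 h0 (ref_bound_ge0 S0))) /le_trans; apply.
have kN : k%:R * n%:R^-1 <= N by rewrite (le_trans _ KN)// ler_wpM2r// ler_nat.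
rewrite /apriori_bound ler_pM ?expR_ge0//.
- by rewrite addr_ge0 ?fnorm_ge0// sumr_ge0// => _ _; rewrite mulr_ge0 ?ref_bound_ge0.
- by rewrite ler_expR ler_wpM2l// addr_ge0// ltW.
rewrite lerD//.
  rewrite /a /X /= /y mul0r w0 addr0 opprD addrA subrr add0r fnormN fnormZ.
  by rewrite (rd_unit hb) mulr1 ger0_norm.
by rewrite sumr_const card_ord -[_ *+ k]mulr_natl mulrA ler_wpM2r// ref_bound_ge0.
Qed.

Lemma euler_grid_bound k : (k <= K)%N ->
  fnorm (X k) <= fnorm x0 + 2 * S + apriori_bound S M N.
Proof.
move=> kK; apply: (le_trans (fnorm_leD _ (y k))).
rewrite lerD ?euler_grid_near_ref//.
by apply: (le_trans (fnorm_leD _ x0)); rewrite lerD2l y_dist.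
Qed.

(** The disjunction serves two uses. With t = tau it covers every grid point, since the cut-off
    drift vanishes below tau; a larger t gives a better bound at points known to lie above t. *)
Lemma cutoff_grid_bound t k : tau <= t -> (k <= K)%N ->
  (t <= dotp v (X k) \/ t = tau) ->
  fnorm (cutoff v tau b (X k)) <= ref_bound S + lip_at t * apriori_bound S M N.
Proof.
move=> taut kK tX; have Z := euler_grid_near_ref kK.
have Z0 := le_trans (fnorm_ge0 _) Z.
rewrite /cutoff; case: ifP => [tauX|_]; last first.
  by rewrite fnorm0 addr_ge0 ?ref_bound_ge0// mulr_ge0// lip_at_ge0.
have {}tX : t <= dotp v (X k) by case: tX => // ->.
apply: (le_trans (fnorm_leD _ (b (y k)))); rewrite lerD ?by_le//.
have r00 := rd_x0 hb; have yD := y_D kK.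
have t0 := lt_le_trans tau0 taut.
apply: (le_trans (rd_lip hb (lt_le_trans t0 tX) (lt_le_trans r00 yD))).
rewrite ler_pM ?fnorm_ge0//; first by rewrite mulr_ge0 ?(ltW (rd_c hb))// !addr_ge0// powR_ge0.
rewrite ler_wpM2l ?(ltW (rd_c hb))//.
by rewrite -!addrA lerD2l lerD// ler_powRN ?(rd_l hb).
Qed.

End a_priori.

(** Let k be the first index below eps and j the last one before it at height at least 2 eps. In
    between, the height lies in [eps, 3 eps], so each step gains at least kap (3 eps)^-al / n. Over
    the time u = (k - j) / n the noise takes away at most H u^ga, and the condition on u keeps the
    net loss below eps. *)
Lemma euler_grid_lower_bound (w : R -> 'rV[R]_d) (n K : nat) (tau eps H ga : R) :
  (0 < n)%N -> 0 < eps -> tau <= eps -> 3 * eps <= eta -> 2 * eps <= r0 ->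
  let X := euler_grid (cutoff v tau b) x0 w n in
  (forall k, (k < K)%N -> fnorm (X k.+1 - X k) <= eps) ->
  (forall j k, (j <= k <= K)%N ->
    fnorm (w (k%:R / n%:R) - w (j%:R / n%:R)) <= H * ((k - j)%:R / n%:R) `^ ga) ->
  (forall u, 0 < u -> H * u `^ ga < eps + kap * (3 * eps) `^ (- al) * u) ->
  forall k, (k <= K)%N -> eps <= dotp v (X k).
Proof.
move=> n0 e0 te e3 e2 X osc wH noc k0 k0K; rewrite leNgt; apply/negP => k0e.
have exk : exists k, dotp v (X k) < eps by exists k0.
case: (ex_minnP exk) => k kP kmin.
have kK : (k <= K)%N by rewrite (leq_trans _ k0K)// kmin.
have exj : exists j, (j <= k)%N && (2 * eps <= dotp v (X j)) by exists 0%N.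
case: (@ex_maxnP (fun j => (j <= k)%N && (2 * eps <= dotp v (X j))) k exj) => [i /andP[]//|j /andP[jk jP] jmax].
have {}jk : (j < k)%N.
  rewrite ltn_neqAle jk andbT; apply/negP => /eqP jk'; move: jP kP; rewrite jk'; lra.
have lo i : (i < k)%N -> eps <= dotp v (X i).
  by move=> ik; rewrite leNgt; apply/negP => /kmin; rewrite leqNgt ik.
have hi' i : (j < i <= k)%N -> dotp v (X i) < 2 * eps.
  by case/andP=> ji ik; rewrite ltNge; apply/negP => P; have := jmax i; rewrite ik P leqNgt ji => /(_ isT).
(* The point j itself may lie above 2 eps, but its successor is below 2 eps and one step changes the
   height by at most eps. *)
have hi i : (j <= i < k)%N -> dotp v (X i) <= 3 * eps.
  case/andP=> ji ik.
  have : dotp v (X i.+1) < 2 * eps by rewrite hi'// ltnS ji.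
  have := osc i (leq_trans ik kK).
  have := normr_dotp_unit (X i.+1 - X i) (rd_unit hb).
  rewrite dotpBr ler_norml => /andP[]; lra.
have incr i : (j <= i <= k)%N -> dotp v (X j) + (i - j)%:R / n%:R * (kap * (3 * eps) `^ (- al))
    + dotp v (w (i%:R / n%:R) - w (j%:R / n%:R)) <= dotp v (X i).
  elim: i => [|i IH]; first by rewrite leqn0 => /andP[/eqP -> _]; rewrite subnn subrr !mul0r dotpr0 !addr0.
  case/andP; rewrite leq_eqVlt => /orP[/eqP ji|ji] ik.
    by rewrite ji subnn subrr !mul0r dotpr0 !addr0.
  have {}IH := IH (introT andP (conj ji (ltnW ik))).
  have elo := lo i ik; have ehi := hi i (introT andP (conj ji ik)).
  rewrite /X /= -/X -/(X i) /cutoff (le_trans te elo) !dotpDr dotpZr.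
  have drift : kap * (3 * eps) `^ (- al) <= dotp v (b (X i)).
    apply: le_trans (rd_rep hb _); last by rewrite (lt_le_trans e0 elo) (le_trans ehi).
    rewrite ler_pM2l ?(rd_kap hb)// ler_powRN ?(lt_le_trans e0 elo)//.
    exact: lt_trans (rd_al hb).
  have n1 : 0 <= n%:R^-1 :> R by rewrite invr_ge0.
  have := ler_wpM2l n1 drift.
  rewrite subSn// -[(i - j).+1]addn1 natrD !dotpNr.
  move: IH; rewrite !dotpDr !dotpNr; lra.
have := incr k; rewrite (ltnW jk) leqnn => /(_ isT).
have u0 : 0 < (k - j)%:R / n%:R :> R by rewrite divr_gt0// ltr0n ?subn_gt0.
have := noc _ u0.
have := wH j k; rewrite (ltnW jk) kK => /(_ isT).
have := normr_dotp_unit (w (k%:R / n%:R) - w (j%:R / n%:R)) (rd_unit hb).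
rewrite ler_norml => /andP[]; lra.
Qed.

End grid_estimates.

(** * Choice of exponents and thresholds *)

Section exponents.
Context {R : realType}.

Lemma exists_nat_ge (x : R) : exists n : nat, x <= n%:R.
Proof. by exists (Num.truncn x).+1; rewrite ltW// truncnS_gt. Qed.

Lemma powR_le_expn (H q : R) (m : nat) : 1 <= H -> q <= m%:R -> H `^ q <= H ^+ m.
Proof.
move=> H1 qm; rewrite -powR_mulrn ?(le_trans ler01)//.
by rewrite ler_powR.
Qed.

Lemma powRD_gt0 (x r s : R) : 0 < x -> x `^ (r + s) = x `^ r * x `^ s.
Proof. by move=> x0; rewrite powRD// (gt_eqF x0) implybT. Qed.

(** Turns smallness of a negative power of x into a threshold that is a power of H: A = C^(1/a) and
    Q >= q/a. *)
Lemma powR_small (a C : R) (q : nat) : 0 < a -> 0 < C ->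
  exists A (Q : nat), 0 < A /\ forall H x : R, 1 <= H -> A * H ^+ Q <= x ->
    C * H ^+ q * x `^ (- a) <= 1.
Proof.
move=> a0 C0; have [Q hQ] := exists_nat_ge (q%:R / a).
exists (C `^ a^-1), Q; split=> [|H x H1 Hx]; first exact: powR_gt0.
have H0 : 0 < H by exact: lt_le_trans H1.
have x0 : 0 < x by apply: lt_le_trans Hx; rewrite mulr_gt0 ?powR_gt0 ?exprn_gt0.
rewrite powRN ler_pdivrMr ?powR_gt0// mul1r.
have : (C `^ a^-1 * H `^ (q%:R / a)) `^ a <= x `^ a.
  rewrite ge0_ler_powR ?nnegrE ?(ltW a0) ?(ltW x0) ?mulr_ge0 ?powR_ge0//.
  apply: le_trans Hx; rewrite ler_pM2l ?powR_gt0//.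
  exact: powR_le_expn.
rewrite powRM ?powR_ge0// -!powRrM mulVf ?gt_eqF//.
rewrite powRr1 ?(ltW C0)//.
rewrite divfK ?gt_eqF//.
by rewrite powR_mulrn// ltW.
Qed.

(* The noise moves by [H u ^ (1 / th)] in time u. Started at height 2 eps the
   repulsion [kap (3 eps) ^ - al] beats it: over times [u < (eps / H) ^ th] the
   noise is below eps, and over longer times the drift dominates. *)
Lemma no_crossing (th al kap m : R) : 1 < th -> th < 1 + al -> 0 < kap -> 0 < m ->
  exists c0 (q : nat), [/\ 0 < c0, (0 < q)%N, c0 <= m & forall H u : R, 1 <= H -> 0 < u ->
    H * u `^ th^-1 < c0 * H ^- q + kap * (3 * (c0 * H ^- q)) `^ (- al) * u].
Proof.
move=> th1 thal kap0 m0.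
have th0 : 0 < th by lra.
(* When u >= (e / H)^th, one has u^(1 - 1/th) >= (e / H)^(th - 1), so the drift dominates as soon as
   H^th < k3 e^(-a) with this exponent a. *)
pose a := al - th + 1; have a0 : 0 < a by rewrite /a; lra.
have al0 : 0 < al by lra.
have [q hq] := exists_nat_ge (th / a).
pose k3 := kap * 3 `^ (- al).
have k30 : 0 < k3 by rewrite mulr_gt0 ?powR_gt0.
(* With e = c0 H^-q, e^(-a) equals H^(q a) / c0^a. Then q a >= th takes care of H, and c0^a <= k3 /
   2 gives the strict inequality. *)
pose c0 := Num.min m ((k3 / 2) `^ a^-1).
have c00 : 0 < c0 by rewrite lt_min m0 powR_gt0// divr_gt0.
exists c0, q; split=> [//|||H u H1 u0].
- by rewrite -(ltr_nat R) (lt_le_trans _ hq)// divr_gt0.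
- by rewrite ge_min lexx.
have H0 : 0 < H by exact: lt_le_trans H1.
pose e := c0 * H ^- q; rewrite -/e.
have e0 : 0 < e by rewrite mulr_gt0// invr_gt0 exprn_gt0.
rewrite powRM ?ltW// mulrA -/k3.
have [small|big] := ltP (H * u `^ th^-1) e.
  apply: (lt_le_trans small); rewrite lerDl !mulr_ge0 ?powR_ge0// ltW//.
rewrite ltr_wpDl ?(ltW e0)//.
have u1 : e / H <= u `^ th^-1 by rewrite ler_pdivrMr// mulrC.
have eH0 : 0 < e / H by rewrite divr_gt0.
have u2 : (e / H) `^ (th - 1) <= u `^ (1 - th^-1).
  rewrite (_ : 1 - th^-1 = th^-1 * (th - 1)) ?powRrM.
    by rewrite ge0_ler_powR ?nnegrE ?powR_ge0 ?(ltW eH0)// subr_ge0 ltW.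
  by rewrite mulrBr mulr1 mulVf// gt_eqF.
have uE : u = u `^ (1 - th^-1) * u `^ th^-1.
  by rewrite -powRD_gt0// subrK powRr1// ltW.
rewrite {2}uE mulrA ltr_pM2r ?powR_gt0//.
suff key : H `^ th < k3 * e `^ (- a).
  apply: (@lt_le_trans _ _ (k3 * e `^ (- al) * (e / H) `^ (th - 1))); last first.
    by rewrite ler_pM2l// mulr_gt0 ?powR_gt0.
  have -> : (e / H) `^ (th - 1) = e `^ (th - 1) * (H `^ (th - 1))^-1.
    by rewrite powRM ?invr_ge0 ?ltW// -powR_inv1 ?ltW// -powRrM mulN1r powRN.
  rewrite mulrA ltr_pdivlMr ?powR_gt0//.
  rewrite -mulrA -powRD_gt0//.
  rewrite (_ : - al + (th - 1) = - a); last by rewrite /a; lra.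
  apply: le_lt_trans key; rewrite le_eqVlt; apply/orP; left; apply/eqP.
  by rewrite -[X in X * _ = _]powRr1 ?ltW// -powRD_gt0// addrC subrK.
have ca : c0 `^ a <= k3 / 2.
  have -> : k3 / 2 = ((k3 / 2) `^ a^-1) `^ a.
    by rewrite -powRrM mulVf ?gt_eqF// powRr1// divr_ge0 ?(ltW k30).
  rewrite ge0_ler_powR ?nnegrE ?powR_ge0 ?(ltW a0) ?(ltW c00)//.
  by rewrite ge_min lexx orbT.
have Ha : H `^ th <= H `^ (q%:R * a).
  by rewrite ler_powR// -ler_pdivrMr.
have -> : e `^ (- a) = H `^ (q%:R * a) / c0 `^ a.
  rewrite /e powRM ?invr_ge0 ?exprn_ge0 ?ltW// powRN mulrC -powR_mulrn ?ltW//.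
  by rewrite -[(H `^ _)^-1]powRN -powRrM mulrNN.
rewrite mulrA ltr_pdivlMr ?powR_gt0//.
have : 0 < H `^ th by rewrite powR_gt0.
move: ca Ha; set x := c0 `^ a; set y := H `^ th; set z := H `^ _ => ca Ha y0.
have : y * x <= y * (k3 / 2) by rewrite ler_pM2l.
have : k3 * y <= k3 * z by rewrite ler_pM2l.
have : 0 < k3 * y by rewrite mulr_gt0.
lra.
Qed.

End exponents.

(** * Comparison of the scheme with another path *)

Section stability.
Context {R : realType} {d : nat} {v : 'rV[R]_d} {b : 'rV[R]_d -> 'rV[R]_d}.
Context {x0 : 'rV[R]_d} {c l al eta kap : R}.
Context (hb : repulsive_drift v b x0 c l al eta kap).

Definition lip_above (e : R) := c * (1 + e `^ (- l) + e `^ (- l)).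

Lemma lip_above_ge0 e : 0 <= lip_above e.
Proof. by rewrite mulr_ge0 ?(ltW (rd_c hb))// !addr_ge0// powR_ge0. Qed.

Lemma lip_aboveP e x y : 0 < e -> e <= dotp v x -> e <= dotp v y ->
  fnorm (b x - b y) <= lip_above e * fnorm (x - y).
Proof.
move=> e0 ex ey.
apply: (le_trans (rd_lip hb (lt_le_trans e0 ex) (lt_le_trans e0 ey))).
rewrite ler_wpM2r ?fnorm_ge0// ler_wpM2l ?(ltW (rd_c hb))//.
by rewrite -!addrA lerD2l lerD// ler_powRN ?(rd_l hb).
Qed.

(** Y enters only through its defect r_j per unit time on each step, so it can be a solution as well
    as another scheme. The maximum of tau and e keeps the cutoff inactive along X. *)
Lemma euler_grid_stability (w Y : R -> 'rV[R]_d) (n K : nat) (tau e M N : R)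
    (r : nat -> R) :
  (0 < n)%N -> 0 < e -> 0 <= M -> n%:R^-1 * lip_above e ^+ 2 <= M ->
  K%:R / n%:R <= N -> Y 0 = x0 ->
  let X := euler_grid (cutoff v tau b) x0 w n in
  (forall k, (k <= K)%N -> Num.max tau e <= dotp v (X k)) ->
  (forall k, (k <= K)%N -> e <= dotp v (Y (k%:R / n%:R))) ->
  (forall k, (k < K)%N -> 0 <= r k /\
    fnorm (Y (k.+1%:R / n%:R) - Y (k%:R / n%:R)
           - (w (k.+1%:R / n%:R) - w (k%:R / n%:R))
           - n%:R^-1 *: b (Y (k%:R / n%:R))) <= n%:R^-1 * r k) ->
  forall k, (k <= K)%N -> fnorm (X k - Y (k%:R / n%:R)) <=
    expR ((c + M) * N) * (n%:R^-1 * \sum_(j < k) r j).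
Proof.
move=> n0 e0 M0 hM KN Y0 X hX hY hr k kK.
have h0 : 0 <= n%:R^-1 :> R by rewrite invr_ge0.
have c0 := rd_c hb.
pose a k := fnorm (X k - Y (k%:R / n%:R)).
have stp j : (j < K)%N -> a j.+1 <= (1 + n%:R^-1 * (c + M)) * a j + n%:R^-1 * r j.
  move=> jK; have [_ hj] := hr _ jK.
  have hXj := hX _ (ltnW jK); rewrite ge_max in hXj; case/andP: hXj => tX eX.
  have eY := hY _ (ltnW jK).
  rewrite /a /X /= -/X -/(X j) /cutoff tX.
  set Yj := Y (j%:R / n%:R) in hj eY *; set Yj1 := Y _ in hj *; set dw := w _ - w _ in hj *.
  rewrite (_ : _ - Yj1 = (X j - Yj + n%:R^-1 *: (b (X j) - b Yj)) -
     (Yj1 - Yj - dw - n%:R^-1 *: b Yj)); last first.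
    by apply/rowP => i; rewrite !mxE; ring.
  apply: (le_trans (fnormD _ _)); rewrite fnormN lerD//.
  apply: (one_step_stability (ltW c0) h0 M0 hM).
    by apply: (rd_osl hb); exact: lt_le_trans e0 _.
  exact: lip_aboveP.
have r0 j : (j < K)%N -> 0 <= n%:R^-1 * r j by move=> /hr[? _]; rewrite mulr_ge0.
have := @discrete_gronwall R (c + M) n%:R^-1 a _ K h0
  (addr_ge0 (ltW c0) M0) r0 stp (fnorm_ge0 _) k kK.
move=> /le_trans; apply.
have kN : k%:R * n%:R^-1 <= N by rewrite (le_trans _ KN)// ler_wpM2r// ler_nat.
rewrite /a /X /= mul0r Y0 subrr fnorm0 add0r -mulr_sumr ler_wpM2r//.
  rewrite mulr_ge0// sumr_ge0// => j _.
  by case: (hr j (leq_trans (ltn_ord j) kK)).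
by rewrite ler_expR ler_wpM2l// addr_ge0// ltW.
Qed.

End stability.

(** * The scheme along a Hoelder path *)

Section path_estimates.
Context {R : realType} {d : nat} {v : 'rV[R]_d} {b : 'rV[R]_d -> 'rV[R]_d}.
Context {x0 : 'rV[R]_d} {c l al eta kap : R}.
Context (hb : repulsive_drift v b x0 c l al eta kap).
Context (th : R) (N : nat) (th2 : 2 < th) (th3 : th <= 3).
Context (N0 : (0 < N)%N).

Definition holder_path (H : R) (w : R -> 'rV[R]_d) :=
  w 0 = 0 /\ forall s t, 0 <= s -> s <= t -> t <= N%:R ->
    fnorm (w t - w s) <= H * (t - s) `^ th^-1.

Definition level (delta om : R) (n : nat) : R := delta * n%:R `^ (- om).

Lemma holder_path_sup H w t : 0 <= H -> holder_path H w -> 0 <= t <= N%:R ->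
  fnorm (w t) <= H * N%:R.
Proof.
move=> H0 [w0 wH] /andP[t0 tN]; rewrite -[w t]subr0 -w0.
apply: (le_trans (wH _ _ (lexx 0) t0 tN)); rewrite subr0 ler_wpM2l//.
have N1 : 1 <= N%:R :> R by rewrite ler1n.
apply: (@le_trans _ _ (N%:R `^ th^-1)).
  by rewrite ge0_ler_powR ?nnegrE ?invr_ge0//; move: th2; lra.
by rewrite ler1_powR// invf_le1; move: th2; lra.
Qed.

Lemma grid_le n k : (0 < n)%N -> (k <= n * N)%N -> (k%:R / n%:R <= N%:R :> R).
Proof.
by move=> n0 kn; rewrite ler_pdivrMr ?ltr0n// -natrM ler_nat mulnC.
Qed.

Lemma grid_ge0 n k : 0 <= k%:R / n%:R :> R.
Proof. by rewrite divr_ge0. Qed.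

(** Linear in H because S = H N enters the previous bounds affinely, while M depends on neither n
    nor H. The third bound contains no power of n; it becomes useful once the height of the scheme
    is known. *)
Lemma euler_grid_apriori (delta om : R) : 0 < delta -> 0 <= om <= 1 / (3 * l) ->
  exists C, 0 < C /\ forall H w n, 1 <= H -> holder_path H w -> (0 < n)%N ->
    let tau := level delta om n in
    let X := euler_grid (cutoff v tau b) x0 w n in
    forall k, (k <= n * N)%N ->
      [/\ fnorm (X k) <= C * H,
          fnorm (cutoff v tau b (X k)) <= C * H * n%:R `^ 3^-1 &
          forall e, tau <= e -> e <= dotp v (X k) ->
            fnorm (b (X k)) <= C * H * (1 + e `^ (- l))].
Proof.
move=> delta0 /andP[om0 oml].
have c0 := rd_c hb; have l0 := rd_l hb; have r0 := rd_x0 hb.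
set f := fnorm (b x0); have f0 : 0 <= f by exact: fnorm_ge0.
set g := fnorm x0; have g0 : 0 <= g by exact: fnorm_ge0.
set rl := dotp v x0 `^ (- l); have rl0 : 0 <= rl by exact: powR_ge0.
set dl := delta `^ (- l); have dl0 : 0 <= dl by exact: powR_ge0.
pose NN : R := N%:R; have NN0 : 0 <= NN by exact: ler0n.
pose L0 := lip_at (v := v) (x0 := x0) (c := c) (l := l) (dotp v x0).
have L00 : 0 <= L0 by exact: (lip_at_ge0 hb).
pose CL := c * (1 + dl + rl).
have CL0 : 0 <= CL by rewrite /CL mulr_ge0 ?(ltW c0)// !addr_ge0.
(* The Lipschitz constant at level tau will be at most CL n^(1/3), and n^-1 (CL n^(1/3))^2 <=
   CL^2. *)
pose M := CL ^+ 2; have M0 : 0 <= M by exact: sqr_ge0.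
pose CR := f + L0 * (2 * NN).
have CR0 : 0 <= CR by apply: addr_ge0 => //; apply: mulr_ge0 => //; exact: mulr_ge0.
pose E := expR ((c + M) * NN); have E0 : 0 <= E by exact: expR_ge0.
pose CZ := E * (NN + NN * CR).
have CZ0 : 0 <= CZ by apply: mulr_ge0 => //; apply: addr_ge0 => //; exact: mulr_ge0.
pose C1 := g + 2 * NN + CZ; pose C2 := CR + CL * CZ; pose C3 := CR + c * (1 + rl) * CZ.
have C10 : 0 <= C1 by apply: addr_ge0 => //; apply: addr_ge0 => //; exact: mulr_ge0.
have C20 : 0 <= C2 by apply: addr_ge0 => //; exact: mulr_ge0.
have c1rl : 0 <= c * (1 + rl) by rewrite mulr_ge0 ?(ltW c0)// addr_ge0.
have C30 : 0 <= C3 by apply: addr_ge0 => //; exact: mulr_ge0.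
exists (1 + C1 + C2 + C3); split; first by lra.
move=> H w n H1 hw n0 tau X k kn.
have H0 : 0 <= H by exact: le_trans H1.
have n1 : 1 <= n%:R :> R by rewrite ler1n.
have nr0 : 0 < n%:R :> R by rewrite ltr0n.
pose n3 : R := n%:R `^ 3^-1.
have n31 : 1 <= n3 by rewrite -(powRr0 n%:R) ler_powR.
have tau0 : 0 < tau by rewrite mulr_gt0// powR_gt0.
(* tau^-l = delta^-l n^(om l), and om l <= 1/3. *)
have Ltau : lip_at (v := v) (x0 := x0) (c := c) (l := l) tau <= CL * n3.
  rewrite /lip_at /CL -mulrA ler_wpM2l ?(ltW c0)//.
  have tl : tau `^ (- l) <= dl * n3.
    rewrite /tau /level powRM ?powR_ge0 ?(ltW delta0)// ler_wpM2l//.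
    rewrite -powRrM mulrNN ler_powR// -ler_pdivlMr//.
    by move: oml; rewrite mul1r invfM.
  have h1 : dl + rl <= (dl + rl) * n3 by rewrite ler_peMr// addr_ge0.
  have h2 : rl <= rl * n3 by rewrite ler_peMr.
  by rewrite -/rl; lra.
have hM : n%:R^-1 * lip_at (v := v) (x0 := x0) (c := c) (l := l) tau ^+ 2 <= M.
  rewrite ler_pdivrMl//.
  apply: (@le_trans _ _ ((CL * n3) ^+ 2)).
    rewrite ler_pXn2r// nnegrE ?(lip_at_ge0 hb)//.
    by rewrite mulr_ge0// powR_ge0.
  rewrite exprMn mulrC ler_wpM2r//.
  rewrite /n3 -powR_mulrn ?powR_ge0// -powRrM -[leRHS]powRr1 ?(ltW nr0)// ler_powR//; lra.
have wS j : (j <= n * N)%N -> fnorm (w (j%:R / n%:R)) <= H * NN.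
  by move=> jn; apply: holder_path_sup => //; rewrite grid_ge0 grid_le.
have KN : (n * N)%:R / n%:R <= NN by rewrite grid_le.
have RS : ref_bound (v := v) (b := b) (x0 := x0) (c := c) (l := l) (H * NN) <= CR * H.
  have fH : f <= f * H by rewrite ler_peMr.
  rewrite /ref_bound -/f -/L0 /CR; lra.
have ZS : apriori_bound (v := v) (b := b) (x0 := x0) (c := c) (l := l) (H * NN) M NN <= CZ * H.
  rewrite /apriori_bound -/E /CZ -mulrA ler_wpM2l// mulrDl lerD//; first by rewrite mulrC.
  by rewrite -mulrA ler_wpM2l.
have Z0 : 0 <= apriori_bound (v := v) (b := b) (x0 := x0) (c := c) (l := l) (H * NN) M NN.
  apply: mulr_ge0 => //; apply: addr_ge0; first exact: mulr_ge0.
  by apply: mulr_ge0 => //; apply: (ref_bound_ge0 hb); exact: mulr_ge0.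
have C1H : 0 <= C1 * H by rewrite mulr_ge0.
have C2H : 0 <= C2 * H by rewrite mulr_ge0.
have C3H : 0 <= C3 * H by rewrite mulr_ge0.
case: (hw) => w0 _.
split.
- have := euler_grid_bound hb tau0 M0 wS w0 hM KN kn.
  rewrite -/X -/g => h.
  have gH : g <= g * H by rewrite ler_peMr.
  have -> : (1 + C1 + C2 + C3) * H = H + (g * H + 2 * (H * NN) + CZ * H) + C2 * H + C3 * H.
    by rewrite /C1; ring.
  lra.
- have := cutoff_grid_bound hb tau0 M0 wS w0 hM KN (lexx tau) kn (or_intror erefl).
  rewrite -/X => h.
  have h1 : lip_at (v := v) (x0 := x0) (c := c) (l := l) tau *
     apriori_bound (v := v) (b := b) (x0 := x0) (c := c) (l := l) (H * NN) M NN <= CL * n3 * (CZ * H).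
    by rewrite ler_pM// (lip_at_ge0 hb).
  have h2 : CR * H <= CR * H * n3 by rewrite ler_peMr// mulr_ge0.
  apply: (le_trans h); rewrite -/n3.
  have -> : (1 + C1 + C2 + C3) * H * n3 =
      H * n3 + C1 * H * n3 + C3 * H * n3 + (CR * H * n3 + CL * n3 * (CZ * H)).
    by rewrite /C2; ring.
  have n30 : 0 <= n3 by exact: le_trans n31.
  have := mulr_ge0 H0 n30; have := mulr_ge0 C1H n30; have := mulr_ge0 C3H n30; lra.
- move=> e te eX.
  have := cutoff_grid_bound hb tau0 M0 wS w0 hM KN te kn (or_introl eX).
  rewrite /cutoff (le_trans te eX) -/X => h; apply: (le_trans h).
  set el := e `^ (- l).
  have el0 : 0 <= el by exact: powR_ge0.
  have Le : lip_at (v := v) (x0 := x0) (c := c) (l := l) e <= c * (1 + rl) * (1 + el).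
    rewrite /lip_at -/rl -/el -[leRHS]mulrA ler_wpM2l ?(ltW c0)//.
    have := mulr_ge0 rl0 el0; lra.
  have h1 : lip_at (v := v) (x0 := x0) (c := c) (l := l) e *
     apriori_bound (v := v) (b := b) (x0 := x0) (c := c) (l := l) (H * NN) M NN <= c * (1 + rl) * (1 + el) * (CZ * H).
    by rewrite ler_pM// (lip_at_ge0 hb).
  have h2 : CR * H <= CR * H * (1 + el) by rewrite ler_peMr ?mulr_ge0// lerDl.
  have -> : (1 + C1 + C2 + C3) * H * (1 + el) =
      H * (1 + el) + C1 * H * (1 + el) + C2 * H * (1 + el) +
      (CR * H * (1 + el) + c * (1 + rl) * (1 + el) * (CZ * H)).
    by rewrite /C3; ring.
  have e10 : 0 <= 1 + el by lra.
  have := mulr_ge0 H0 e10; have := mulr_ge0 C1H e10; have := mulr_ge0 C2H e10; lra.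
Qed.

(** The level falls below e because om > 0. In the second bound the drift contributes order n^(-2/3)
    and the noise order n^(-1/th), both at most n^(-1/3): here th <= 3 enters. *)
Lemma large_step_count (delta om C c0 : R) (q : nat) :
  0 < delta -> 0 < om -> 0 < C -> 0 < c0 ->
  exists A (Q : nat), 0 < A /\ forall H (n : nat), 1 <= H -> A * H ^+ Q <= n%:R ->
    let e := c0 * H ^- q in
    [/\ level delta om n <= e,
        n%:R^-1 * (C * H * n%:R `^ 3^-1) + H * n%:R^-1 `^ th^-1 <= e / 2 &
        n%:R^-1 * lip_above (c := c) (l := l) (e / 2) ^+ 2 <= 1].
Proof.
move=> delta0 om0 C0 c00.
have cc := rd_c hb; have l0 := rd_l hb.
(* Converts e^-l, of order H^(q l), into a natural power of H. *)
have [m hm] := exists_nat_ge (q%:R * l).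
pose K := c * (1 + (c0 / 2) `^ (- l) + (c0 / 2) `^ (- l)).
have K0 : 0 < K by rewrite /K mulr_gt0// ltr_wpDr ?powR_ge0// ltr_wpDr ?powR_ge0.
have [A1 [Q1 [A10 h1]]] := @powR_small R om (delta / c0) q om0 (divr_gt0 delta0 c00).
have th30 : 0 < 3^-1 :> R by [].
have C10 : 0 < 2 * (C + 1) / c0 by rewrite divr_gt0// mulr_gt0// addr_gt0.
have [A2 [Q2 [A20 h2]]] := @powR_small R 3^-1 (2 * (C + 1) / c0) q.+1 th30 C10.
have K20 : 0 < K ^+ 2 by rewrite exprn_gt0.
have [A3 [Q3 [A30 h3]]] := @powR_small R 1 (K ^+ 2) (m * 2) ltr01 K20.
exists (1 + A1 + A2 + A3), (Q1 + Q2 + Q3)%N; split; first by lra.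
move=> H n H1 Hn e.
have H0 : 0 < H by exact: lt_le_trans H1.
have HQ j : (j <= Q1 + Q2 + Q3)%N -> 0 <= H ^+ j <= H ^+ (Q1 + Q2 + Q3).
  by move=> jQ; rewrite exprn_ge0 ?(ltW H0)// ler_weXn2l.
have le A Q : 0 <= A <= 1 + A1 + A2 + A3 -> (Q <= Q1 + Q2 + Q3)%N -> A * H ^+ Q <= n%:R.
  move=> /andP[a0 aA] qQ; apply: le_trans Hn; have /andP[? ?] := HQ _ qQ.
  by rewrite ler_pM.
have n1 : 1 <= n%:R :> R.
  by rewrite -[leLHS]mulr1 -(expr0 H) le// ?leq0n//; apply/andP; split; lra.
have n0 : 0 < n%:R :> R by exact: lt_le_trans n1.
have q0 : 0 < H ^+ q by rewrite exprn_gt0.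
have e0 : 0 < e by rewrite mulr_gt0// invr_gt0.
split.
- have := h1 H n%:R H1 (le _ _ _ _); rewrite -addnA leq_addr.
  move=> /(_ (introT andP (conj (ltW A10) _)) isT) hh.
  have {hh} := hh ltac:(lra).
  rewrite (_ : level _ _ _ = e * (delta / c0 * H ^+ q * n%:R `^ (- om))).
    by move=> hh; rewrite ler_piMr// ltW.
  by rewrite /level /e; field; rewrite !gt_eqF.
- have := h2 H n%:R H1 (le _ _ _ _); rewrite addnAC leq_addl.
  move=> /(_ (introT andP (conj (ltW A20) _)) isT) hh.
  have {hh} := hh ltac:(lra).
  set y := n%:R `^ (- 3^-1) => hh.
  have y0 : 0 <= y by exact: powR_ge0.
  apply: (@le_trans _ _ ((C + 1) * H * y)); last first.
    rewrite (_ : _ * y = e / 2 * (2 * (C + 1) / c0 * H ^+ q.+1 * y)).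
      by rewrite ler_piMr// divr_ge0// ltW.
    by rewrite /e exprS; field; rewrite !gt_eqF.
  rewrite (_ : (C + 1) * H * y = C * H * y + H * y); last by ring.
  rewrite lerD//.
    rewrite [leLHS]mulrC -[C * H * _ / _]mulrA.
    apply: ler_wpM2l; first by rewrite mulr_ge0 ?(ltW C0) ?(ltW H0).
    by rewrite -[n%:R^-1]powR_inv1 ?(ltW n0)// -powRD_gt0// ler_powR//; lra.
  rewrite ler_wpM2l ?(ltW H0)// -[n%:R^-1]powR_inv1 ?(ltW n0)// -powRrM ler_powR// mulN1r lerN2.
  by rewrite lef_pV2 ?posrE//; move: th2; lra.
- have := h3 H n%:R H1 (le _ _ _ _); rewrite leq_addl.
  move=> /(_ (introT andP (conj (ltW A30) _)) isT) hh.
  have {hh} := hh ltac:(lra).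
  rewrite powR_inv1 ?(ltW n0)// exprM -exprMn => hh.
  apply: le_trans hh; rewrite mulrC ler_wpM2r ?invr_ge0 ?(ltW n0)//.
  have Hm1 : 1 <= H ^+ m by rewrite exprn_ege1.
  rewrite ler_pXn2r// ?nnegrE ?(lip_above_ge0 hb)//; last first.
    by rewrite mulr_ge0 ?(ltW K0)// (le_trans _ Hm1).
  rewrite /lip_above /K -[leRHS]mulrA ler_wpM2l ?(ltW cc)//.
  have el : (e / 2) `^ (- l) <= (c0 / 2) `^ (- l) * H ^+ m.
    rewrite /e mulrAC [leLHS]powRM ?invr_ge0 ?divr_ge0 ?(ltW c00) ?(ltW q0)//.
    rewrite ler_wpM2l ?powR_ge0// -[(H ^+ q)^-1]powR_inv1 ?(ltW q0)// -powRrM.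
    rewrite -!powR_mulrn ?(ltW H0)// -powRrM ler_powR//.
    by move: hm; lra.
  by lra.
Qed.

End path_estimates.

Lemma integrable_setU_disj dd (T : measurableType dd) (R : realType)
    (mu : {measure set T -> \bar R}) (f : T -> R) (A B : set T) :
  measurable A -> measurable B -> [disjoint A & B] ->
  mu.-integrable A (EFin \o f) -> mu.-integrable B (EFin \o f) ->
  mu.-integrable (A `|` B) (EFin \o f).
Proof.
move=> mA mB AB /integrableP[mfA iA] /integrableP[mfB iB].
have mf := (measurable_funU _ mA mB).2 (conj mfA mfB).
apply/integrableP; split => //.
rewrite ge0_integral_setU//; first exact: lte_add_pinfty.
exact: measurableT_comp.
Qed.

(** * Integrals of functions constant on grid intervals *)

Section interval_integrals.
Context {R : realType}.
Notation mu := (@lebesgue_measure R).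

Lemma fine_lebesgue_itv (b1 b2 : bool) (s t : R) : s <= t ->
  fine (mu [set` Interval (BSide b1 s) (BSide b2 t)]) = t - s.
Proof.
rewrite lebesgue_measure_itv /= lte_fin => st.
by case: ltgtP st => // -> _; rewrite subrr.
Qed.

Lemma integrable_cst_itv (b1 b2 : bool) (s t k : R) :
  mu.-integrable [set` Interval (BSide b1 s) (BSide b2 t)] (EFin \o cst k).
Proof.
apply: measurable_bounded_integrable => //.
- by rewrite /= lebesgue_measure_itv /=; case: ifP => _; rewrite ?ltry// -EFinB ltry.
- exact/bounded_cst.
Qed.

Lemma normr_Rintegral_itv (b1 b2 : bool) (g : R -> R) (s t K : R) : s <= t ->
  let I := Interval (BSide b1 s) (BSide b2 t) in
  mu.-integrable [set` I] (EFin \o g) -> (forall u, u \in I -> `|g u| <= K) ->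
  `|\int[mu]_(u in [set` I]) g u| <= K * (t - s).
Proof.
move=> st I ig gK; apply: (le_trans (le_normr_Rintegral _ ig)) => //.
rewrite -(@fine_lebesgue_itv b1 b2 s t)// -Rintegral_cst//.
apply: le_Rintegral => //.
- exact: (integrable_norm ig).
- exact: integrable_cst_itv.
Qed.

Lemma integrable_Rintegral_const (b1 b2 : bool) (f : R -> R) (s t k : R) : s <= t ->
  (forall u, u \in Interval (BSide b1 s) (BSide b2 t) -> f u = k) ->
  mu.-integrable [set` Interval (BSide b1 s) (BSide b2 t)] (EFin \o f) /\
  \int[mu]_(u in [set` Interval (BSide b1 s) (BSide b2 t)]) f u = k * (t - s).
Proof.
move=> st fk; split.
  apply: (eq_integrable _ (EFin \o cst k)) => //; last exact: integrable_cst_itv.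
  by move=> u /set_mem /= /fk /= ->.
rewrite (@eq_Rintegral _ _ _ _ _ (cst k)); last by move=> u /set_mem /fk.
by rewrite Rintegral_cst// fine_lebesgue_itv.
Qed.

Lemma gridE (n : nat) (t : R) : 0 <= t ->
  grid n t = (Num.truncn (n%:R * t))%:R / n%:R.
Proof.
move=> t0; rewrite /grid truncn_floor mulr_ge0//.
by rewrite -[X in X%:~R]gez0_abs ?pmulrn// floor_ge0 mulr_ge0.
Qed.

Lemma grid_eq (n k : nat) (t : R) : (0 < n)%N ->
  k%:R / n%:R <= t < k.+1%:R / n%:R -> grid n t = k%:R / n%:R.
Proof.
move=> n0 /andP[kt tk]; have nr0 : 0 < n%:R :> R by rewrite ltr0n.
rewrite gridE ?(le_trans _ kt) ?divr_ge0//; congr (_%:R / _).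
apply: truncn_def; move: kt tk.
by rewrite ler_pdivrMr// ltr_pdivlMr// mulrC => -> ->.
Qed.

Lemma grid_bounds (n : nat) (t : R) : (0 < n)%N -> 0 <= t ->
  (Num.truncn (n%:R * t))%:R / n%:R <= t < (Num.truncn (n%:R * t)).+1%:R / n%:R.
Proof.
move=> n0 t0; have nr0 : 0 < n%:R :> R by rewrite ltr0n.
rewrite ler_pdivrMr// ltr_pdivlMr// mulrC.
by rewrite truncn_itv// mulr_ge0.
Qed.

Lemma grid_succ (n k : nat) : (0 < n)%N ->
  k.+1%:R / n%:R = k%:R / n%:R + n%:R^-1 :> R.
Proof. by move=> n0; rewrite -[k.+1]addn1 natrD mulrDl mul1r. Qed.

Lemma integral_step (n : nat) (g : R -> R) (k : nat) (t : R) : (0 < n)%N ->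
  k%:R / n%:R <= t <= k.+1%:R / n%:R ->
  mu.-integrable `[0, t] (EFin \o (g \o grid n)) /\
  \int[mu]_(s in `[0, t]) g (grid n s) =
    \sum_(j < k) n%:R^-1 * g (j%:R / n%:R) + (t - k%:R / n%:R) * g (k%:R / n%:R).
Proof.
move=> n0 /andP[kt tk].
have mono j : 0 <= j%:R / n%:R :> R by rewrite divr_ge0.
(* Half-open intervals: on [j/n, s[ the grid time is j/n even when s = (j+1)/n. The closed right end
   is restored at the end of the proof. *)
have aux (j : nat) (s : R) : j%:R / n%:R <= s <= j.+1%:R / n%:R ->
   mu.-integrable `[0, j%:R / n%:R[ (EFin \o (g \o grid n)) ->
   mu.-integrable `[0, s[ (EFin \o (g \o grid n)) /\
   \int[mu]_(u in `[0, s[) g (grid n u) = \int[mu]_(u in `[0, j%:R / n%:R[) g (grid n u) +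
     (s - j%:R / n%:R) * g (j%:R / n%:R).
  move=> /andP[js sj] ij.
  have [i1 e1] : mu.-integrable `[j%:R / n%:R, s[ (EFin \o (g \o grid n)) /\
      \int[mu]_(u in `[j%:R / n%:R, s[) (g \o grid n) u = g (j%:R / n%:R) * (s - j%:R / n%:R).
    apply: integrable_Rintegral_const => // u; rewrite in_itv/= => /andP[ju us].
    by rewrite (grid_eq n0 (k := j))// ju (lt_le_trans us).
  have E : `[0, s[%classic = `[0, j%:R / n%:R[ `|` `[j%:R / n%:R, s[ :> set R.
    by rewrite -itv_bndbnd_setU// bnd_simp.
  have D : [disjoint `[0, j%:R / n%:R[%classic & `[j%:R / n%:R, s[%classic : set R].
    apply/disj_setPS => u [] /=; rewrite !in_itv/= => /andP[_ uj] /andP[ju _].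
    by move: uj; rewrite ltNge ju.
  have iU : mu.-integrable `[0, s[ (EFin \o (g \o grid n)).
    by rewrite E; apply: integrable_setU_disj.
  split=> //; rewrite E Rintegral_setU -?E//.
  by congr (_ + _); rewrite [RHS]mulrC; exact: e1.
have : mu.-integrable `[0, k%:R / n%:R[ (EFin \o (g \o grid n)) /\
    \int[mu]_(u in `[0, k%:R / n%:R[) g (grid n u) = \sum_(j < k) n%:R^-1 * g (j%:R / n%:R).
  elim: k {kt tk} => [|k [ik ek]].
    by rewrite mul0r set_itvco0 Rintegral_set0 big_ord0; split => //; exact: integrable_set0.
  have := aux k (k.+1%:R / n%:R); rewrite lexx grid_succ// lerDl invr_ge0 ler0n.
  move=> /(_ isT ik) [ik1 ->]; split=> //.
  by rewrite ek big_ord_recr /= [X in X * _]addrAC subrr add0r.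
move=> [ik ek]; have [it et] := aux k t (introT andP (conj kt tk)) ik.
rewrite -ek -et; split; last by rewrite -Rintegral_itv_bndo_bndc.
have t0 : 0 <= t by exact: le_trans kt.
have [i1 _] := @integrable_Rintegral_const true false (g \o grid n) t t (g (grid n t))
  (lexx t) (fun u => ltac:(by rewrite in_itv/= -eq_le => /eqP <-)).
rewrite (@itv_bndbnd_setU _ _ (BLeft 0) (BLeft t) (BRight t)) ?bnd_simp//.
apply: integrable_setU_disj => //.
by apply/disj_setPS => u [] /=; rewrite !in_itv/= => /andP[_ uj] /andP[]; rewrite leNgt uj.
Qed.

End interval_integrals.

(** * Integral equations along a single path *)

Section paths.
Context {R : realType} {d : nat}.
Notation mu := (@lebesgue_measure R).
Implicit Types (w Y g : R -> 'rV[R]_d).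

Definition ode_solution w (x0 : 'rV[R]_d) g Y (T : R) :=
  forall t, 0 <= t <= T -> forall i,
    mu.-integrable `[0, t] (fun s => (g s 0 i)%:E) /\
    Y t 0 i = x0 0 i + \int[mu]_(s in `[0, t]) g s 0 i + w t 0 i.

(* Integral-free consequence of [dY = g dt + dw]. *)
Definition driven w g Y (T : R) :=
  forall s t (a : 'rV[R]_d) K, 0 <= s -> s <= t -> t <= T ->
    (forall u, s <= u < t -> fnorm (g u - a) <= K) ->
    fnorm (Y t - Y s - (w t - w s) - (t - s) *: a) <= d%:R * K * (t - s).

(** Each coordinate of the integral of g - a over [s, t] is at most K (t - s); summing the
    coordinates produces the factor d. *)
Lemma ode_solution_driven w x0 g Y T : ode_solution w x0 g Y T -> driven w g Y T.
Proof.
move=> sol s t a K s0 st tT gK.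
apply: (le_trans (fnorm_le_sum _)).
rewrite -mulrA mulr_natl -[X in _ *+ X]card_ord -sumr_const; apply: ler_sum => i _.
have t0 := le_trans s0 st.
have [it et] := sol t (introT andP (conj t0 tT)) i.
have [_ es] := sol s (introT andP (conj s0 (le_trans st tT))) i.
rewrite !mxE et es.
have e1 := @Rintegral_itvB R (fun s => g s 0 i) (BLeft 0) (BRight t) s it.
rewrite !bnd_simp in e1; have {}e1 := e1 s0 st.
have isub (b : bool) : mu.-integrable [set` Interval (BRight s) (BSide b t)] (EFin \o (fun s => g s 0 i)).
  apply: (integrableS _ _ _ it) => // u /=; rewrite !in_itv/= => /andP[su ut].
  by rewrite (le_trans s0 (ltW su)) /=; case: b ut => //; exact: ltW.
rewrite -(Rintegral_itv_bndo_bndc (isub true)) in e1.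
have -> : x0 0 i + \int[mu]_(s in `[0, t]) g s 0 i + w t 0 i -
    (x0 0 i + \int[mu]_(s in `[0, s]) g s 0 i + w s 0 i) - (w t 0 i - w s 0 i) - (t - s) * a 0 i
   = \int[mu]_(u in `]s, t[) (g u 0 i - a 0 i).
  rewrite (RintegralB _ (isub true) (integrable_cst_itv false true s t (a 0 i)))//.
  by rewrite -e1 Rintegral_cst// fine_lebesgue_itv//; ring.
apply: normr_Rintegral_itv => //.
  exact: (integrableB _ (isub true) (integrable_cst_itv false true s t (a 0 i))).
move=> u; rewrite in_itv/= => /andP[su ut]; apply: le_trans (gK u _); last by rewrite ltW.
by have := normr_coord_le (g u - a) i; rewrite !mxE.
Qed.

Lemma ode_solution0 w x0 g Y T : 0 <= T -> w 0 = 0 -> ode_solution w x0 g Y T -> Y 0 = x0.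
Proof.
move=> T0 w0 sol; apply/rowP => i.
have [_ ->] := sol 0 (introT andP (conj (lexx 0) T0)) i.
by rewrite set_itv1 Rintegral_set1 w0 mxE !addr0.
Qed.

(** Between grid points the drift is frozen while the noise is w itself, so the equation of the
    scheme holds at every time and not just on the grid. *)
Definition euler_path (b : 'rV[R]_d -> 'rV[R]_d) x0 w (n : nat) (t : R) : 'rV[R]_d :=
  let k := Num.truncn (n%:R * t) in
  let e := euler_grid b x0 w n k in
  e + (t - k%:R / n%:R) *: b e + (w t - w (k%:R / n%:R)).

Section euler.
Context (b : 'rV[R]_d -> 'rV[R]_d) (x0 : 'rV[R]_d) (w : R -> 'rV[R]_d).
Context (n : nat) (n0 : (0 < n)%N).
Let X := euler_grid b x0 w n.
Let E := euler_path b x0 w n.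

Lemma truncn_grid k : Num.truncn (n%:R * (k%:R / n%:R : R)) = k.
Proof. by rewrite mulrC divfK ?natrK// pnatr_eq0 -lt0n. Qed.

Lemma euler_path_step k t : k%:R / n%:R <= t <= k.+1%:R / n%:R ->
  E t = X k + (t - k%:R / n%:R) *: b (X k) + (w t - w (k%:R / n%:R)).
Proof.
move=> /andP[kt]; rewrite le_eqVlt => /orP[/eqP ->|tk].
  rewrite /E /euler_path truncn_grid subrr scale0r !subrr !addr0 /X /=.
  by rewrite (_ : _ - k%:R / n%:R = n%:R^-1)// grid_succ// addrAC subrr add0r.
have nr0 : 0 < n%:R :> R by rewrite ltr0n.
rewrite /E /euler_path (@truncn_def _ _ k)//.
by move: kt tk; rewrite ler_pdivrMr// ltr_pdivlMr// mulrC => -> ->.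
Qed.

Lemma euler_path_grid k : E (k%:R / n%:R) = X k.
Proof. by rewrite /E /euler_path truncn_grid subrr scale0r subrr !addr0. Qed.

Lemma euler_grid_sum k :
  X k = x0 + \sum_(j < k) n%:R^-1 *: b (X j) + (w (k%:R / n%:R) - w 0).
Proof.
elim: k => [|k IH]; first by rewrite big_ord0 mul0r subrr !addr0.
rewrite /X /= -/X -/(X k) {1}IH big_ord_recr /=.
by apply/rowP => i; rewrite !mxE; ring.
Qed.

Lemma euler_path_ode_solution T : w 0 = 0 ->
  ode_solution w x0 (fun t => b (E (grid n t))) E T.
Proof.
move=> w0 t /andP[t0 _] i.
have /andP[kt tk] := grid_bounds n0 t0; set k := Num.truncn _ in kt tk.
have kt' := introT andP (conj kt (ltW tk)).
have [? e] := integral_step (fun s => b (E s) 0 i) n0 kt'.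
split=> //; rewrite e (euler_path_step kt') {1}euler_grid_sum w0 subr0 !mxE summxE.
rewrite euler_path_grid.
have -> : \sum_(j < k) (n%:R^-1 *: b (X j)) 0 i = \sum_(j < k) n%:R^-1 * b (E (j%:R / n%:R)) 0 i.
  by apply: eq_bigr => j _; rewrite mxE euler_path_grid.
by ring.
Qed.

(** The equation is explicit: the drift at time t reads Y at the last grid point, so strong
    induction on the grid index determines all values. *)
Lemma euler_path_unique Y : w 0 = 0 ->
  (forall T, ode_solution w x0 (fun t => b (Y (grid n t))) Y T) ->
  forall t, 0 <= t -> Y t = E t.
Proof.
move=> w0 sol.
have formula k t : k%:R / n%:R <= t <= k.+1%:R / n%:R ->
    Y t = x0 + \sum_(j < k) n%:R^-1 *: b (Y (j%:R / n%:R)) +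
      (t - k%:R / n%:R) *: b (Y (k%:R / n%:R)) + w t.
  move=> kt; apply/rowP => i.
  have t0 : 0 <= t by case/andP: kt => kt _; rewrite (le_trans _ kt) ?divr_ge0.
  have [_ ->] := sol t t (introT andP (conj t0 (lexx t))) i.
  have [_ ->] := integral_step (fun s => b (Y s) 0 i) n0 kt.
  rewrite !mxE summxE; congr (_ + _); rewrite -addrA; congr (_ + (_ + _)).
  by apply: eq_bigr => j _; rewrite mxE.
have YX k : Y (k%:R / n%:R) = X k.
  have [m] := ubnP k; elim: m k => // m IH k; rewrite ltnS => km.
  rewrite (formula k) ?lexx ?ler_pM2r ?invr_gt0 ?ltr0n// ?ler_nat ?leqnSn//.
  rewrite euler_grid_sum w0 subr0 subrr scale0r addr0; congr (_ + _ + _).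
  by apply: eq_bigr => j _; rewrite IH// (leq_trans (ltn_ord j)).
move=> t t0; have /andP[kt tk] := grid_bounds n0 t0; set k := Num.truncn _ in kt tk.
have kt' := introT andP (conj kt (ltW tk)).
rewrite (formula k)// (euler_path_step kt') YX {2}euler_grid_sum w0 subr0.
rewrite (eq_bigr (fun j : 'I_k => n%:R^-1 *: b (X j))); last by move=> j _; rewrite YX.
by apply/rowP => i; rewrite !mxE; ring.
Qed.

End euler.
End paths.

(** * The scheme kept away from the boundary *)

Section path_convergence.
Context {R : realType} {d : nat} {v : 'rV[R]_d} {b : 'rV[R]_d -> 'rV[R]_d}.
Context {x0 : 'rV[R]_d} {c l al eta kap : R}.
Context (hb : repulsive_drift v b x0 c l al eta kap).
Context (th : R) (th2 : 2 < th) (th3 : th <= 3).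
Context (c0 : R) (q : nat) (c00 : 0 < c0) (c0m : c0 <= Num.min (eta / 3) (dotp v x0 / 2)).
Context (noc : forall H u : R, 1 <= H -> 0 < u ->
  H * u `^ th^-1 < c0 * H ^- q + kap * (3 * (c0 * H ^- q)) `^ (- al) * u).
Context (N : nat) (N0 : (0 < N)%N).

(** The height not crossed by the scheme when the noise has Hoelder constant H; c0 and q are those
    of [no_crossing]. *)
Definition eps (H : R) := c0 * H ^- q.

Lemma eps_gt0 H : 1 <= H -> 0 < eps H.
Proof. by move=> H1; rewrite mulr_gt0// invr_gt0 exprn_gt0// (lt_le_trans ltr01). Qed.

Lemma eps_le H : 1 <= H -> 3 * eps H <= eta /\ 2 * eps H <= dotp v x0.
Proof.
move=> H1; have : eps H <= c0.
  by rewrite /eps ler_piMr ?(ltW c00)// invf_le1 ?exprn_ege1// exprn_gt0// (lt_le_trans ltr01).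
by move: c0m; rewrite le_min => /andP[]; lra.
Qed.

Lemma eps_half_gt0 H : 1 <= H -> 0 < eps H / 2.
Proof. by move=> H1; rewrite divr_gt0// eps_gt0. Qed.

Definition drift_bound C (H : R) := C * H * (1 + eps H `^ (- l)).

Lemma drift_bound_ge0 C H : 0 <= C -> 1 <= H -> 0 <= drift_bound C H.
Proof.
move=> C0 H1; rewrite mulr_ge0 ?addr_ge0 ?powR_ge0// mulr_ge0// (le_trans ler01)//.
Qed.

(** What is gained once n exceeds a power of H. By [ss_level] the cutoff is inactive. Between grid
    points only eps / 2 is kept, because a step may lower rho by the other half. *)
Record safe_scheme (tau C H : R) (w : R -> 'rV[R]_d) (n : nat) : Prop := SafeScheme {
  ss_lip : n%:R^-1 * lip_above (c := c) (l := l) (eps H / 2) ^+ 2 <= 1 ;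
  ss_level : forall k, (k <= n * N)%N -> 
    tau <= dotp v (euler_grid (cutoff v tau b) x0 w n k) ;
  ss_eps : forall k, (k <= n * N)%N ->
    eps H <= dotp v (euler_grid (cutoff v tau b) x0 w n k) ;
  ss_drift : forall k, (k <= n * N)%N ->
    fnorm (b (euler_grid (cutoff v tau b) x0 w n k)) <= drift_bound C H ;
  ss_path : forall t, 0 <= t <= N%:R ->
    eps H / 2 <= dotp v (euler_path (cutoff v tau b) x0 w n t) }.

Lemma truncn_le_horizon n (t : R) : 0 <= t <= N%:R -> (Num.truncn (n%:R * t) <= n * N)%N.
Proof.
move=> /andP[t0 tN]; rewrite -(ler_nat R).
apply: (@le_trans _ _ (n%:R * t)); first by rewrite truncn_le mulr_ge0.
by rewrite natrM ler_wpM2l.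
Qed.

Lemma step_length (n k : nat) (t : R) : (0 < n)%N ->
  k%:R / n%:R <= t <= k.+1%:R / n%:R -> 0 <= t - k%:R / n%:R <= n%:R^-1.
Proof. by move=> n0; rewrite grid_succ// => /andP[]; lra. Qed.

(** Two regimes: the first bound holds for every n and is what remains below the threshold; beyond
    it the scheme is safe. *)
Lemma euler_path_estimates (delta om : R) : 0 < delta -> 0 < om <= 1 / (3 * l) ->
  exists C A (Q : nat), 0 < C /\ 0 < A /\
  forall H w n, 1 <= H -> holder_path th N H w -> (0 < n)%N ->
    (forall t, 0 <= t <= N%:R ->
       fnorm (euler_path (cutoff v (level delta om n) b) x0 w n t) <= C * H) /\
    (A * H ^+ Q <= n%:R -> safe_scheme (level delta om n) C H w n).
Proof.
move=> delta0 /andP[om0 oml].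
have [C [C0 hC]] := euler_grid_apriori hb th2 N0 delta0 (introT andP (conj (ltW om0) oml)).
have [A [Q [A0 hA]]] := large_step_count hb th2 th3 q delta0 om0 C0 c00.
(* C H for the last grid value, C H for the drift since then, and H for the noise. *)
exists (2 * C + 1), A, Q; split; first by lra.
split=> // H w n H1 hw n0.
have H0 : 0 <= H by exact: le_trans H1.
have nr0 : 0 < n%:R :> R by rewrite ltr0n.
set tau := level delta om n; set X := euler_grid (cutoff v tau b) x0 w n.
have hCX k kn := hC H w n H1 hw n0 k kn.
have inc t k : 0 <= t <= N%:R -> (k <= n * N)%N -> k%:R / n%:R <= t <= k.+1%:R / n%:R ->
    fnorm (euler_path (cutoff v tau b) x0 w n t - X k) <=
    n%:R^-1 * (C * H * n%:R `^ 3^-1) + H * n%:R^-1 `^ th^-1.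
  move=> tN kn kt; rewrite (euler_path_step _ _ _ n0 kt) -/X.
  have /andP[t1 t2] := step_length n0 kt.
  rewrite -(addrA (X k)) (addrC (X k)) addrK (le_trans (fnormD _ _))// lerD//.
    have [_ hc _] := hCX k kn.
    by rewrite fnormZ ger0_norm// ler_pM// ?fnorm_ge0.
  case: hw => _ hw; case/andP: kt => kt _; case/andP: tN => _ tN.
  apply: (le_trans (hw _ _ (grid_ge0 n k) kt tN)).
  rewrite ler_wpM2l// ge0_ler_powR ?nnegrE ?invr_ge0 ?(ltW nr0)//.
  by move: th2; lra.
split=> [t tN|hn].
  have /andP[t0 _] := tN; have /andP[kt tk] := grid_bounds n0 t0.
  have kn := truncn_le_horizon n tN; set k := Num.truncn _ in kt tk kn.
  have kt' := introT andP (conj kt (ltW tk)).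
  apply: (le_trans (fnorm_leD _ (X k))).
  have [hx _ _] := hCX k kn.
  rewrite -/tau -/X in hx.
  have h1 : n%:R^-1 * (C * H * n%:R `^ 3^-1) <= C * H.
    rewrite ler_pdivrMl// mulrC ler_wpM2r ?mulr_ge0 ?(ltW C0)//.
    rewrite -[leRHS]powRr1 ?(ltW nr0)// ler_powR//; last by lra.
    by rewrite ler1n.
  have h2 : n%:R^-1 `^ th^-1 <= 1.
    apply: (@le_trans _ _ (1 `^ th^-1)); last by rewrite powR1.
    rewrite ge0_ler_powR ?nnegrE ?invr_ge0 ?(ltW nr0)//.
      by move: th2; lra.
    by rewrite invf_le1// ler1n.
  have h3 : H * n%:R^-1 `^ th^-1 <= H by rewrite ler_piMr.
  have := inc t k tN kn kt'; lra.
have [lev osc lip] := hA H n H1 hn.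
have [e3 e2] := eps_le H1.
have e0 := eps_gt0 H1.
have oscX k : (k < n * N)%N -> fnorm (X k.+1 - X k) <= eps H / 2.
  move=> kn.
  have := inc (k.+1%:R / n%:R) k (introT andP (conj (grid_ge0 n k.+1) (grid_le n0 kn))) (ltnW kn).
  rewrite (euler_path_grid _ _ _ n0) lexx andbT ler_pM2r ?invr_gt0// ler_nat leqnSn.
  by move=> /(_ isT) /le_trans; apply.
have low k : (k <= n * N)%N -> eps H <= dotp v (X k).
  apply: (euler_grid_lower_bound (H := H) (ga := th^-1) hb n0 e0 lev e3 e2).
  - by move=> j jn; apply: (le_trans (oscX j jn)); rewrite -/(eps H); lra.
  - move=> i j /andP[ij jn]; rewrite natrB// mulrBl; case: hw => _ hw.
    apply: hw; rewrite ?grid_ge0// ?grid_le//.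
    by rewrite ler_pM2r ?invr_gt0// ler_nat.
  - by move=> u u0; apply: noc.
have path t : 0 <= t <= N%:R -> eps H / 2 <= dotp v (euler_path (cutoff v tau b) x0 w n t).
  move=> tN; have /andP[t0 _] := tN; have /andP[kt tk] := grid_bounds n0 t0.
  have kn := truncn_le_horizon n tN; set k := Num.truncn _ in kt tk kn.
  have kt' := introT andP (conj kt (ltW tk)).
  have := le_trans (inc t k tN kn kt') osc.
  move=> /(le_trans (normr_dotp_unit _ (rd_unit hb))).
  rewrite dotpBr ler_norml => /andP[]; have := low k kn; rewrite -/(eps H); lra.
split=> // k kn; first exact: le_trans lev (low k kn).
have [_ _ hb3] := hCX k kn; apply: (le_trans (hb3 (eps H) lev (low k kn))).
rewrite /drift_bound ler_wpM2r ?addr_ge0 ?powR_ge0// ler_wpM2r//.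
by lra.
Qed.

(** r_k measures how far the drift of Y moves from its value at the start of step k. The last
    summand is the motion of both paths, apart from the noise, in the incomplete final step. Y has
    to be controlled only up to T, so it can be compared up to an exit time. *)
Lemma euler_vs_driven (tau C H T : R) w n (Y g : R -> 'rV[R]_d) (r : nat -> R) :
  0 <= C -> 1 <= H -> (0 < n)%N -> safe_scheme tau C H w n -> Y 0 = x0 ->
  T <= N%:R -> driven w g Y T ->
  (forall u, 0 <= u <= T -> fnorm (g u) <= drift_bound C H) ->
  (forall k, k%:R / n%:R <= T -> eps H / 2 <= dotp v (Y (k%:R / n%:R))) ->
  (forall k, 0 <= r k) ->
  (forall k u, k%:R / n%:R <= u < k.+1%:R / n%:R -> u <= T ->
     fnorm (g u - b (Y (k%:R / n%:R))) <= r k) ->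
  forall t, 0 <= t <= T ->
    fnorm (euler_path (cutoff v tau b) x0 w n t - Y t) <=
    expR ((c + 1) * N%:R) *
      (n%:R^-1 * \sum_(j < Num.truncn (n%:R * t)) (d%:R * r j)) +
    (1 + d%:R) * (drift_bound C H * n%:R^-1).
Proof.
move=> C0 H1 n0 [lip lev lo dri _] Y0 TN dr gB Ylo r0 gr t /andP[t0 tT].
have tN : 0 <= t <= N%:R by rewrite t0 (le_trans tT).
have /andP[kt tk] := grid_bounds n0 t0.
have kn := truncn_le_horizon n tN; set k := Num.truncn _ in kt tk kn *.
have kt' := introT andP (conj kt (ltW tk)).
have nr0 : 0 < n%:R :> R by rewrite ltr0n.
set X := euler_grid (cutoff v tau b) x0 w n in lev lo dri *.
have B0 := drift_bound_ge0 C0 H1.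
have /andP[t1 t2] := step_length n0 kt'.
have jk_le j : (j <= k)%N -> j%:R / n%:R <= T.
  by move=> jk; rewrite (le_trans _ tT)// (le_trans _ kt)// ler_pM2r ?invr_gt0// ler_nat.
have stab : fnorm (X k - Y (k%:R / n%:R)) <=
    expR ((c + 1) * N%:R) * (n%:R^-1 * \sum_(j < k) (d%:R * r j)).
  apply: (@euler_grid_stability _ _ _ _ _ _ _ _ _ _ hb w Y n k tau (eps H / 2) 1 N%:R
    (fun j => d%:R * r j) n0 (eps_half_gt0 H1) ler01 lip (grid_le n0 kn) Y0) => //.
  - move=> j jk; have jn := leq_trans jk kn; rewrite ge_max -/X lev//=.
    by apply: le_trans (lo j jn); have := eps_gt0 H1; lra.
  - by move=> j jk; apply: Ylo; exact: jk_le.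
  move=> j jk; split; first by rewrite mulr_ge0.
  have js : j%:R / n%:R <= j.+1%:R / n%:R :> R by rewrite ler_pM2r ?invr_gt0// ler_nat.
  have := dr (j%:R / n%:R) (j.+1%:R / n%:R) (b (Y (j%:R / n%:R))) (r j)
    (grid_ge0 n j) js (jk_le _ jk).
  have -> : j.+1%:R / n%:R - j%:R / n%:R = n%:R^-1 :> R by rewrite grid_succ// addrAC subrr add0r.
  rewrite [n%:R^-1 * (d%:R * _)]mulrC; apply => u /andP[u1 u2].
  by apply: gr; rewrite ?u1 ?u2// (le_trans (ltW u2))// jk_le.
rewrite (euler_path_step _ _ _ n0 kt') -/X /cutoff lev//.
(* In the final step the defect of Y is taken relative to the drift a = 0. *)
rewrite (_ : _ - Y t = (X k - Y (k%:R / n%:R)) + ((t - k%:R / n%:R) *: b (X k) -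
   (Y t - Y (k%:R / n%:R) - (w t - w (k%:R / n%:R)) - (t - k%:R / n%:R) *: 0))); last first.
  by apply/rowP => i; rewrite !mxE; ring.
rewrite (le_trans (fnormD _ _))// lerD//.
rewrite mulrDl mul1r (le_trans (fnormD _ _))// fnormN lerD//.
  by rewrite fnormZ ger0_norm// mulrC ler_pM ?fnorm_ge0// dri.
apply: (le_trans (dr _ _ 0 (drift_bound C H) (grid_ge0 n k) kt tT _)).
  move=> u /andP[u1 u2]; rewrite subr0 gB// (le_trans (grid_ge0 n k) u1)/=.
  by rewrite (le_trans (ltW u2)).
by rewrite -mulrA ler_wpM2l// ler_wpM2l.
Qed.

End path_convergence.

(** * Limits with explicit rates *)

Section real_sequences.
Context {R : realType}.

Lemma exists_inv_powR_le (K e a : R) : 0 < e -> 0 < a ->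
  exists n0 : nat, (0 < n0)%N /\ forall n, (n0 <= n)%N -> K * n%:R^-1 `^ a <= e.
Proof.
move=> e0 a0.
have [n1 hn1] := exists_nat_ge ((Num.max K 1 / e) `^ a^-1).
exists n1.+1; split=> // n n1n.
have K0 : 0 < Num.max K 1 by rewrite lt_max ltr01 orbT.
have n0 : 0 < n%:R :> R by rewrite ltr0n (leq_trans _ n1n).
apply: (@le_trans _ _ (Num.max K 1 * n%:R^-1 `^ a)).
  by rewrite ler_wpM2r ?powR_ge0// le_max lexx.
rewrite -powR_inv1 ?(ltW n0)// -powRrM mulN1r powRN ler_pdivrMr ?powR_gt0// mulrC -ler_pdivrMr//.
have Ke : 0 < Num.max K 1 / e by rewrite divr_gt0.
have -> : Num.max K 1 / e = ((Num.max K 1 / e) `^ a^-1) `^ a.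
  by rewrite -powRrM mulVf ?lt0r_neq0// powRr1 ?(ltW Ke).
rewrite ge0_ler_powR ?nnegrE ?powR_ge0 ?(ltW a0) ?(ltW n0)// (le_trans hn1)//.
by rewrite ler_nat (leq_trans _ n1n).
Qed.

(** The way inequalities pass to the limit below: apply it to the difference of the two sides, known
    up to an error K n^(-a). *)
Lemma le_of_le_inv_powR (x K a : R) (n0 : nat) : 0 < a ->
  (forall n, (n0 <= n)%N -> x <= K * n%:R^-1 `^ a) -> x <= 0.
Proof.
move=> a0 h; rewrite leNgt; apply/negP => x0.
have [n1 [_ hn1]] := exists_inv_powR_le K (divr_gt0 x0 (ltr0n R 2)) a0.
have := le_trans (h (maxn n0 n1) (leq_maxl _ _)) (hn1 (maxn n0 n1) (leq_maxr _ _)).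
lra.
Qed.

Lemma limn_rate (u : nat -> R) (K a : R) (n0 : nat) : 0 < a ->
  (forall n m, (n0 <= n <= m)%N -> `|u n - u m| <= K * n%:R^-1 `^ a) ->
  forall n, (n0 <= n)%N -> `|u n - limn u| <= K * n%:R^-1 `^ a.
Proof.
move=> a0 h.
have cu : cvgn u.
  apply/cauchy_cvgP/cauchy_exP => e e0.
  have [n1 [_ hn1]] := exists_inv_powR_le K (divr_gt0 e0 (ltr0n R 2)) a0.
  exists (u (maxn n0 n1)); exists (maxn n0 n1) => // m /= nm.
  rewrite /ball/= (le_lt_trans (h _ m _))// ?leq_maxl//.
  by rewrite (le_lt_trans (hn1 _ (leq_maxr _ _)))//; lra.
move=> n n0n.
have cn : (fun m => `|u n - u m|) @ \oo --> `|u n - limn u|.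
  by apply: cvg_norm; apply: cvgB => //; exact: cvg_cst.
rewrite -(cvg_lim _ cn)//; apply: limr_le; first by apply/cvg_ex; eexists; exact: cn.
by exists n => // m /= nm; apply: h; rewrite n0n.
Qed.

End real_sequences.

(** * Cauchy property and limit of the schemes *)

Section limit_path.
Context {R : realType} {d : nat} {v : 'rV[R]_d} {b : 'rV[R]_d -> 'rV[R]_d}.
Context {x0 : 'rV[R]_d} {c l al eta kap : R}.
Context (hb : repulsive_drift v b x0 c l al eta kap).
Context (th : R) (th2 : 2 < th) (th3 : th <= 3).
Context (c0 : R) (q : nat) (c00 : 0 < c0) (c0m : c0 <= Num.min (eta / 3) (dotp v x0 / 2)).
Context (q0 : (0 < q)%N).
Context (noc : forall H u : R, 1 <= H -> 0 < u ->
  H * u `^ th^-1 < c0 * H ^- q + kap * (3 * (c0 * H ^- q)) `^ (- al) * u).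
Context (N : nat) (N0 : (0 < N)%N).

Notation epsH := (eps c0 q).
Notation LH := (fun H => lip_above (c := c) (l := l) (eps c0 q H / 2)).
Notation BH := (drift_bound (l := l) c0 q).
Notation safe := (safe_scheme (v := v) (b := b) (x0 := x0) (c := c) (l := l) c0 q N).
Notation a := (th^-1).

Let a0 : 0 < a. Proof. by rewrite invr_gt0; move: th2; lra. Qed.

Let inv_le_powR (n : nat) : (0 < n)%N -> n%:R^-1 <= n%:R^-1 `^ a :> R.
Proof.
move=> n0; rewrite -[leLHS]powRr1 ?invr_ge0// ger_powR//.
  by rewrite invr_gt0 ltr0n n0 invf_le1 ?ltr0n// ler1n.
by rewrite invf_le1; move: th2; lra.
Qed.

Lemma driven_modulus (w : R -> 'rV[R]_d) H B T (g Y : R -> 'rV[R]_d) s t : 0 <= H -> 0 <= B -> holder_path th N H w ->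
  driven w g Y T -> T <= N%:R -> (forall u, 0 <= u <= T -> fnorm (g u) <= B) ->
  0 <= s -> s <= t -> t <= T ->
  fnorm (Y t - Y s) <= d%:R * B * (t - s) + H * (t - s) `^ a.
Proof.
move=> H0 B0 [w0 hw] dr TN gB s0 st tT.
rewrite -[Y t - Y s](subrK (w t - w s)) (le_trans (fnormD _ _))// lerD//; last first.
  by apply: hw => //; exact: le_trans TN.
have := dr s t 0 B s0 st tT; rewrite scaler0 subr0; apply => u /andP[su ut].
by rewrite subr0 gB// (le_trans s0 su) (le_trans (ltW ut) tT).
Qed.

Lemma driven_modulus_step (w : R -> 'rV[R]_d) H B T (g Y : R -> 'rV[R]_d) s t n : (0 < n)%N ->
  0 <= H -> 0 <= B -> holder_path th N H w ->
  driven w g Y T -> T <= N%:R -> (forall u, 0 <= u <= T -> fnorm (g u) <= B) ->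
  0 <= s <= T -> 0 <= t <= T -> `|t - s| <= n%:R^-1 ->
  fnorm (Y t - Y s) <= (d%:R * B + H) * n%:R^-1 `^ a.
Proof.
move=> n0 H0 B0 hw dr TN gB.
wlog st : s t / s <= t.
  move=> hwlog sT tT; have [st|/ltW ts] := leP s t; first exact: hwlog.
  by rewrite distrC fnormB; exact: hwlog.
move=> /andP[s0 sT] /andP[t0 tT]; rewrite ger0_norm ?subr_ge0// => tsn.
apply: (le_trans (driven_modulus H0 B0 hw dr TN gB s0 st tT)).
rewrite mulrDl lerD//.
  by rewrite ler_wpM2l ?mulr_ge0// (le_trans tsn)// inv_le_powR.
by rewrite ler_wpM2l// ge0_ler_powR ?nnegrE ?(ltW a0) ?subr_ge0 ?invr_ge0.
Qed.

Section euler_driven.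
Context (tau C H : R) (w : R -> 'rV[R]_d) (n : nat).
Context (n0 : (0 < n)%N) (C0 : 0 <= C) (H1 : 1 <= H) (hw : holder_path th N H w).
Context (ss : safe tau C H w n).
Let E := euler_path (cutoff v tau b) x0 w n.
Let g u := cutoff v tau b (E (grid n u)).

Lemma euler_path_driven : driven w g E N%:R.
Proof.
by apply: ode_solution_driven; apply: euler_path_ode_solution => //; case: hw.
Qed.

Lemma grid_in (u : R) : 0 <= u <= N%:R -> 0 <= grid n u <= N%:R.
Proof.
move=> /[dup] uN /andP[u0 _]; rewrite gridE// grid_ge0 grid_le//.
exact: truncn_le_horizon.
Qed.

Lemma euler_path_drift (u : R) : 0 <= u <= N%:R -> g u = b (E (grid n u)).
Proof.
move=> /[dup] uN /andP[u0 _]; rewrite /g gridE// /E euler_path_grid// /cutoff.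
by rewrite (ss_level ss)// truncn_le_horizon.
Qed.

Lemma euler_path_drift_le (u : R) : 0 <= u <= N%:R -> fnorm (g u) <= BH C H.
Proof.
move=> /[dup] uN /andP[u0 _]; rewrite euler_path_drift// gridE// /E euler_path_grid//.
by rewrite (ss_drift ss)// truncn_le_horizon.
Qed.

Lemma grid_dist (u : R) : 0 <= u -> `|u - grid n u| <= n%:R^-1.
Proof.
move=> u0; rewrite gridE//; have /andP[h1 h2] := grid_bounds n0 u0.
have := step_length n0 (introT andP (conj h1 (ltW h2))) => /andP[h3 h4].
by rewrite ger0_norm.
Qed.

Lemma euler_path_modulus (s t : R) m : (0 < m)%N -> 0 <= s <= N%:R -> 0 <= t <= N%:R ->
  `|t - s| <= m%:R^-1 -> fnorm (E t - E s) <= (d%:R * BH C H + H) * m%:R^-1 `^ a.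
Proof.
move=> m0; apply: (driven_modulus_step m0 (le_trans ler01 H1) _ hw euler_path_driven) => //.
  by apply: drift_bound_ge0.
exact: euler_path_drift_le.
Qed.

End euler_driven.

(** The bound of [euler_vs_driven] when each r_j is the Lipschitz constant times the modulus of Y
    over a step; at most n N steps, divided by n, give the factor N. *)
Definition compare_const C H :=
  expR ((c + 1) * N%:R) * (N%:R * (d%:R * (LH H * (d%:R * BH C H + H)))) +
  (1 + d%:R) * BH C H.

(** The delay u - s allowed in the drift covers both applications: s = u for a solution, and s the
    grid time for a finer scheme. *)
Lemma euler_vs_driven_modulus (tau C H T : R) w n (Y g : R -> 'rV[R]_d) :
  0 <= C -> 1 <= H -> (0 < n)%N -> safe tau C H w n ->
  holder_path th N H w -> Y 0 = x0 -> T <= N%:R -> driven w g Y T ->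
  (forall u, 0 <= u <= T -> fnorm (g u) <= BH C H) ->
  (forall u, 0 <= u <= T -> epsH H / 2 <= dotp v (Y u)) ->
  (forall u, 0 <= u <= T -> exists2 s, 0 <= s <= T /\ 0 <= u - s <= n%:R^-1 & g u = b (Y s)) ->
  forall t, 0 <= t <= T ->
    fnorm (euler_path (cutoff v tau b) x0 w n t - Y t) <=
    compare_const C H * n%:R^-1 `^ a.
Proof.
move=> C0 H1 n0 ss hw Y0 TN dr gB Ylo gY t tT.
have H0 : 0 <= H by exact: le_trans H1.
have B0 : 0 <= BH C H by exact: drift_bound_ge0.
have L0 : 0 <= LH H by exact: (lip_above_ge0 hb).
have nr0 : 0 < n%:R :> R by rewrite ltr0n.
pose r : R := LH H * ((d%:R * BH C H + H) * n%:R^-1 `^ a).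
have r0 : 0 <= r.
  by rewrite /r mulr_ge0 ?lip_above_ge0// mulr_ge0 ?powR_ge0// addr_ge0// mulr_ge0.
have /andP[t0 tTT] := tT.
have kn := truncn_le_horizon n (introT andP (conj t0 (le_trans tTT TN))).
apply: (le_trans (@euler_vs_driven _ _ _ _ _ _ _ _ _ _ hb c0 q c00 N _ _ _ _ _ _ _ _ (fun=> r) C0 H1 n0 ss Y0 TN dr gB _ (fun=> r0) _ t tT)).
- by move=> k kT; apply: Ylo; rewrite grid_ge0 kT.
- move=> k u /[dup] ku /andP[ku1 ku2] uT.
  have u0 : 0 <= u by rewrite (le_trans _ ku1)// grid_ge0.
  have [s [/[dup] sT /andP[s0 sT'] /andP[s1 s2]] ->] := gY u (introT andP (conj u0 uT)).
  have kT : 0 <= (k%:R / n%:R : R) <= T.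
    by apply/andP; split; [exact: divr_ge0|exact: le_trans uT].
  apply: (le_trans (lip_aboveP hb (eps_half_gt0 q c00 H1) _ _)); [exact: Ylo|exact: Ylo|].
  rewrite ler_wpM2l//.
  apply: (driven_modulus_step n0 H0 B0 hw dr TN gB kT sT).
  (* Both s and k/n lie in [u - 1/n, u], so they differ by at most 1/n. *)
  have := step_length n0 (introT andP (conj ku1 (ltW ku2))) => /andP[h3 h4].
  by rewrite ler_norml; apply/andP; split; lra.
- rewrite sumr_const card_ord /compare_const [leRHS]mulrDl lerD//; last first.
    by rewrite mulrA; apply: ler_wpM2l; rewrite ?inv_le_powR// mulr_ge0// addr_ge0.
  have h : n%:R^-1 * (d%:R * r *+ Num.truncn (n%:R * t)) <= N%:R * (d%:R * r).
    rewrite ler_pdivrMl// -[_ *+ Num.truncn _]mulr_natl [leRHS]mulrA -natrM.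
    by apply: ler_wpM2r; [exact: mulr_ge0|rewrite ler_nat].
  rewrite -mulrA ler_wpM2l ?expR_ge0//; apply: (le_trans h).
  by rewrite /r le_eqVlt; apply/orP; left; apply/eqP; ring.
Qed.

End limit_path.

Section continuity.
Context {R : realType}.

Lemma within_continuousP (V : normedModType R) (A : set R) (f : R -> V) :
  {within A, continuous f} <->
  forall x, A x -> forall e, 0 < e -> exists2 dl, 0 < dl &
    forall y, A y -> `|y - x| < dl -> `|f y - f x| <= e.
Proof.
rewrite subspace_continuousP; split=> h x Ax.
  move=> e e0; have /cvgrPdist_le/(_ _ e0) := h x Ax.
  rewrite near_withinE => /nbhs_ballP[dl /= dl0 hd]; exists dl => // y Ay yx.
  by rewrite distrC; apply: hd => //; rewrite /ball/= distrC.
apply/cvgrPdist_le => e e0; rewrite near_withinE.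
have [dl dl0 hd] := h x Ax e e0.
apply/nbhs_ballP; exists dl => //= y xy Ay.
by rewrite distrC hd// distrC.
Qed.

Lemma mx_norm_le_fnorm d (x : 'rV[R]_d) : `|x| <= fnorm x.
Proof.
rewrite [`|x|]mx_normrE; apply: bigmax_le; first exact: fnorm_ge0.
by move=> [i j] _ /=; rewrite ord1 normr_coord_le.
Qed.

Lemma fnorm_le_mx_norm d (x : 'rV[R]_d) : fnorm x <= d%:R * `|x|.
Proof.
apply: (le_trans (fnorm_le_sum x)).
rewrite mulr_natl -[X in _ *+ X]card_ord -sumr_const; apply: ler_sum => i _.
by rewrite [`|x|]mx_normrE; apply: (le_bigmax _ (fun ij => `|x ij.1 ij.2|) (0, i)).
Qed.

(** tau is the supremum of the times up to which f stays above m. If f tau < m, continuity gives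
    values below m before tau; if f tau > m, then f stays above m beyond tau, against the choice of
    tau or against t1. *)
Lemma first_hit (f : R -> R) (T m t1 : R) : 0 <= t1 <= T ->
  {within `[0, T], continuous f} -> m < f 0 -> f t1 <= m ->
  exists tau, [/\ 0 <= tau <= T, f tau = m & forall s, 0 <= s < tau -> m < f s].
Proof.
move=> /andP[t10 t1T] /within_continuousP fc f0 ft1.
pose S := [set t | 0 <= t <= T /\ forall s, 0 <= s <= t -> m < f s].
have T0 : 0 <= T by exact: le_trans t1T.
have S0 : S 0.
  by split; [rewrite lexx T0|move=> s s0; rewrite -(le_anti s0)].
have hsS : has_sup S by split; [exists 0|exists T => t [/andP[]]].
pose tau := sup S.
have tau0 : 0 <= tau by apply: (ub_le_sup hsS.2 S0).
have tauT : tau <= T by apply: ge_sup; [exists 0|move=> t [/andP[]]].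
have below s : 0 <= s < tau -> m < f s.
  move=> /andP[s0 stau]; have e0 : 0 < tau - s by rewrite subr_gt0.
  have [t [_ hS]] := sup_adherent e0 hsS.
  by rewrite subKr => st; apply: hS; rewrite s0 ltW.
have inA s : 0 <= s -> s <= T -> `[0, T]%classic s by move=> s0 sT /=; rewrite in_itv/= s0.
exists tau; rewrite tau0 tauT; split=> //.
have [lt|gt|//] := ltgtP (f tau) m.
  have tauN0 : 0 < tau.
    by rewrite lt_neqAle tau0 andbT; apply/eqP => tau00; move: lt; rewrite -tau00 ltNge ltW.
  have e0 : 0 < (m - f tau) / 2 by rewrite divr_gt0// subr_gt0.
  have [dl dl0 hd] := fc tau (inA _ tau0 tauT) _ e0.
  pose s := Num.max 0 (tau - dl / 2).
  have s0 : 0 <= s by rewrite le_max lexx.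
  have st : s < tau by rewrite gt_max tauN0; lra.
  have sd : tau - dl / 2 <= s by rewrite le_max lexx orbT.
  have := hd s (inA _ s0 (ltW (lt_le_trans st tauT))).
  have -> : `|s - tau| < dl by rewrite ltr_norml; apply/andP; split; lra.
  move=> /(_ isT); rewrite ler_norml => /andP[_ h2].
  by have := below s (introT andP (conj s0 st)); lra.
have e0 : 0 < (f tau - m) / 2 by rewrite divr_gt0// subr_gt0.
have [dl dl0 hd] := fc tau (inA _ tau0 tauT) _ e0.
have above s : 0 <= s -> s <= T -> s <= tau + dl / 2 -> m < f s.
  move=> s0 sT sd; have [st|ts] := ltP s tau; first by apply: below; rewrite s0.
  have := hd s (inA _ s0 sT).
  have -> : `|s - tau| < dl by rewrite ltr_norml; apply/andP; split; lra.
  by move=> /(_ isT); rewrite ler_norml => /andP[h2 _]; lra.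
have [t1d|dt1] := leP t1 (tau + dl / 2).
  by have := above t1 t10 t1T t1d; rewrite ltNge ft1.
have : S (tau + dl / 2).
  split; first by apply/andP; split; lra.
  by move=> s /andP[s0 sd]; apply: above => //; lra.
by move=> /(ub_le_sup hsS.2); rewrite -/tau; lra.
Qed.

End continuity.

Section limit_path.
Context {R : realType} {d : nat} {v : 'rV[R]_d} {b : 'rV[R]_d -> 'rV[R]_d}.
Context {x0 : 'rV[R]_d} {c l al eta kap : R}.
Context (hb : repulsive_drift v b x0 c l al eta kap).
Context (th : R) (th2 : 2 < th).
Context (c0 : R) (q : nat) (c00 : 0 < c0) (q0 : (0 < q)%N).

Notation epsH := (eps c0 q).
Notation LH := (fun H => lip_above (c := c) (l := l) (eps c0 q H / 2)).
Notation BH := (drift_bound (l := l) c0 q).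
Notation safe := (safe_scheme (v := v) (b := b) (x0 := x0) (c := c) (l := l) c0 q).
Notation KH N := (compare_const (d := d) (c := c) (l := l) c0 q N).
Notation a := (th^-1).
Notation euler delta om n := (euler_path (cutoff v (level delta om n) b) x0).

Let a0 : 0 < a. Proof. by rewrite invr_gt0; move: th2; lra. Qed.

Definition scheme_estimates (N : nat) (delta om C A : R) (Q : nat) :=
  0 < C /\ 0 < A /\
  forall H w n, 1 <= H -> holder_path th N H w -> (0 < n)%N ->
    (forall t, 0 <= t <= N%:R -> fnorm (euler delta om n w n t) <= C * H) /\
    (A * H ^+ Q <= n%:R -> safe N (level delta om n) C H w n).

Definition path_limit (E : nat -> R -> 'rV[R]_d) (t : R) : 'rV[R]_d :=
  \row_i limn (fun n => E n t 0 i).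

Section one_path.
Context (N : nat) (N0 : (0 < N)%N).
Context (delta om C A H : R) (Q : nat) (w : R -> 'rV[R]_d).
Context (est : scheme_estimates N delta om C A Q).
Context (H1 : 1 <= H) (hw : holder_path th N H w).
Let E n := euler delta om n w n.
Let X := path_limit E.

Let C0 : 0 <= C. Proof. by case: est => /ltW. Qed.
Let H0 : 0 <= H. Proof. exact: le_trans H1. Qed.
Let B0 : 0 <= BH C H. Proof. exact: drift_bound_ge0. Qed.
Let L0 : 0 <= LH H. Proof. exact: (lip_above_ge0 hb). Qed.

(** The finer scheme m is itself a driven path, with drift delayed by at most 1/m <= 1/n, so it can
    play the role of Y against the coarser scheme n. *)
Lemma euler_path_cauchy : exists n0 : nat, (0 < n0)%N /\ forall n, (n0 <= n)%N ->
  safe N (level delta om n) C H w n /\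
  forall m, (n <= m)%N -> forall t, 0 <= t <= N%:R ->
    fnorm (E n t - E m t) <= KH N C H * n%:R^-1 `^ a.
Proof.
have [n1 hn1] := exists_nat_ge (A * H ^+ Q).
case: est => _ [A0 he].
exists n1.+1; split=> // n n1n.
have n0 : (0 < n)%N by exact: leq_trans n1n.
have sn j : (n <= j)%N -> safe N (level delta om j) C H w j.
  move=> nj; have [_] := he H w j H1 hw (leq_trans n0 nj); apply.
  by rewrite (le_trans hn1)// ler_nat (leq_trans _ nj)// ltnW.
split=> [|m nm t tN]; first exact: sn.
have m0 := leq_trans n0 nm.
apply: (euler_vs_driven_modulus hb th2 c00 (g := fun u => cutoff v (level delta om m) b (E m (grid m u))) C0 H1 n0 (sn n (leqnn n)) hw (T := N%:R)) => //.
- by rewrite /E /euler_path mulr0 truncn0 mul0r /= subrr scale0r subrr !addr0.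
- by apply: euler_path_driven => //; exact: hw.
- by move=> u uN; exact: (euler_path_drift_le m0 (sn m nm) uN).
- by move=> u uN; apply: (ss_path (sn m nm)).
- move=> u /[dup] uN /andP[u0 _]; exists (grid m u).
    split; first exact: grid_in.
    have := grid_dist m0 u0; rewrite gridE//.
    have /andP[h1 h2] := grid_bounds m0 u0.
    rewrite ger0_norm ?subr_ge0// => h3; rewrite h1/= (le_trans h3)//.
    by rewrite lef_pV2 ?posrE ?ltr0n// ler_nat.
  exact: (euler_path_drift m0 (sn m nm) uN).
Qed.

Record limit_props (Y : R -> 'rV[R]_d) : Prop := LimitProps {
  lp_bound : forall t, 0 <= t <= N%:R -> fnorm (Y t) <= C * H ;
  lp_eps : forall t, 0 <= t <= N%:R -> epsH H / 2 <= dotp v (Y t) ;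
  lp_drift : forall t, 0 <= t <= N%:R -> fnorm (b (Y t)) <= BH C H ;
  lp_modulus : forall s t m, (0 < m)%N -> 0 <= s <= N%:R -> 0 <= t <= N%:R ->
    `|t - s| <= m%:R^-1 -> fnorm (Y t - Y s) <= (d%:R * BH C H + H) * m%:R^-1 `^ a ;
  lp_sol : ode_solution w x0 (fun t => b (Y t)) Y N%:R }.

Lemma euler_path_limit : exists n0 : nat, (0 < n0)%N /\ forall n, (n0 <= n)%N ->
  safe N (level delta om n) C H w n /\
  forall t, 0 <= t <= N%:R ->
    fnorm (E n t - X t) <= d%:R * KH N C H * n%:R^-1 `^ a.
Proof.
have [n0 [n00 hn]] := euler_path_cauchy; exists n0; split=> // n n0n.
have [ss _] := hn n n0n; split=> // t tN.
apply: (le_trans (fnorm_le_sum _)).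
rewrite -mulrA mulr_natl -[X in _ *+ X]card_ord -sumr_const; apply: ler_sum => i _.
have -> : (E n t - X t) 0 i = E n t 0 i - limn (fun k => E k t 0 i) by rewrite !mxE.
apply: (@limn_rate _ (fun k => E k t 0 i) _ _ n0 a0 _ n n0n) => k m /andP[n0k km].
have [_ hk] := hn k n0k.
by have := le_trans (normr_coord_le _ i) (hk m km t tN); rewrite !mxE.
Qed.

(** Each bound on Y holds up to an error of order n^(-a), which [le_of_le_inv_powR] removes; the
    integral equation needs in addition convergence of the drifts. *)
Lemma limit_props_of_cvg (F : nat -> R -> 'rV[R]_d) (Y : R -> 'rV[R]_d) (K G : R) (n0 : nat) :
  0 <= K -> G = d%:R * BH C H + H -> 
  (forall n, (n0 <= n)%N -> (0 < n)%N) ->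
  (forall n t, (n0 <= n)%N -> 0 <= t <= N%:R -> 
    [/\ fnorm (F n t) <= C * H, epsH H / 2 <= dotp v (F n t),
        fnorm (b (F n (grid n t))) <= BH C H &
        fnorm (F n t - Y t) <= K * n%:R^-1 `^ a]) ->
  (forall n s t m, (n0 <= n)%N -> (0 < m)%N -> 0 <= s <= N%:R -> 0 <= t <= N%:R ->
    `|t - s| <= m%:R^-1 -> fnorm (F n t - F n s) <= G * m%:R^-1 `^ a) ->
  (forall n, (n0 <= n)%N -> ode_solution w x0 (fun t => b (F n (grid n t))) (F n) N%:R) ->
  limit_props Y.
Proof.
move=> K0 GE n0_gt hF modF solF.
have G0 : 0 <= G by rewrite GE addr_ge0// mulr_ge0.
have bound t : 0 <= t <= N%:R -> fnorm (Y t) <= C * H.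
  move=> tN; rewrite -subr_le0; apply: (le_of_le_inv_powR (K := K) (n0 := n0) a0) => n n0n.
  have [h1 _ _ h2] := hF n t n0n tN.
  have := fnorm_leD (Y t) (F n t); rewrite fnormB; lra.
have Yeps t : 0 <= t <= N%:R -> epsH H / 2 <= dotp v (Y t).
  move=> tN; rewrite -subr_le0; apply: (le_of_le_inv_powR (K := K) (n0 := n0) a0) => n n0n.
  have [_ h1 _ h2] := hF n t n0n tN; have := le_trans (normr_dotp_unit _ (rd_unit hb)) h2.
  by rewrite dotpBr ler_norml => /andP[_]; lra.
have modY s t m : (0 < m)%N -> 0 <= s <= N%:R -> 0 <= t <= N%:R ->
    `|t - s| <= m%:R^-1 -> fnorm (Y t - Y s) <= G * m%:R^-1 `^ a.
  move=> m0 sN tN ts; rewrite -subr_le0.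
  apply: (le_of_le_inv_powR (K := 2 * K) (n0 := n0) a0) => n n0n.
  have [_ _ _ h1] := hF n t n0n tN; have [_ _ _ h2] := hF n s n0n sN.
  have h3 := modF n s t m n0n m0 sN tN ts.
  have h4 := fnorm_triangle (F n t) (Y t) (Y s).
  have h5 := fnorm_triangle (F n s) (F n t) (Y s).
  rewrite (fnormB (Y t) (F n t)) in h4; lra.
(* Uniform convergence of the drifts: both points lie above eps / 2, where b is Lipschitz, and the
   grid time is within 1/n of t. *)
have near n t : (n0 <= n)%N -> 0 <= t <= N%:R ->
    fnorm (b (F n (grid n t)) - b (Y t)) <= LH H * ((K + G) * n%:R^-1 `^ a).
  move=> n0n tN; have [_ _ _ h] := hF n t n0n tN.
  have gN := grid_in (n0_gt n n0n) tN; have [_ h1 _ _] := hF n _ n0n gN.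
  apply: (le_trans (lip_aboveP hb (eps_half_gt0 q c00 H1) h1 (Yeps t tN))).
  rewrite ler_wpM2l// mulrDl (le_trans (fnorm_triangle (F n t) _ _))// addrC lerD//.
  apply: modF => //; first exact: n0_gt.
  by rewrite distrC; apply: grid_dist; [exact: n0_gt|case/andP: tN].
have Ydrift t : 0 <= t <= N%:R -> fnorm (b (Y t)) <= BH C H.
  move=> tN; rewrite -subr_le0.
  apply: (le_of_le_inv_powR (K := LH H * (K + G)) (n0 := n0) a0) => n n0n.
  have [_ _ h _] := hF n t n0n tN; have := near n t n0n tN.
  by have := fnorm_leD (b (Y t)) (b (F n (grid n t))); rewrite fnormB mulrA; lra.
split=> //; first by rewrite -GE.
move=> t tN i.
have /andP[t0 tN'] := tN.
have sub s : 0 <= s <= t -> 0 <= s <= N%:R.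
  by move=> /andP[-> st]; rewrite (le_trans st).
(* The limit drift is continuous in time, by the modulus of Y and the Lipschitz bound above eps / 2,
   hence integrable on a compact interval. *)
have ib : lebesgue_measure.-integrable `[0, t] (EFin \o (fun s => b (Y s) 0 i)).
  apply: continuous_compact_integrable; first exact: segment_compact.
  apply/within_continuousP => s /=; rewrite in_itv/= => st e e0.
  have [m [m0 hm]] := exists_inv_powR_le (LH H * G) e0 a0.
  exists m%:R^-1; first by rewrite invr_gt0 ltr0n.
  move=> u; rewrite in_itv/= => ut us.
  have := normr_coord_le (b (Y u) - b (Y s)) i; rewrite !mxE => /le_trans; apply.
  apply: le_trans (hm m (leqnn m)); rewrite -mulrA.
  apply: (le_trans (lip_aboveP hb (eps_half_gt0 q c00 H1) (Yeps u (sub u ut)) (Yeps s (sub s st)))).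
  by rewrite ler_wpM2l// modY// ?sub// ltW.
split=> //.
apply/eqP; rewrite -subr_eq0 -normr_le0.
apply: (le_of_le_inv_powR (K := K + LH H * (K + G) * N%:R) (n0 := n0) a0) => n n0n.
have [_ _ _ h] := hF n t n0n tN.
have [iE eE] := solF n n0n t tN i.
have ht := le_trans (normr_coord_le _ i) h.
rewrite !mxE in ht.
have diff : `|\int[lebesgue_measure]_(s in `[0, t]) b (F n (grid n s)) 0 i -
     \int[lebesgue_measure]_(s in `[0, t]) b (Y s) 0 i| <= LH H * (K + G) * n%:R^-1 `^ a * N%:R.
  rewrite -RintegralB//.
  apply: le_trans (_ : LH H * (K + G) * n%:R^-1 `^ a * (t - 0) <= _); last first.
    rewrite subr0; apply: ler_wpM2l => //; apply: mulr_ge0; last exact: powR_ge0.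
    by apply: mulr_ge0 => //; exact: addr_ge0.
  apply: (normr_Rintegral_itv (b1 := true) (b2 := false) t0); first exact: (integrableB _ iE ib).
  move=> s.
  rewrite in_itv/= => st; have := near n s n0n (sub s st).
  rewrite -mulrA; apply: le_trans.
  by have := normr_coord_le (b (F n (grid n s)) - b (Y s)) i; rewrite !mxE.
rewrite [leRHS]mulrDl [X in _ <= _ + X]mulrAC.
move: ht diff; rewrite eE !ler_norml => /andP[ht1 ht2] /andP[hd1 hd2].
by apply/andP; split; lra.
Qed.

Lemma path_limitP : limit_props X.
Proof.
have [n0 [n00 hn]] := euler_path_limit.
have K0 : 0 <= d%:R * KH N C H.
  apply: mulr_ge0 => //; apply: addr_ge0.
    apply: mulr_ge0; first exact: expR_ge0.
    do 3 apply: mulr_ge0 => //; apply: addr_ge0 => //; exact: mulr_ge0.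
  by apply: mulr_ge0 => //; exact: addr_ge0.
have n0_gt n : (n0 <= n)%N -> (0 < n)%N by exact: leq_trans.
apply: (limit_props_of_cvg (F := E) K0 erefl n0_gt).
- move=> n t n0n tN; have [ss h] := hn n n0n; split.
  + case: est => _ [_ he]; have [hE _] := he H w n H1 hw (n0_gt n n0n).
    exact: hE.
  + exact: (ss_path ss).
  + have := euler_path_drift_le (n0_gt n n0n) ss tN.
    by rewrite (euler_path_drift (n0_gt n n0n) ss tN).
  + exact: h.
- move=> n s t m n0n m0 sN tN ts; have [ss h] := hn n n0n.
  exact: (euler_path_modulus th2 (n0_gt n n0n) C0 H1 hw ss m0 sN tN ts).
- move=> n n0n t tN i; have [ss h] := hn n n0n; have [w00 _] := hw.
  have [iE eE] := euler_path_ode_solution (cutoff v (level delta om n) b) x0 (n0_gt n n0n) w00 tN i.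
  have same : {in `[0, t]%classic, (fun s => cutoff v (level delta om n) b (E n (grid n s)) 0 i) =1
     (fun s => b (E n (grid n s)) 0 i)}.
    move=> s /set_mem /=; rewrite in_itv/= => /andP[s0 st].
    have /andP[_ tN'] := tN.
    congr (fun_of_matrix _ 0 i); apply: (euler_path_drift (n0_gt n n0n) ss).
    by rewrite s0 (le_trans st).
  split; last by rewrite [LHS]eE; congr (_ + _ + _); exact: eq_Rintegral.
  apply: (eq_integrable _ _ _ _ iE) => // s sI.
  by congr EFin; exact: same.
Qed.

End one_path.
End limit_path.

Lemma within_continuous_lip (R : realType) d (A : set R) (Y : R -> 'rV[R]_d)
    (g : 'rV[R]_d -> R) (k : R) :
  (forall x y, `|g y - g x| <= k * fnorm (y - x)) ->
  {within A, continuous Y} -> {within A, continuous (g \o Y)}.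
Proof.
move=> hg /within_continuousP hY; apply/within_continuousP => x Ax e e0.
have K0 : 0 < `|k| * d%:R + 1 by rewrite ltr_wpDl// mulr_ge0.
have [dl dl0 hd] := hY x Ax _ (divr_gt0 e0 K0).
exists dl => // y Ay yx; apply: (le_trans (hg _ _)).
have := hd y Ay yx; rewrite ler_pdivlMr// => /(le_trans _); apply.
apply: (@le_trans _ _ (`|k| * (d%:R * `|Y y - Y x|))).
  apply: (le_trans (ler_wpM2r (fnorm_ge0 _) (ler_norm k))).
  by rewrite ler_wpM2l// fnorm_le_mx_norm.
by rewrite mulrA mulrC ler_wpM2l// lerDl.
Qed.

(** * Uniqueness and rate along a single path *)

Section path_uniqueness.
Context {R : realType} {d : nat} {v : 'rV[R]_d} {b : 'rV[R]_d -> 'rV[R]_d}.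
Context {x0 : 'rV[R]_d} {c l al eta kap : R}.
Context (hb : repulsive_drift v b x0 c l al eta kap).
Context (th : R) (th2 : 2 < th).
Context (c0 : R) (q : nat) (c00 : 0 < c0) (q0 : (0 < q)%N).

Notation epsH := (eps c0 q).
Notation LH := (fun H => lip_above (c := c) (l := l) (eps c0 q H / 2)).
Notation BH := (drift_bound (l := l) c0 q).
Notation safe := (safe_scheme (v := v) (b := b) (x0 := x0) (c := c) (l := l) c0 q).
Notation KH N := (compare_const (d := d) (c := c) (l := l) c0 q N).
Notation a := (th^-1).
Notation euler delta om n := (euler_path (cutoff v (level delta om n) b) x0).
Notation estimates := (scheme_estimates (v := v) (b := b) (x0 := x0) (l := l) (c := c) th c0 q).
Notation lprops := (limit_props (v := v) (b := b) (x0 := x0) (l := l) th c0 q).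

Let a0 : 0 < a. Proof. by rewrite invr_gt0; move: th2; lra. Qed.

Section unique.
Context (N : nat) (N0 : (0 < N)%N).
Context (delta om C A H : R) (Q : nat) (w : R -> 'rV[R]_d).
Context (est : estimates N delta om C A Q).
Context (H1 : 1 <= H) (hw : holder_path th N H w).

Notation X := (path_limit (fun n => euler delta om n w n)).

Lemma holder_path_le H' : H <= H' -> holder_path th N H' w.
Proof.
move=> HH; case: hw => w0 h; split=> // s t s0 st tN.
by apply: (le_trans (h s t s0 st tN)); rewrite ler_wpM2r// powR_ge0.
Qed.

(** A path that is Hoelder with constant H is so with any larger constant. Enlarging H lowers the
    barrier and raises the drift bound until Y satisfies both; then the schemes converge to Y and to
    X. *)
Lemma path_unique_inside (Y : R -> 'rV[R]_d) (T m B : R) :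
  0 <= T <= N%:R -> 0 < m -> 0 <= B -> ode_solution w x0 (fun t => b (Y t)) Y T ->
  (forall t, 0 <= t <= T -> m <= dotp v (Y t)) ->
  (forall t, 0 <= t <= T -> fnorm (b (Y t)) <= B) ->
  forall t, 0 <= t <= T -> Y t = X t.
Proof.
move=> /andP[T0 TN] m0 B0 sol Ym YB t /[dup] tT /andP[t0 tT'].
case: (est) => C0 _.
(* The second term gives eps(H') / 2 <= m, since q >= 1; the third gives B <= C H', which is below
   the drift bound for H'. *)
pose H' := H + c0 / (2 * m) + B / C.
have cm0 : 0 <= c0 / (2 * m) by rewrite divr_ge0 ?(ltW c00)// mulr_ge0// ltW.
have BC0 : 0 <= B / C by rewrite divr_ge0// ltW.
have HH' : H <= H' by rewrite /H'; lra.
have H'1 : 1 <= H' by exact: le_trans HH'.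
have H'0 : 0 < H' by exact: lt_le_trans H'1.
have hw' := holder_path_le HH'.
have e'm : epsH H' / 2 <= m.
  rewrite ler_pdivrMr// /eps ler_pdivrMr ?exprn_gt0//.
  apply: (@le_trans _ _ (m * 2 * H')).
    rewrite mulrC -ler_pdivrMr ?mulr_gt0// (mulrC m) /H'; move: H1; lra.
  rewrite ler_pM2l ?mulr_gt0//; case: q q0 => // q' _.
  by rewrite exprS ler_peMr ?(ltW H'0)// exprn_ege1.
have B' : B <= BH C H'.
  apply: (@le_trans _ _ (C * H')).
    by rewrite mulrC -ler_pdivrMr// /H'; move: H1; lra.
  by rewrite /drift_bound ler_peMr ?mulr_ge0 ?(ltW C0) ?(ltW H'0)// lerDl powR_ge0.
have [n0 [n00 hn]] := euler_path_limit hb th2 c00 est H'1 hw'.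
apply/eqP; rewrite -subr_eq0; apply/eqP/fnorm_eq0/eqP.
rewrite eq_le fnorm_ge0 andbT.
apply: (le_of_le_inv_powR (K := d%:R * KH N C H' + KH N C H') (n0 := n0) a0) => n n0n.
have [ss h] := hn n n0n.
have tN : 0 <= t <= N%:R by rewrite t0 (le_trans tT').
have h1 := h t tN.
have w00 : w 0 = 0 by case: hw.
have h2 := @euler_vs_driven_modulus _ _ _ _ _ _ _ _ _ _ hb _ th2 _ _ c00 N
  _ C H' T w n Y (fun u => b (Y u)) (ltW C0) H'1 (leq_trans n00 n0n) ss hw'
  (ode_solution0 T0 w00 sol) TN (ode_solution_driven sol)
  (fun u uT => le_trans (YB u uT) B') (fun u uT => le_trans e'm (Ym u uT)) _ t tT.
have {}h2 := h2 _.
rewrite (le_trans (fnorm_triangle (euler delta om n w n t) _ _))//.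
rewrite mulrDl addrC lerD//.
rewrite fnormB; apply: h2 => u /[dup] uT /andP[u0 uT']; exists u => //.
by rewrite uT subrr lexx invr_ge0 ler0n.
Qed.

(** Outside D the drift b is arbitrary, so Y must first be kept inside. If Y reached eps / 4, it
    would equal X up to that time, but X never goes below eps / 2. *)
Lemma path_unique (Y : R -> 'rV[R]_d) :
  ode_solution w x0 (fun t => b (Y t)) Y N%:R -> {within `[0, N%:R], continuous Y} ->
  forall t, 0 <= t <= N%:R -> Y t = X t.
Proof.
move=> sol cY.
have hX := path_limitP hb th2 c00 est H1 hw.
have w00 : w 0 = 0 by case: hw.
have NN : 0 <= N%:R :> R by [].
have Y0 := ode_solution0 NN w00 sol.
have X0 := ode_solution0 NN w00 (lp_sol hX).
pose m := epsH H / 4.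
have e0 := eps_gt0 q c00 H1.
have m0 : 0 < m by rewrite divr_gt0.
have x0e : epsH H / 2 <= dotp v x0.
  by rewrite -X0; apply: (lp_eps hX); rewrite lexx.
have fc : {within `[0, N%:R], continuous (dotp v \o Y)}.
  apply: (within_continuous_lip (k := 1)) cY => x y.
  by rewrite -dotpBr mul1r normr_dotp_unit// (rd_unit hb).
have Yc : {within `[0, N%:R], continuous ((fun x => fnorm x) \o Y)}.
  apply: (within_continuous_lip (k := 1)) cY => x y; rewrite mul1r ler_norml.
  have := fnorm_leD y x; have := fnorm_leD x y; rewrite (fnormB x y); lra.
have [s0 _ hs0] := EVT_max NN Yc.
pose MY := fnorm (Y s0).
have YM t : 0 <= t <= N%:R -> fnorm (Y t) <= MY by move=> tN; apply: hs0; rewrite in_itv.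
(* Y is bounded on the compact time interval and x0 lies above m, so the Lipschitz bound on {rho >=
   m} controls b along Y as long as Y stays there. *)
pose B := fnorm (b x0) + lip_above (c := c) (l := l) m * (MY + fnorm x0).
have MY0 : 0 <= MY by exact: fnorm_ge0.
have B0 : 0 <= B.
  rewrite /B addr_ge0 ?fnorm_ge0// mulr_ge0 ?addr_ge0 ?fnorm_ge0//.
  exact: (lip_above_ge0 hb).
have bB t : 0 <= t <= N%:R -> m <= dotp v (Y t) -> fnorm (b (Y t)) <= B.
  move=> tN Ym; apply: (le_trans (fnorm_leD _ (b x0))); rewrite lerD2l.
  have x0m : m <= dotp v x0 by apply: le_trans x0e; rewrite /m; lra.
  apply: (le_trans (lip_aboveP hb m0 Ym x0m)); rewrite ler_wpM2l ?(lip_above_ge0 hb)//.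
  by rewrite (le_trans (fnormD _ _))// fnormN lerD// YM.
have above t : 0 <= t <= N%:R -> m < dotp v (Y t).
  move=> tN; rewrite ltNge; apply/negP => Ytm.
  have f0 : m < (dotp v \o Y) 0 by rewrite /= Y0 (lt_le_trans _ x0e)// /m; lra.
  have [tau [tauN ftau hlt]] := first_hit tN fc f0 Ytm.
  have /andP[tau0 tauN'] := tauN.
  have sub u : 0 <= u <= tau -> 0 <= u <= N%:R by move=> /andP[-> ?]; rewrite (le_trans _ tauN').
  have Ym u : 0 <= u <= tau -> m <= dotp v (Y u).
    move=> /andP[u0]; rewrite le_eqVlt => /orP[/eqP ->|ut]; first by rewrite -ftau.
    by apply: ltW; apply: hlt; rewrite u0.
  have solt : ode_solution w x0 (fun t => b (Y t)) Y tau by move=> u uT; apply: sol; exact: sub.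
  have YX := @path_unique_inside Y tau m B tauN m0 B0 solt Ym
    (fun u uT => bB u (sub u uT) (Ym u uT)) tau.
  have := lp_eps hX tauN; rewrite -YX ?tau0 ?lexx//.
  by move: ftau; rewrite /= /m; lra.
apply: (path_unique_inside (m := m) (B := B)) => //; first by rewrite NN lexx.
- by move=> t tN; apply: ltW; exact: above.
- by move=> t tN; apply: bB => //; apply: ltW; exact: above.
Qed.

End unique.

Lemma lip_above_poly : exists K (m : nat), 0 < K /\
  forall H, 1 <= H -> LH H <= K * H ^+ m /\ epsH H `^ (- l) <= K * H ^+ m.
Proof.
have cc := rd_c hb; have l0 := rd_l hb.
have [m hm] := exists_nat_ge (q%:R * l).
have pc : 0 <= (c0 / 2) `^ (- l) by exact: powR_ge0.
have pc' : 0 <= c0 `^ (- l) by exact: powR_ge0.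
exists (c * (1 + (c0 / 2) `^ (- l) + (c0 / 2) `^ (- l)) + c0 `^ (- l)), m.
have K1 : 0 < c * (1 + (c0 / 2) `^ (- l) + (c0 / 2) `^ (- l)) by rewrite mulr_gt0//; lra.
split=> [|H H1]; first by lra.
have H0 : 0 < H by exact: lt_le_trans H1.
have Hm1 : 1 <= H ^+ m by rewrite exprn_ege1.
have q1 : 0 < H ^+ q by rewrite exprn_gt0.
have pe k : 0 < k -> (k * H ^- q) `^ (- l) <= k `^ (- l) * H ^+ m.
  move=> k0; rewrite powRM ?invr_ge0 ?(ltW k0) ?(ltW q1)//.
  rewrite ler_wpM2l ?powR_ge0// -[(H ^+ q)^-1]powR_inv1 ?(ltW q1)// -powRrM.
  rewrite -!powR_mulrn ?(ltW H0)// -powRrM ler_powR//.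
  by move: hm; lra.
have h1 := pe c0 c00.
have h2 := pe (c0 / 2) (divr_gt0 c00 (ltr0n R 2)).
have e2 : epsH H / 2 = c0 / 2 * H ^- q by rewrite /eps mulrAC.
split; rewrite mulrDl.
  rewrite /lip_above e2; apply: le_trans (_ : c * (1 + (c0 / 2) `^ (- l) + (c0 / 2) `^ (- l)) * H ^+ m <= _).
    rewrite -[leRHS]mulrA ler_wpM2l ?(ltW cc)//; lra.
  by rewrite lerDl mulr_ge0// (le_trans ler01).
apply: (le_trans h1); rewrite lerDr mulr_ge0 ?(ltW K1)// (le_trans ler01)//.
Qed.

(** r_j keeps the actual oscillation M j of the noise over the step: replacing it by H n^(-1/th)
    would give a rate below 1/2, since th > 2. *)
Lemma path_rate N (delta om C A C' : R) (Q : nat) :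
  (0 < N)%N -> estimates N delta om C A Q -> 0 < C' ->
  exists C2 (Q2 : nat), 0 < C2 /\ forall H w (Y : R -> 'rV[R]_d) n (M : nat -> R),
    1 <= H -> holder_path th N H w -> lprops N C' H w Y -> (0 < n)%N ->
    (forall j, 0 <= M j) ->
    (forall j u, j%:R / n%:R <= u <= j.+1%:R / n%:R -> u <= N%:R ->
       fnorm (w u - w (j%:R / n%:R)) <= M j) ->
    forall t, 0 <= t <= N%:R -> fnorm (euler delta om n w n t - Y t) <=
      C2 * H ^+ Q2 * (n%:R^-1 `^ 2^-1 + n%:R^-1 * \sum_(j < n * N) M j).
Proof.
move=> N0 est C'0; case: (est) => C0 [A0 he].
have [K [m [K0 hK]]] := lip_above_poly.
have cc := rd_c hb.
pose E := expR ((c + 1) * N%:R); have E0 : 0 <= E by exact: expR_ge0.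
pose D : R := d%:R; have D0 : 0 <= D by exact: ler0n.
pose NN : R := N%:R; have NN0 : 0 <= NN by exact: ler0n.
(* A common constant, because [euler_vs_driven] takes one drift bound for the scheme and for Y. *)
pose CC := C + C'; have CC0 : 0 <= CC by rewrite addr_ge0// ltW.
pose KB := CC * (1 + K); have KB0 : 0 <= KB by rewrite mulr_ge0// addr_ge0// ltW.
pose P := E * (D * K * (NN * D * KB + 1)) + (1 + D) * KB.
have K0' := ltW K0.
have P0 : 0 <= P.
  apply: addr_ge0; last by apply: mulr_ge0 => //; exact: addr_ge0.
  apply: mulr_ge0 => //; apply: mulr_ge0; first exact: mulr_ge0.
  by apply: addr_ge0 => //; apply: mulr_ge0 => //; exact: mulr_ge0.
(* The power 2 m + 1 comes from the product of Lipschitz constant and drift bound, the power Q + 1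
   from the small values of n. *)
exists (1 + P + CC * A), ((m + m).+1 + Q.+1)%N; split.
  by rewrite -addrA ltr_wpDr// addr_ge0// mulr_ge0// ltW.
move=> H w Y n M H1 hw hY n0 M0 hM t tN.
have H0 : 0 <= H by exact: le_trans H1.
have [hE hsafe] := he H w n H1 hw n0.
have nr0 : 0 < n%:R :> R by rewrite ltr0n.
have n1 : 1 <= n%:R :> R by rewrite ler1n.
set y := n%:R^-1 `^ 2^-1; set S := n%:R^-1 * _.
have S0 : 0 <= S by rewrite mulr_ge0 ?invr_ge0// sumr_ge0.
have y0 : 0 <= y by exact: powR_ge0.
have ny : n%:R^-1 <= y.
  rewrite -[leLHS]powRr1 ?invr_ge0// /y ger_powR ?invr_gt0 ?nr0 ?invf_le1//; lra.
have pw k : 1 <= H ^+ k by rewrite exprn_ege1.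
have hyS : 0 <= y + S by exact: addr_ge0.
(* For small n the crude bound CC H already has the claimed form, because n < A H^Q gives 1 <= A H^Q
   n^(-1/2). *)
have [good|bad] := leP (A * H ^+ Q) n%:R; last first.
  have h1 := hE t tN; have h2 := lp_bound hY tN.
  apply: (@le_trans _ _ (CC * H)).
    by apply: (le_trans (fnormD _ _)); rewrite fnormN /CC mulrDl lerD.
  have one : 1 <= A * H ^+ Q * y.
    apply: (@le_trans _ _ (n%:R * y)); last by rewrite ler_wpM2r// ltW.
    by rewrite -ler_pdivrMl// mulr1.
  apply: (@le_trans _ _ (CC * H * (A * H ^+ Q * y))).
    by rewrite ler_peMr// mulr_ge0.
  rewrite (_ : _ * (A * H ^+ Q * y) = CC * A * H ^+ Q.+1 * y); last by rewrite exprS; ring.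
  apply: ler_pM => //; first by rewrite !mulr_ge0 ?(ltW A0)// exprn_ge0.
    apply: ler_pM => //; first by rewrite mulr_ge0// ltW.
    - by rewrite exprn_ge0.
    - lra.
    - by apply: ler_weXn2l => //; rewrite leq_addl.
  by rewrite lerDl.
have ss := hsafe good.
have BC1 : BH C H <= BH CC H.
  rewrite /drift_bound ler_wpM2r ?addr_ge0 ?powR_ge0// ler_wpM2r// /CC; lra.
have BC2 : BH C' H <= BH CC H.
  rewrite /drift_bound ler_wpM2r ?addr_ge0 ?powR_ge0// ler_wpM2r// /CC; lra.
have ss' : safe N (level delta om n) CC H w n.
  case: ss => s1 s2 s3 s4 s5; split=> // k kn; exact: le_trans (s4 k kn) BC1.
have [hL he'] := hK H H1.
pose L := LH H; have L0 : 0 <= L by exact: (lip_above_ge0 hb).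
pose B := BH CC H; have B0 : 0 <= B by exact: drift_bound_ge0.
have w00 : w 0 = 0 by case: hw.
(* Over one step Y moves by at most D B / n through the drift and by M j through the noise. *)
pose r j := L * (D * B * n%:R^-1 + M j).
have r0 j : 0 <= r j.
  apply: mulr_ge0 => //; apply: addr_ge0 => //; apply: mulr_ge0; first exact: mulr_ge0.
  by rewrite invr_ge0 ltW.
have dr := ode_solution_driven (lp_sol hY).
have YB u : 0 <= u <= N%:R -> fnorm (b (Y u)) <= B.
  by move=> uN; apply: le_trans (lp_drift hY uN) BC2.
have := @euler_vs_driven _ _ _ _ _ _ _ _ _ _ hb c0 q c00 N (level delta om n) CC H N%:R w n Y
  (fun u => b (Y u)) r CC0 H1 n0 ss' (ode_solution0 NN0 w00 (lp_sol hY)) (lexx _) dr YB _ r0 _ t tN.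
rewrite -/E -/B -/D => hcmp.
apply: (le_trans (hcmp _ _)).
- by move=> k kN; apply: (lp_eps hY); rewrite divr_ge0.
- move=> k u /andP[ku uk] uN.
  have kN : 0 <= (k%:R / n%:R : R) by exact: divr_ge0.
  have uN' : 0 <= u <= N%:R by rewrite uN (le_trans kN ku).
  have kN' : 0 <= (k%:R / n%:R : R) <= N%:R by apply/andP; split => //; exact: le_trans uN.
  apply: (le_trans (lip_aboveP hb (eps_half_gt0 q c00 H1) (lp_eps hY uN') (lp_eps hY kN'))).
  rewrite -/(LH H) -/L ler_wpM2l// -[Y u - _](subrK (w u - w (k%:R / n%:R))).
  rewrite (le_trans (fnormD _ _))// lerD//; last first.
    by apply: hM => //; rewrite ku ltW.
  have := dr _ u 0 B kN ku uN; rewrite scaler0 subr0 => hdr.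
  apply: (le_trans (hdr _)).
    move=> z /andP[z1 z2]; rewrite subr0 YB// (le_trans kN z1) (le_trans (ltW z2) uN)//.
  apply: ler_wpM2l; first exact: mulr_ge0.
  by have /andP[] := step_length n0 (introT andP (conj ku (ltW uk))).
have kn := truncn_le_horizon n tN.
have sums : \sum_(j < Num.truncn (n%:R * t)) D * r j <= \sum_(j < n * N) D * r j.
  rewrite -!(big_mkord xpredT (fun j => D * r j)) (big_cat_nat _ kn)//= lerDl.
  by rewrite sumr_ge0// => j _; rewrite mulr_ge0.
have sumE : n%:R^-1 * \sum_(j < n * N) D * r j = D * L * (NN * D * B * n%:R^-1 + S).
  rewrite -mulr_sumr -mulr_sumr big_split /= sumr_const card_ord -[_ *+ (n * N)]mulr_natl natrM /S.
  rewrite -/NN; field.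
  by rewrite gt_eqF.
have h1 : n%:R^-1 * \sum_(j < Num.truncn (n%:R * t)) D * r j <= D * L * (NN * D * B * n%:R^-1 + S).
  by rewrite -sumE ler_wpM2l// invr_ge0.
have hB : B <= KB * H ^+ m.+1.
  rewrite /B /drift_bound /KB exprS.
  rewrite (_ : CC * (1 + K) * (H * H ^+ m) = CC * H * ((1 + K) * H ^+ m)); last by ring.
  rewrite ler_wpM2l ?mulr_ge0// mulrDl mul1r lerD//.
apply: (le_trans (lerD (ler_wpM2l E0 h1) (lexx _))).
have e1 : E * (D * L * (NN * D * B * n%:R^-1 + S)) + (1 + D) * (B * n%:R^-1) <=
    (E * (D * L * (NN * D * B + 1)) + (1 + D) * B) * (y + S).
  have z0 : 0 <= n%:R^-1 :> R by rewrite invr_ge0.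
  move: z0 ny S0; move: (n%:R^-1) => z z0 zy S0.
  have h2 : NN * D * B * z + S <= (NN * D * B + 1) * (y + S).
    have c1 : 0 <= NN * D * B by apply: mulr_ge0 => //; exact: mulr_ge0.
    have h3 := ler_wpM2l c1 zy; have h4 := mulr_ge0 c1 S0; clear -h3 h4 zy S0 y0; lra.
  have h5 : B * z <= B * (y + S).
    by rewrite ler_wpM2l// (le_trans zy)// lerDl.
  rewrite [leRHS]mulrDl lerD//.
    rewrite -[leRHS]mulrA ler_wpM2l// -[leRHS]mulrA ler_wpM2l//.
    exact: mulr_ge0.
  by rewrite -[leRHS]mulrA ler_wpM2l// addr_ge0.
apply: (le_trans e1); apply: ler_wpM2r => //.
pose p := H ^+ (m + m).+1.
have p1 : 1 <= p by exact: pw.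
have hLp : L <= K * p.
  by apply: (le_trans hL); rewrite ler_wpM2l// ler_weXn2l// ltnW// ltnS leq_addr.
have hBp : B <= KB * p.
  by apply: (le_trans hB); rewrite ler_wpM2l// ler_weXn2l// ltnS leq_addr.
have hLBp : L * B <= K * KB * p.
  apply: le_trans (ler_pM L0 B0 hL hB) _.
  by rewrite mulrACA -exprD addnS.
apply: (@le_trans _ _ (P * p)).
  have -> : P * p = E * D * (NN * D * (K * KB * p) + K * p) + (1 + D) * (KB * p).
    by rewrite /P; ring.
  have -> : E * (D * L * (NN * D * B + 1)) + (1 + D) * B =
      E * D * (NN * D * (L * B) + L) + (1 + D) * B by ring.
  rewrite lerD//; last by rewrite ler_wpM2l// addr_ge0.
  rewrite ler_wpM2l ?mulr_ge0// lerD// ler_wpM2l// mulr_ge0//.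
apply: ler_pM => //; first exact: le_trans p1.
  have : 0 <= CC * A by rewrite mulr_ge0// ltW.
  lra.
by rewrite /p ler_weXn2l// leq_addr.
Qed.

End path_uniqueness.

(** * Chaining: from dyadic increments to a Hoelder modulus *)

Section chaining.
Context {R : realType}.

Lemma expr_powRN (x ga : R) n : 0 <= x -> (x `^ (- ga)) ^+ n = (x ^+ n)^-1 `^ ga.
Proof.
move=> x0; have xn0 : 0 <= x ^+ n by rewrite exprn_ge0.
have e1 : (x `^ (- ga)) ^+ n = x `^ (- ga * n%:R).
  by rewrite powRrM (powR_mulrn _ (powR_ge0 x (- ga))).
have e2 : (x ^+ n)^-1 `^ ga = x `^ (n%:R * (- 1 * ga)).
  by rewrite powRrM (powR_mulrn _ x0) powRrM powR_inv1.
by rewrite e1 e2; congr (_ `^ _); rewrite mulN1r mulrC.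
Qed.

Lemma powR2N_lt1 (ga : R) : 0 < ga -> 2 `^ (- ga) < 1 :> R.
Proof.
move=> ga0; rewrite powRN invf_lt1 ?powR_gt0//.
have := @gt0_ltr_powR R ga ga0 1 2; rewrite powR1; apply; rewrite ?nnegrE//.
by rewrite ltr1n.
Qed.

Definition dyadic_point (a tau : R) (k j : nat) : R := a + tau * (j%:R / 2 ^+ k).

Section unit_interval.
Context (g : R -> R) (A q : R) (q0 : 0 < q) (q1 : q < 1) (A0 : 0 <= A).
Context (gc : {within `[0, 1], continuous g}).
Context (hg : forall k j, (j < 2 ^ k)%N ->
  `|g (j.+1%:R / 2 ^+ k) - g (j%:R / 2 ^+ k)| <= A * q ^+ k).

Let p k (t : R) : R := (Num.truncn (2 ^+ k * t))%:R / 2 ^+ k.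

Let pow0 k : 0 < 2 ^+ k :> R. Proof. by rewrite exprn_gt0. Qed.

Let p_le k t : 0 <= t -> p k t <= t < p k t + (2 ^+ k)^-1.
Proof.
move=> t0; have /truncn_itv : 0 <= 2 ^+ k * t by rewrite mulr_ge0// ltW.
rewrite -[(Num.truncn _).+1%:R]natr1 /p => /andP[h1 h2]; rewrite ler_pdivrMr// [t * _]mulrC h1/=.
by rewrite -[X in _ + X]mul1r -mulrDl ltr_pdivlMr// [t * _]mulrC.
Qed.

Let truncn_lt k (t : R) (m : nat) : 0 <= t <= 1 -> (m < Num.truncn (2 ^+ k * t))%N -> (m < 2 ^ k)%N.
Proof.
move=> /andP[t0 t1] /leq_trans; apply; rewrite -(ler_nat R) natrX.
by rewrite (le_trans (_ : _ <= 2 ^+ k * t)) ?truncn_le ?mulr_ge0 ?(ltW (pow0 k))// ler_piMr// ltW.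
Qed.

(** Doubling the scale at most adds one to twice the truncated value, so the approximation either
    stays or moves to the next point of level k + 1. *)
Let refine k t : 0 <= t <= 1 -> `|g (p k.+1 t) - g (p k t)| <= A * q ^+ k.+1.
Proof.
move=> /[dup] t01 /andP[t0 t1].
have := @truncn_lt k.+1 t ((Num.truncn (2 ^+ k * t)).*2) t01; rewrite /p.
have /truncn_itv /andP[h1 h2] : 0 <= 2 ^+ k * t by rewrite mulr_ge0// ltW.
have /truncn_itv /andP[h3 h4] : 0 <= 2 ^+ k.+1 * t by rewrite mulr_ge0// ltW.
set m := Num.truncn (2 ^+ k * t) in h1 h2 *; set m' := Num.truncn _ in h3 h4 *.
have e : m%:R / 2 ^+ k = m.*2%:R / 2 ^+ k.+1 :> R.
  rewrite exprS -muln2 natrM; field.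
  by rewrite gt_eqF.
rewrite exprS in h3 h4.
have m1 : (m.*2 <= m')%N.
  rewrite -ltnS -(ltr_nat R) (le_lt_trans _ h4)// -muln2 natrM; lra.
have m2 : (m' <= m.*2.+1)%N.
  by rewrite -ltnS -(ltr_nat R) (le_lt_trans h3)// -doubleS -muln2 natrM; lra.
rewrite e => lt.
have [->|ne] := eqVneq m' m.*2; first by rewrite subrr normr0 mulr_ge0// exprn_ge0// ltW.
have lt_mm' : (m.*2 < m')%N by rewrite ltn_neqAle eq_sym ne.
have -> : m' = m.*2.+1 by apply/eqP; rewrite eqn_leq m2.
by apply: hg; exact: lt.
Qed.

Let telescope k i t : 0 <= t <= 1 ->
  `|g (p (k + i) t) - g (p k t)| <= A * q ^+ k.+1 * (1 - q)^-1.
Proof.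
move=> t01; have q10 : 0 < 1 - q by rewrite subr_gt0.
suff h : `|g (p (k + i) t) - g (p k t)| <= A * q ^+ k.+1 * ((1 - q ^+ i) / (1 - q)).
  apply: (le_trans h); rewrite ler_wpM2l ?mulr_ge0 ?exprn_ge0 ?(ltW q0)//.
  by rewrite ler_pdivrMr// mulVf ?gt_eqF// gerBl exprn_ge0// ltW.
elim: i => [|i IH]; first by rewrite addn0 subrr normr0 expr0 subrr mul0r mulr0.
rewrite addnS (le_trans (ler_distD (g (p (k + i) t)) _ _))//.
apply: (le_trans (lerD (refine _ t01) IH)).
rewrite le_eqVlt; apply/orP; left; apply/eqP; rewrite -addSn exprD (exprSr q i).
by field; rewrite gt_eqF.
Qed.

(** The dyadic approximations of t converge to t, and the telescoped bound does not depend on the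
    finer level; continuity of g concludes. *)
Let limit k t : 0 <= t <= 1 -> `|g t - g (p k t)| <= A * q ^+ k.+1 * (1 - q)^-1.
Proof.
move=> /[dup] t01 /andP[t0 t1]; apply/ler_addgt0Pl => e e0.
have [dl dl0 hd] := (within_continuousP _ _).1 gc t (ltac:(by rewrite /= in_itv/=)) e e0.
have [n hn] : exists n : nat, (2 ^+ n)^-1 < dl.
  have [n hn] := exists_nat_ge (dl^-1); exists n.
  rewrite invf_plt ?posrE//; apply: (le_lt_trans hn).
  by rewrite -natrX ltr_nat ltn_expl.
have [i [ki ni]] : exists i, (k <= i /\ n <= i)%N by exists (maxn k n); rewrite leq_maxl leq_maxr.
have /andP[h1 h2] := p_le i t0.
have pi0 : 0 <= p i t by rewrite divr_ge0// ltW.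
have inv : (2 ^+ i)^-1 <= (2 ^+ n)^-1 :> R by rewrite lef_pV2 ?posrE// ler_weXn2l// ler1n.
have := hd (p i t); rewrite /= in_itv/= pi0 (le_trans h1 t1) => /(_ isT).
have -> : `|p i t - t| < dl by rewrite ler0_norm ?subr_le0//; lra.
move=> /(_ isT) h3; rewrite distrC in h3.
rewrite (le_trans (ler_distD (g (p i t)) _ _))// lerD//.
by rewrite -(subnKC ki); exact: telescope.
Qed.

Lemma chaining_unit (ga : R) s t : 0 <= ga -> q = 2 `^ (- ga) -> 0 <= s -> s <= t -> t <= 1 ->
  `|g t - g s| <= A * ((1 + q) / ((1 - q) * q)) * (t - s) `^ ga.
Proof.
move=> ga0 qE s0; rewrite le_eqVlt => /orP[/eqP <- _|st t1].
  by rewrite subrr normr0 mulr_ge0 ?powR_ge0// mulr_ge0// divr_ge0 ?mulr_ge0 ?subr_ge0 ?addr_ge0 ?(ltW q0) ?(ltW q1).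
have ts0 : 0 < t - s by rewrite subr_gt0.
have exk : exists k, (2 ^+ k.+1)^-1 < t - s.
  have [n hn] := exists_nat_ge ((t - s)^-1); exists n.
  rewrite invf_plt ?posrE//; apply: (le_lt_trans hn).
  by rewrite -natrX ltr_nat (leq_trans (ltn_expl n (ltnSn 1)))// leq_pexp2l.
(* By minimality t - s is at most 2^-k and exceeds 2^-(k+1), so the approximations of s and t at
   level k coincide or are neighbours. *)
case: (ex_minnP exk) => k hk kmin.
have tsk : 2 ^+ k * (t - s) <= 1.
  rewrite -ler_pdivlMl// mulr1; case: k {hk} kmin => [_|k kmin]; first by rewrite expr0 invr1; lra.
  by rewrite leNgt; apply/negP => /kmin; rewrite ltnn.
have t01 : 0 <= t <= 1 by rewrite t1 (le_trans s0 (ltW st)).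
have s01 : 0 <= s <= 1 by rewrite s0 (le_trans (ltW st) t1).
have mid : `|g (p k t) - g (p k s)| <= A * q ^+ k.
  have := @truncn_lt k t (Num.truncn (2 ^+ k * s)) t01; rewrite /p.
  have /truncn_itv /andP[h1 h2] : 0 <= 2 ^+ k * s by rewrite mulr_ge0// ltW.
  have /truncn_itv /andP[h3 h4] : 0 <= 2 ^+ k * t by rewrite mulr_ge0 ?(ltW (pow0 k))//; case/andP: t01.
  have hst : 2 ^+ k * s <= 2 ^+ k * t by rewrite ler_wpM2l ?(ltW (pow0 k))// ltW.
  set m := Num.truncn (2 ^+ k * s) in h1 h2 *; set m' := Num.truncn _ in h3 h4 *.
  have m1 : (m <= m')%N by rewrite -ltnS -(ltr_nat R); lra.
  have m2 : (m' <= m.+1)%N.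
    by rewrite -ltnS -(ltr_nat R) -[m.+2%:R]natr1; lra.
  move=> lt; have [->|ne] := eqVneq m' m; first by rewrite subrr normr0 mulr_ge0// exprn_ge0// ltW.
  have lt_mm' : (m < m')%N by rewrite ltn_neqAle eq_sym ne.
  have -> : m' = m.+1 by apply/eqP; rewrite eqn_leq m2.
  by apply: hg; exact: lt.
have lt' := limit k t01; have ls := limit k s01.
have qk : q ^+ k * q <= (t - s) `^ ga.
  rewrite -exprSr qE; have -> : (2 `^ (- ga)) ^+ k.+1 = (2 ^+ k.+1)^-1 `^ ga :> R.
    exact: expr_powRN.
  by rewrite ge0_ler_powR ?nnegrE ?invr_ge0 ?(ltW (pow0 _)) ?(ltW ts0)// ltW.
have q10 : 0 < 1 - q by rewrite subr_gt0.
apply: (@le_trans _ _ (A * ((1 + q) / ((1 - q) * q)) * (q ^+ k * q))); last first.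
  apply: ler_wpM2l => //; apply: mulr_ge0 => //; apply: divr_ge0; first by rewrite addr_ge0// ltW.
  by apply: mulr_ge0; exact: ltW.
(* Two tails q^(k+1) / (1 - q), at s and at t, and one jump q^k add up to q^k (1 + q) / (1 - q). *)
have -> : A * ((1 + q) / ((1 - q) * q)) * (q ^+ k * q) =
    A * q ^+ k.+1 / (1 - q) + (A * q ^+ k + A * q ^+ k.+1 / (1 - q)).
  by rewrite exprSr; field; rewrite !gt_eqF.
rewrite (le_trans (ler_distD (g (p k t)) _ _))// lerD//.
rewrite (le_trans (ler_distD (g (p k s)) _ _))// lerD//.
by rewrite distrC.
Qed.

End unit_interval.

(** An affine change of time. The length tau stays explicit because the result serves on [0, N] and
    on every grid step. *)
Lemma chaining (f : R -> R) (a tau A ga : R) : 0 < tau -> 0 < ga -> 0 <= A ->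
  {within `[a, a + tau], continuous f} ->
  let q := 2 `^ (- ga) in
  (forall k j, (j < 2 ^ k)%N ->
    `|f (dyadic_point a tau k j.+1) - f (dyadic_point a tau k j)| <= A * q ^+ k) ->
  forall s t, a <= s -> s <= t -> t <= a + tau ->
    `|f t - f s| <= A * ((1 + q) / ((1 - q) * q)) * ((t - s) / tau) `^ ga.
Proof.
move=> tau0 ga0 A0 fc q hf s t as_ st ta.
have q0 : 0 < q by rewrite powR_gt0.
have q1 : q < 1 by exact: powR2N_lt1.
pose g u := f (a + tau * u).
have gc : {within `[0, 1], continuous g}.
  apply/within_continuousP => u /=; rewrite in_itv/= => /andP[u0 u1] e e0.
  have inA z : 0 <= z -> z <= 1 -> `[a, a + tau]%classic (a + tau * z).
    by move=> z0 z1 /=; rewrite in_itv/= lerDl mulr_ge0 ?(ltW tau0)//= lerD2l ler_piMr// ltW.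
  have [dl dl0 hd] := (within_continuousP _ _).1 fc _ (inA u u0 u1) e e0.
  exists (dl / tau); first by rewrite divr_gt0.
  move=> z; rewrite in_itv/= => /andP[z0 z1]; rewrite ltr_pdivlMr// => zu.
  apply: hd; first exact: inA.
  rewrite opprD addrACA subrr add0r -mulrBr normrM (gtr0_norm tau0) mulrC//.
have := @chaining_unit g A q q0 q1 A0 gc hf ga ((s - a) / tau) ((t - a) / tau) (ltW ga0) erefl.
have back z : a + tau * ((z - a) / tau) = z by rewrite mulrC divfK ?gt_eqF// subrKC.
rewrite /g !back -mulrBl opprB addrA subrK; apply.
- by rewrite divr_ge0 ?subr_ge0// ltW.
- by rewrite ler_wpM2r ?invr_ge0 ?(ltW tau0)// lerD2r.
- by rewrite ler_pdivrMr// mul1r lerBlDl.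
Qed.

End chaining.

(** * Even moments of the normal law *)

Section normal_moments.
Context {R : realType}.
Notation mu := (@lebesgue_measure R).

(** The Radon-Nikodym derivative of the normal law agrees almost everywhere with the density, as
    both have the same integrals over measurable sets. *)
Lemma ge0_integral_normal_prob (m s : R) (f : R -> \bar R) :
  measurable_fun setT f -> (forall x, 0 <= f x)%E ->
  (\int[normal_prob m s]_x f x = \int[mu]_x (f x * (normal_pdf m s x)%:E))%E.
Proof.
move=> mf f0.
have dom := normal_prob_dominates m s.
rewrite -(Radon_Nikodym_SigmaFinite.change_of_variables dom)//=.
have mRN := measurable_int _ (Radon_Nikodym_SigmaFinite.f_integrable dom).
have mpdf : measurable_fun setT (EFin \o normal_pdf m s).
  by apply/measurable_EFinP; exact: measurable_normal_pdf.
apply: ae_eq_integral => //; [exact: emeasurable_funM|exact: emeasurable_funM|].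
apply: ae_eqe_mul2l => /=.
apply: integral_ae_eq => //=.
- exact: Radon_Nikodym_SigmaFinite.f_integrable.
- by move=> E _ mE; rewrite -Radon_Nikodym_SigmaFinite.f_integral.
Qed.

(** For m > 0 this is the m-th power of y / m <= e^(y/m). *)
Lemma expr_le_expR (y : R) (m : nat) : 0 <= y -> y ^+ m <= m%:R ^+ m * expR y.
Proof.
move=> y0; case: m => [|m]; first by rewrite !expr0 mul1r -[leLHS]expR0 ler_expR.
have m0 : 0 < m.+1%:R :> R by [].
have -> : expR y = expR (y / m.+1%:R) ^+ m.+1.
  by rewrite -expRM_natl mulrC divfK ?gt_eqF.
rewrite -exprMn lerXn2r ?nnegrE ?mulr_ge0 ?expR_ge0//.
rewrite mulrC -ler_pdivrMr// (le_trans _ (expR_ge1Dx _))// lerDr ler01//.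
Qed.

(** Half of the Gaussian exponent absorbs x^(2m); the other half is, up to the factor sqrt 2, the
    density with standard deviation sqrt 2 s. Integrating gives the scaling s^(2m) at once. *)
Lemma normal_moment_pointwise (m : nat) (s x : R) : 0 < s ->
  x ^+ (2 * m) * normal_pdf 0 s x <=
  (4 ^+ m * m%:R ^+ m * Num.sqrt 2) * s ^+ (2 * m) * normal_pdf 0 (Num.sqrt 2 * s) x.
Proof.
move=> s0; have r20 : 0 < Num.sqrt 2 :> R by rewrite sqrtr_gt0.
have rs0 : 0 < Num.sqrt 2 * s by rewrite mulr_gt0.
rewrite !normal_pdfE ?gt_eqF// /normal_fun /normal_peak subr0.
have sq2 : Num.sqrt 2 ^+ 2 = 2 :> R by rewrite sqr_sqrtr.
set y := x ^+ 2 / (4 * s ^+ 2).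
have s20 : 0 < s ^+ 2 by rewrite exprn_gt0.
have y0 : 0 <= y by rewrite divr_ge0 ?sqr_ge0// mulr_ge0// ltW.
have -> : - x ^+ 2 / (s ^+ 2 *+ 2) = - y + - y.
  by rewrite /y -mulr_natl; field; rewrite gt_eqF.
have -> : - x ^+ 2 / ((Num.sqrt 2 * s) ^+ 2 *+ 2) = - y.
  by rewrite exprMn sq2 /y -mulr_natl; field; rewrite gt_eqF.
rewrite expRD.
have -> : (Num.sqrt 2 * s) ^+ 2 * pi *+ 2 = 2 * (s ^+ 2 * pi *+ 2) :> R.
  by rewrite exprMn sq2 -mulr_natl -[in RHS]mulr_natl; ring.
rewrite sqrtrM// invfM.
set pk := (Num.sqrt (s ^+ 2 * pi *+ 2))^-1.
have pk0 : 0 <= pk by rewrite invr_ge0.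
have -> : 4 ^+ m * m%:R ^+ m * Num.sqrt 2 * s ^+ (2 * m) * ((Num.sqrt 2)^-1 * pk * expR (- y)) =
    (4 ^+ m * s ^+ (2 * m) * m%:R ^+ m) * (pk * expR (- y)).
  by field; rewrite gt_eqF.
rewrite (_ : x ^+ (2 * m) * _ = x ^+ (2 * m) * expR (- y) * (pk * expR (- y))); last by ring.
rewrite ler_wpM2r ?mulr_ge0 ?expR_ge0//.
have -> : x ^+ (2 * m) = 4 ^+ m * s ^+ (2 * m) * y ^+ m.
  by rewrite !exprM -!exprMn; congr (_ ^+ m); rewrite /y; field; rewrite gt_eqF.
rewrite -[leLHS]mulrA ler_wpM2l ?mulr_ge0 ?exprn_ge0 ?(ltW s0)//.
rewrite expRN ler_pdivrMr ?expR_gt0//; exact: expr_le_expR.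
Qed.

Lemma normal_moment (m : nat) : exists2 C : R, 0 < C & forall s : R, 0 < s ->
  (\int[normal_prob 0 s]_x (x ^+ (2 * m))%:E <= (C * s ^+ (2 * m))%:E)%E.
Proof.
pose C : R := 4 ^+ m * m%:R ^+ m * Num.sqrt 2.
have C0 : 0 < C.
  rewrite mulr_gt0 ?sqrtr_gt0//; apply: mulr_gt0; first by rewrite exprn_gt0.
  by case: (m) => [|k]; rewrite ?expr0// exprn_gt0.
exists C => // s s0.
have xm x : 0 <= x ^+ (2 * m) :> R by rewrite exprM exprn_ge0// sqr_ge0.
have mX : measurable_fun setT (fun x : R => (x ^+ (2 * m))%:E).
  by apply/measurable_EFinP; exact: measurable_funX.
have xm' x : (0 <= (x ^+ (2 * m))%:E :> \bar R)%E by rewrite lee_fin.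
rewrite ge0_integral_normal_prob//.
have mpdf (s' : R) : measurable_fun setT (EFin \o normal_pdf 0 s').
  by apply/measurable_EFinP; exact: measurable_normal_pdf.
have Cs0 : 0 <= C * s ^+ (2 * m) by rewrite mulr_ge0 ?(ltW C0)// exprn_ge0// ltW.
apply: (@le_trans _ _ (\int[mu]_x ((C * s ^+ (2 * m))%:E * (normal_pdf 0 (Num.sqrt 2 * s) x)%:E))%E).
  apply: ge0_le_integral => //.
  - by move=> x _; rewrite mule_ge0// lee_fin// normal_pdf_ge0.
  - exact: (emeasurable_funM mX (mpdf s)).
  - exact: (measurable_funeM _ (mpdf _)).
  - by move=> x _; rewrite -!EFinM lee_fin; exact: normal_moment_pointwise.
have pdf0 x : (0 <= (normal_pdf 0 (Num.sqrt 2 * s) x)%:E)%E by rewrite lee_fin normal_pdf_ge0.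
have e := ge0_integralZl_EFin mu measurableT (fun x _ => pdf0 x) (mpdf _) Cs0.
rewrite [leLHS]e.
by rewrite integral_normal_pdf mule1.
Qed.

End normal_moments.

Lemma rat_approx (R : realType) (x e : R) : 0 < e -> exists q : rat, `|x - ratr q| < e.
Proof.
move=> e0; have lt : x - e < x + e by lra.
have [q] := rat_in_itvoo lt.
rewrite in_itv/= => /andP[h1 h2]; exists q.
by rewrite ltr_norml; apply/andP; split; lra.
Qed.

(** * Borel sets, adaptedness and continuity of the schemes *)

Section borel_coordinates.
Context {R : realType} {d : nat}.

Lemma borel_open (A : set 'rV[R]_d) : open A -> borel A.
Proof. exact: sub_gen_smallest. Qed.

Lemma borel_setC (A : set 'rV[R]_d) : borel A -> borel (~` A).
Proof. exact: sigma_algebraC. Qed.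

Lemma borel_setI (A B : set 'rV[R]_d) : borel A -> borel B -> borel (A `&` B).
Proof.
exact: (@measurableI _ (g_sigma_algebraType (@open 'rV[R]_d))).
Qed.

Lemma borel_setU (A B : set 'rV[R]_d) : borel A -> borel B -> borel (A `|` B).
Proof.
exact: (@measurableU _ (g_sigma_algebraType (@open 'rV[R]_d))).
Qed.

Lemma open_gt_lip (g : 'rV[R]_d -> R) (r : R) :
  (forall x y, `|g y - g x| <= fnorm (y - x)) -> open [set x | r < g x].
Proof.
move=> hg; rewrite openE => x /= rx.
have d0 : 0 < d%:R + 1 :> R by rewrite ltr_wpDl.
apply/nbhs_ballP; exists ((g x - r) / (d%:R + 1)) => /=.
  by rewrite divr_gt0// subr_gt0.
move=> y; rewrite -ball_normE /ball_ /= => xy.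
have := le_trans (hg x y) (fnorm_le_mx_norm (y - x)).
rewrite (distrC y) ler_norml => /andP[h1 _].
by move: xy; rewrite ltr_pdivlMr//; have := normr_ge0 (x - y); lra.
Qed.

Lemma borel_coord_gt (i : 'I_d) (r : R) : borel [set x : 'rV[R]_d | r < x 0 i].
Proof.
apply: borel_open; apply: (@open_gt_lip (fun x => x 0 i)) => x y.
by have := normr_coord_le (y - x) i; rewrite !mxE.
Qed.

Lemma measurable_coord_of_borel dd (T : measurableType dd) (f : T -> 'rV[R]_d) :
  (forall A, borel A -> measurable (f @^-1` A)) ->
  forall i, measurable_fun setT (fun x => f x 0 i).
Proof.
move=> hf i; apply: (measurability _ (RGenOInfty.measurableE R)) => //.
move=> _ [_ [r ->] <-]; rewrite setTI.
have := hf _ (borel_coord_gt i r); congr measurable.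
by apply/seteqP; split => x /=; rewrite in_itv/= andbT.
Qed.

(** An open set is a countable union of boxes with rational centres and radii 1/(k+1), and the
    preimage of a box is a finite intersection of conditions on coordinates. *)
Lemma borel_of_measurable_coord dd (T : measurableType dd) (f : T -> 'rV[R]_d) :
  (forall i, measurable_fun setT (fun x => f x 0 i)) ->
  forall A, borel A -> measurable (f @^-1` A).
Proof.
move=> hf A bA.
suff : @borel R d `<=` [set A | measurable (f @^-1` A)] by move=> /(_ _ bA).
apply: smallest_sub.
  split=> [|B mB|F mF] /=.
  - by rewrite preimage_set0.
  - by rewrite setTD preimage_setC; exact: measurableC.
  - by rewrite preimage_bigcup; apply: bigcup_measurable => n _; exact: mF.
move=> U oU /=.
pose Box (p : {ffun 'I_d -> rat} * nat) : set 'rV[R]_d :=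
  [set x | forall i, `|x 0 i - ratr (p.1 i)| < p.2.+1%:R^-1].
have -> : f @^-1` U = \bigcup_p [set w | Box p (f w) /\ Box p `<=` U].
  apply/seteqP; split => [w /= Uw|w [p _ /= [bw pU]]]; last exact: pU.
  have /nbhs_ballP[e /= e0 he] : nbhs (f w) U by move: oU; rewrite openE; exact.
  have [n hn] : exists n : nat, n.+1%:R^-1 < e / 2.
    exists (Num.truncn (e / 2)^-1); rewrite invf_plt ?posrE// ?divr_gt0//.
    exact: truncnS_gt.
  have n0 : 0 < n.+1%:R^-1 :> R by rewrite invr_gt0.
  have hq i := rat_approx (f w 0 i) n0.
  have [q qP] := choice hq.
  exists ([ffun i => q i], n) => //=; split; first by move=> i; rewrite ffunE.
  move=> x /= hx; apply: he; rewrite -ball_normE /ball_ /=.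
  rewrite [`|_|]mx_normrE; apply: bigmax_lt => // -[i j] _ /=; rewrite ord1 !mxE.
  have := hx j; rewrite ffunE => h1; have h2 := qP j.
  rewrite (le_lt_trans (ler_distD (ratr (q j)) _ _))// [X in _ + X]distrC.
  by rewrite [ltRHS]splitr ltrD//; [exact: lt_trans h2 hn|exact: lt_trans h1 hn].
apply: countable_bigcupT_measurable => //= p.
have [pU|pU] := pselect (Box p `<=` U); last first.
  by rewrite (_ : [set _ | _] = set0)//; apply/seteqP; split => // w [].
have -> : [set w | Box p (f w) /\ Box p `<=` U] = \bigcap_(i in [set: 'I_d])
    ((fun w => f w 0 i) @^-1` [set r | `|r - ratr (p.1 i)| < p.2.+1%:R^-1]).
  apply/seteqP; split => w /=; first by move=> [h _] i _; exact: h.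
  by move=> h; split => // i; exact: (h i).
apply: fin_bigcap_measurable => // i _.
rewrite -[X in measurable X]setTI; apply: hf => //.
have -> : [set r : R | `|r - ratr (p.1 i)| < p.2.+1%:R^-1] =
    `](ratr (p.1 i) - p.2.+1%:R^-1), (ratr (p.1 i) + p.2.+1%:R^-1)[%classic.
  by apply/seteqP; split => r /=; rewrite in_itv/= ltr_distl.
exact: measurable_itv.
Qed.

End borel_coordinates.

Section adapted_schemes.
Context {R : realType} {disp : measure_display} {Omega : measurableType disp}.
Context (P : probability Omega R) {d : nat} (W : @process R disp Omega d).

(** The generators of [augmented_filtration], named so that [g_sigma_algebraType] turns the
    sigma-algebra at time t into a measurable structure on Omega. *)
Definition augmented_generator (t : R) : set (set Omega) :=
  [set A | (exists s B, [/\ 0 <= s <= t, borel B & A = W s @^-1` B]) \/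
           (measurable A /\ P A = 0%E)].

Notation Omega_ t := (g_sigma_algebraType (augmented_generator t)).

Lemma measurable_noise s t i : 0 <= s <= t ->
  measurable_fun (setT : set (Omega_ t)) (fun om => W s om 0 i).
Proof.
move=> st; apply: (@measurable_coord_of_borel _ _ _ (Omega_ t)) => A bA.
by apply: sub_gen_smallest; left; exists s, A.
Qed.

Lemma adapted_of_coord (X : @process R disp Omega d) :
  (forall t, 0 <= t -> forall i, measurable_fun (setT : set (Omega_ t)) (fun om => X t om 0 i)) ->
  adapted (augmented_filtration P W) X.
Proof.
move=> hX t t0 A bA.
exact: (@borel_of_measurable_coord _ _ _ (Omega_ t) (X t) (hX t t0) A bA).
Qed.

Section euler.
Context (b : 'rV[R]_d -> 'rV[R]_d) (x0 : 'rV[R]_d) (b_borel : borel_fun b).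

Lemma measurable_coord_comp dd (T : measurableType dd) (f : T -> 'rV[R]_d) :
  (forall i, measurable_fun setT (fun x => f x 0 i)) ->
  forall i, measurable_fun setT (fun x => b (f x) 0 i).
Proof.
move=> hf; apply: (measurable_coord_of_borel (f := fun x => b (f x))) => A /b_borel.
exact: borel_of_measurable_coord.
Qed.

Lemma measurable_euler_grid n k t : k%:R / n%:R <= t ->
  forall i, measurable_fun (setT : set (Omega_ t))
    (fun om => euler_grid b x0 (W^~ om) n k 0 i).
Proof.
elim: k => [|k IH] kt i; first exact: measurable_cst.
have kt' : k%:R / n%:R <= t.
  by apply: le_trans kt; rewrite ler_wpM2r ?invr_ge0// ler_nat.
rewrite [X in measurable_fun _ X](_ : _ = fun om => euler_grid b x0 (W^~ om) n k 0 i +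
    n%:R^-1 * b (euler_grid b x0 (W^~ om) n k) 0 i + (W (k.+1%:R / n%:R) om 0 i - W (k%:R / n%:R) om 0 i)); last first.
  by apply/funext => om; rewrite /= !mxE; ring.
apply: measurable_funD; first apply: measurable_funD.
- exact: IH.
- by apply: measurable_funM => //; exact: (measurable_coord_comp (IH kt')).
- by apply: measurable_funB; apply: measurable_noise; rewrite divr_ge0.
Qed.

Lemma measurable_euler_path n t : (0 < n)%N -> 0 <= t ->
  forall i, measurable_fun (setT : set (Omega_ t))
    (fun om => euler_path b x0 (W^~ om) n t 0 i).
Proof.
move=> n0 t0 i; have /andP[kt _] := grid_bounds n0 t0.
rewrite /euler_path; set k := Num.truncn _ in kt *.
rewrite [X in measurable_fun _ X](_ : _ = fun om => euler_grid b x0 (W^~ om) n k 0 i +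
    (t - k%:R / n%:R) * b (euler_grid b x0 (W^~ om) n k) 0 i + (W t om 0 i - W (k%:R / n%:R) om 0 i)); last first.
  by apply/funext => om; rewrite /= !mxE; ring.
have mX := measurable_euler_grid kt.
apply: measurable_funD; first apply: measurable_funD.
- exact: mX.
- by apply: measurable_funM => //; exact: (measurable_coord_comp mX).
- by apply: measurable_funB; apply: measurable_noise; rewrite ?t0 ?lexx// divr_ge0.
Qed.

Lemma adapted_euler_path n : (0 < n)%N ->
  adapted (augmented_filtration P W) (fun t om => euler_path b x0 (W^~ om) n t).
Proof.
move=> n0; apply: adapted_of_coord => t t0 i; exact: measurable_euler_path.
Qed.

End euler.

(** Convergence is known off a null set N. The augmentation puts N into the sigma-algebra of every
    time t >= 0, so redefining the process on N keeps it adapted. *)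
Lemma adapted_limit (Xn : nat -> @process R disp Omega d) (N : set Omega) (X : @process R disp Omega d) x0 :
  measurable N -> P N = 0%E -> (forall n t i, 0 <= t ->
    measurable_fun (setT : set (Omega_ t)) (fun om => Xn n t om 0 i)) ->
  (forall t om, N om -> X t om = x0) ->
  (forall t om i, 0 <= t -> ~ N om -> (fun n => Xn n t om 0 i) @ \oo --> X t om 0 i) ->
  adapted (augmented_filtration P W) X.
Proof.
move=> mN N0 mX XN cX; apply: adapted_of_coord => t t0 i.
apply: (@measurable_fun_cvg _ (Omega_ t) R setT
  (fun n om => if om \in N then x0 0 i else Xn n t om 0 i)).
  move=> n; apply: measurable_fun_ifT => //; last exact: mX.
  apply: (measurable_fun_bool true); rewrite setTI.
  rewrite (_ : _ @^-1` _ = N); last by apply/seteqP; split => om /= h; [exact: set_mem|exact: mem_set].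
  by apply: sub_gen_smallest; right.
move=> om _; have [omN|omN] := pselect (N om).
  by rewrite mem_set// XN//; exact: cvg_cst.
by rewrite memNset//; exact: cX.
Qed.

End adapted_schemes.

Section euler_continuity.
Context {R : realType} {d : nat}.

(** W 0 = 0 holds almost surely, whereas paths must be continuous for every outcome; the shift
    reduces the latter to paths that start at 0. *)
Lemma euler_path_shift (b : 'rV[R]_d -> 'rV[R]_d) x0 w a n :
  euler_path b x0 (fun t => w t - a) n = euler_path b x0 w n.
Proof.
have e k : euler_grid b x0 (fun t => w t - a) n k = euler_grid b x0 w n k.
  by elim: k => //= k ->; congr (_ + _); apply/rowP => i; rewrite !mxE; ring.
apply/funext => t; rewrite /euler_path e; congr (_ + _).
by apply/rowP => i; rewrite !mxE; ring.
Qed.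

Lemma euler_path_continuous (b : 'rV[R]_d -> 'rV[R]_d) x0 (w : R -> 'rV[R]_d) n : (0 < n)%N ->
  {within `[0, +oo[, continuous w} -> {within `[0, +oo[, continuous (euler_path b x0 w n)}.
Proof.
move=> n0 /within_continuousP cw; apply/within_continuousP => s /= s0 e e0.
rewrite in_itv/= andbT in s0.
set E := euler_path b x0 w n.
have Esol T := euler_path_ode_solution b x0 n0 (w := fun t => w t - w 0) (T := T) (subrr _).
rewrite euler_path_shift -/E in Esol.
have [N hN] := exists_nat_ge (s + 1).
have N0 : (0 < N)%N by rewrite -(ltr0n R) (lt_le_trans _ hN)// ltr_wpDl.
pose K := \sum_(k < (n * N).+1) fnorm (b (E (k%:R / n%:R))).
have hK u : 0 <= u <= N%:R -> fnorm (b (E (grid n u)) - 0) <= K.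
  move=> /andP[u0 uN]; rewrite subr0 gridE//.
  have kn : (Num.truncn (n%:R * u) < (n * N).+1)%N.
    by rewrite ltnS -[leqRHS](@natrK R); apply: le_truncn; rewrite natrM ler_wpM2l.
  rewrite /K (bigD1 (Ordinal kn))//= lerDl; apply: sumr_ge0 => *; exact: fnorm_ge0.
have K0 : 0 <= K by apply: sumr_ge0 => *; exact: fnorm_ge0.
have step u t : 0 <= u -> u <= t -> t <= N%:R ->
    fnorm (E t - E u) <= d%:R * K * (t - u) + fnorm (w t - w u).
  move=> u0 ut tN.
  have := ode_solution_driven (Esol N%:R) u0 ut tN (a := 0) (K := K).
  rewrite scaler0 subr0 => /(_ _); have: (forall r, u <= r < t -> fnorm (b (E (grid n r)) - 0) <= K).
    by move=> r /andP[ur rt]; apply: hK; rewrite (le_trans u0)// (le_trans (ltW rt)).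
  move=> h /(_ h); rewrite (_ : w t - w 0 - (w u - w 0) = w t - w u); last first.
    by apply/rowP => i; rewrite !mxE; ring.
  by have := fnorm_leD (E t - E u) (w t - w u); lra.
have [dl dl0 hd] := cw s (ltac:(rewrite /= in_itv/= andbT; exact: s0)) (e / (2 * (d%:R + 1))) (ltac:(by rewrite divr_gt0// mulr_gt0// ltr_wpDl)).
have D0 : 0 < d%:R * K + 1 by rewrite ltr_wpDl// mulr_ge0.
exists (Num.min (Num.min dl 1) (e / (2 * (d%:R * K + 1)))).
  by rewrite !lt_min dl0 ltr01 divr_gt0// mulr_gt0.
move=> t; rewrite /= in_itv/= andbT => t0; rewrite !lt_min => /andP[/andP[ts1 ts2] ts3].
have wts := hd t (ltac:(rewrite /= in_itv/= andbT; exact: t0)) ts1.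
apply: (le_trans (mx_norm_le_fnorm _)).
have tN : t <= N%:R by move: ts2; rewrite ltr_norml => /andP[_]; move: hN; lra.
have sN : s <= N%:R by move: hN; lra.
have : fnorm (E t - E s) <= d%:R * K * `|t - s| + fnorm (w t - w s).
  have [st|/ltW ts] := leP s t.
    by rewrite ger0_norm ?subr_ge0//; exact: step.
  by rewrite distrC ger0_norm ?subr_ge0// fnormB (fnormB (w t)); exact: step.
move=> /le_trans; apply.
have h1 : fnorm (w t - w s) <= e / 2.
  apply: (le_trans (fnorm_le_mx_norm _)).
  move: wts; rewrite ler_pdivlMr ?mulr_gt0 ?ltr_wpDl//.
  by have := normr_ge0 (w t - w s); nra.
have h2 : d%:R * K * `|t - s| <= e / 2.
  move: ts3; rewrite ltr_pdivlMr ?mulr_gt0//.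
  have := normr_ge0 (t - s); have : 0 <= d%:R * K by rewrite mulr_ge0.
  by move: (d%:R * K) `|t - s| => r1 r2; nra.
by rewrite [leRHS]splitr addrC lerD.
Qed.

End euler_continuity.

(** * Dyadic energy of a path and its expectation *)

Section energy.
Context {R : realType} {d : nat} (m : nat) (ga : R) (m0 : (0 < m)%N) (ga0 : 0 < ga).
Let q : R := 2 `^ (- ga).

(** The weight is chosen so that a bound on this term makes every increment of level k at most a
    constant times q^k, as [chaining] requires. *)
Definition energy_term (w : R -> 'rV[R]_d) (a tau : R) (k : nat) : R :=
  q ^- (2 * m * k) * \sum_(j < 2 ^ k) \sum_(i < d)
    (w (dyadic_point a tau k j.+1) 0 i - w (dyadic_point a tau k j) 0 i) ^+ (2 * m).

(* If finite, it controls the Hoelder modulus of order ga of w on [a, a + tau]. *)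
Definition energy (w : R -> 'rV[R]_d) (a tau : R) : \bar R :=
  (\sum_(0 <= k <oo) (energy_term w a tau k)%:E)%E.

Definition energy_root (w : R -> 'rV[R]_d) (a tau : R) : R :=
  fine (energy w a tau) `^ (2 * m)%:R^-1.

Definition chaining_const : R := d%:R * ((1 + q) / ((1 - q) * q)).

Let q0 : 0 < q. Proof. exact: powR_gt0. Qed.
Let q1 : q < 1. Proof. exact: powR2N_lt1. Qed.

Lemma chaining_const_ge0 : 0 <= chaining_const.
Proof.
apply: mulr_ge0 => //; apply: divr_ge0; first by rewrite addr_ge0// ltW.
by apply: mulr_ge0; [rewrite subr_ge0|]; exact: ltW.
Qed.

Lemma energy_term_ge0 w a tau k : 0 <= energy_term w a tau k.
Proof.
apply: mulr_ge0; first by rewrite invr_ge0 exprn_ge0// ltW.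
apply: sumr_ge0 => j _; apply: sumr_ge0 => i _.
by rewrite exprM exprn_ge0// sqr_ge0.
Qed.

Lemma energy_ge0 w a tau : (0 <= energy w a tau)%E.
Proof. by apply: nneseries_ge0 => k _ _; rewrite lee_fin energy_term_ge0. Qed.

Lemma energy_root_ge0 w a tau : 0 <= energy_root w a tau.
Proof. exact: powR_ge0. Qed.

Lemma energy_rootX w a tau : energy_root w a tau ^+ (2 * m) = fine (energy w a tau).
Proof.
have fE0 : 0 <= fine (energy w a tau) by rewrite fine_ge0// energy_ge0.
have mm : (2 * m)%:R != 0 :> R by rewrite pnatr_eq0 muln_eq0 -lt0n m0.
by rewrite -powR_mulrn ?powR_ge0// -powRrM mulVf// powRr1.
Qed.

Lemma dyadic_increment_le w a tau k j i : (j < 2 ^ k)%N -> (energy w a tau < +oo)%E ->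
  `|w (dyadic_point a tau k j.+1) 0 i - w (dyadic_point a tau k j) 0 i|
    <= energy_root w a tau * q ^+ k.
Proof.
move=> jk fin.
have finE : energy w a tau \is a fin_num by rewrite ge0_fin_numE// energy_ge0.
set r := _ - _.
have term_le : energy_term w a tau k <= fine (energy w a tau).
  rewrite -lee_fin fineK//.
  apply: le_trans (_ : (\sum_(0 <= n < k.+1) (energy_term w a tau n)%:E <= _)%E).
    rewrite big_nat_recr//= leeDr// sume_ge0// => n _.
    by rewrite lee_fin energy_term_ge0.
  by apply: nneseries_lim_ge => n _ _; rewrite lee_fin energy_term_ge0.
have r_le : r ^+ (2 * m) <= q ^+ (2 * m * k) * fine (energy w a tau).
  rewrite -ler_pdivrMl ?exprn_gt0//; apply: le_trans term_le.
  rewrite /energy_term ler_wpM2l ?invr_ge0 ?exprn_ge0 ?(ltW q0)//.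
  rewrite (bigD1 (Ordinal jk))//= (bigD1 i)//= -/r -addrA lerDl.
  apply: addr_ge0; [|apply: sumr_ge0 => ? _]; apply: sumr_ge0 => ? _;
  by rewrite exprM exprn_ge0// sqr_ge0.
rewrite -(@ler_pXn2r _ (2 * m)) ?muln_gt0 ?m0// ?nnegrE ?mulr_ge0 ?powR_ge0 ?exprn_ge0 ?(ltW q0)//.
rewrite exprMn -exprM energy_rootX (mulnC k) mulrC.
by rewrite exprM real_normK ?num_real// -exprM.
Qed.

Lemma energy_modulus (w : R -> 'rV[R]_d) a tau : 0 < tau ->
  {within `[a, a + tau], continuous w} -> (energy w a tau < +oo)%E ->
  forall s t, a <= s -> s <= t -> t <= a + tau ->
  fnorm (w t - w s) <= chaining_const * energy_root w a tau * ((t - s) / tau) `^ ga.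
Proof.
move=> tau0 cw fin s t as_ st ta; apply: (le_trans (fnorm_le_sum _)).
rewrite /chaining_const -!mulrA mulr_natl -[X in _ *+ X]card_ord -sumr_const; apply: ler_sum => i _.
rewrite !mxE.
have cwi : {within `[a, a + tau], continuous (fun u => w u 0 i)}.
  apply: (within_continuous_lip (g := fun x => x 0 i) (k := 1)) cw => x y.
  by have := normr_coord_le (y - x) i; rewrite !mxE mul1r.
have := chaining tau0 ga0 (energy_root_ge0 w a tau) cwi
  (fun k j jk => dyadic_increment_le i jk fin) as_ st ta.
by move=> /le_trans; apply; rewrite -/q (mulrC (energy_root _ _ _)) -!mulrA.
Qed.

End energy.

Section energy_expectation.
Context {R : realType} {disp : measure_display} {Omega : measurableType disp}.
Context {P : probability Omega R} {d : nat} {F : R -> set (set Omega)}.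
Context {W : @process R disp Omega d} (hF : filtration F) (hW : wiener P F W).

Lemma measurable_wiener t i : 0 <= t -> measurable_fun setT (fun om => W t om 0 i).
Proof.
move=> t0; apply: measurable_coord_of_borel => A bA.
have [/(_ t t0)[_ sub] _] := hF; apply: sub; exact: (wiener_adapted hW).
Qed.

Lemma measurable_increment s t i : 0 <= s -> 0 <= t ->
  measurable_fun setT (fun om => W t om 0 i - W s om 0 i).
Proof. by move=> s0 t0; apply: measurable_funB; exact: measurable_wiener. Qed.

Lemma increment_law s t i (B : set (measurableTypeR R)) : 0 <= s -> s < t -> measurable B ->
  P ((fun om => W t om 0 i - W s om 0 i) @^-1` B) = normal_prob 0 (Num.sqrt (t - s)) B.
Proof.
move=> s0 st mB.
have FT : F s setT.
  by have [/(_ s s0)[sa _] _] := hF; case: sa => F0 FC _; have := FC _ F0; rewrite setD0.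
(* A box that constrains only coordinate i isolates its law; the other factors have mass 1. *)
pose Bs j : set (measurableTypeR R) := if j == i then B else setT.
have mBs j : measurable (Bs j) by rewrite /Bs; case: ifP.
have := wiener_increments hW s0 st FT mBs.
rewrite setTI probability_setT mul1e (bigD1 i)//= /Bs eqxx big1 ?mule1; last first.
  by move=> j /negPf ->; exact: probability_setT.
move=> <-; congr (P _); apply/seteqP; split => om /=; last by move/(_ i); rewrite eqxx.
by move=> h j; case: eqP => // ->.
Qed.

Lemma increment_moment m : exists2 C : R, 0 < C & forall s t i, 0 <= s -> s < t ->
  (\int[P]_om ((W t om 0 i - W s om 0 i) ^+ (2 * m))%:E <= (C * (t - s) ^+ m)%:E)%E.
Proof.
have [C C0 hC] := @normal_moment R m; exists C => // s t i s0 st.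
have ts0 : 0 < t - s by rewrite subr_gt0.
have := hC _ (ltac:(by rewrite sqrtr_gt0) : 0 < Num.sqrt (t - s)).
rewrite exprM sqr_sqrtr ?(ltW ts0)//; apply: le_trans.
pose f om := W t om 0 i - W s om 0 i.
have mf : measurable_fun setT (f : Omega -> measurableTypeR R).
  exact: measurable_increment (le_trans s0 (ltW st)).
have mX : measurable_fun setT (fun x : measurableTypeR R => (x ^+ (2 * m))%:E).
  by apply/measurable_EFinP; exact: measurable_funX.
have X0 : {in setT, forall y : measurableTypeR R, (0 <= (y ^+ (2 * m))%:E)%E}.
  by move=> y _; rewrite lee_fin exprM exprn_ge0// sqr_ge0.
have := ge0_integral_pushforward mf P measurableT mX X0.
rewrite preimage_setT => <-.
rewrite (@eq_measure_integral _ _ _ _ (normal_prob 0 (Num.sqrt (t - s))))//.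
by move=> A mA _; exact: increment_law.
Qed.

Lemma dyadic_point_bounds (a tau : R) k j : 0 <= a -> 0 < tau ->
  0 <= dyadic_point a tau k j /\ dyadic_point a tau k j < dyadic_point a tau k j.+1.
Proof.
move=> a0 tau0; have p0 : 0 < 2 ^+ k :> R by rewrite exprn_gt0.
split; first by rewrite addr_ge0// mulr_ge0 ?(ltW tau0)// divr_ge0// ltW.
by rewrite ltrD2l ltr_pM2l// ltr_pM2r ?invr_gt0// ltr_nat.
Qed.

Lemma dyadic_point_step (a tau : R) k j :
  dyadic_point a tau k j.+1 - dyadic_point a tau k j = tau / 2 ^+ k.
Proof.
by rewrite /dyadic_point -natr1; field; rewrite expf_neq0.
Qed.

Context (m : nat) (ga : R).

Lemma measurable_energy_term a tau k : 0 <= a -> 0 < tau ->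
  measurable_fun setT (fun om => (energy_term m ga (W^~ om) a tau k)%:E).
Proof.
move=> a0 tau0; apply/measurable_EFinP; apply: measurable_funM => //.
apply: measurable_sum => j; apply: measurable_sum => i; apply: measurable_funX.
have [h1 h2] := dyadic_point_bounds k j a0 tau0.
by apply: measurable_increment => //; exact: le_trans (ltW h2).
Qed.

Lemma measurable_energy a tau : 0 <= a -> 0 < tau ->
  measurable_fun setT (fun om => energy m ga (W^~ om) a tau).
Proof.
move=> a0 tau0; apply: (ge0_emeasurable_sum (P := xpredT)) => [k om _ _|k _].
  by rewrite lee_fin energy_term_ge0.
exact: measurable_energy_term.
Qed.

(** Level k has 2^k increments over time tau / 2^k, each coordinate with moment at most C (tau /
    2^k)^m; together with the weights this is a geometric series of ratio z. *)
Lemma energy_moment : 2 * ((2 `^ (- ga)) ^- 2 / 2) ^+ m < 1 ->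
  exists2 C : R, 0 < C & forall a tau, 0 <= a -> 0 < tau ->
  (\int[P]_om energy m ga (W^~ om) a tau <= (C * tau ^+ m)%:E)%E.
Proof.
set z := 2 * _ => z1; have [C C0 hC] := increment_moment m.
have q0 : 0 < 2 `^ (- ga) :> R by exact: powR_gt0.
have z0 : 0 < z by rewrite mulr_gt0// exprn_gt0// divr_gt0// invr_gt0 exprn_gt0.
exists ((d%:R * C + 1) / (1 - z)) => [|a tau a0 tau0].
  by rewrite divr_gt0 ?subr_gt0// ltr_wpDl// mulr_ge0// ltW.
have K0 : 0 <= (d%:R * C + 1) * tau ^+ m.
  by rewrite mulr_ge0 ?exprn_ge0 ?(ltW tau0)// addr_ge0// mulr_ge0// ltW.
rewrite integral_nneseries//; first last.
- by move=> k om _; rewrite lee_fin energy_term_ge0.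
- by move=> k; exact: measurable_energy_term.
have term k : (\int[P]_om (energy_term m ga (W^~ om) a tau k)%:E
    <= ((d%:R * C + 1) * tau ^+ m * z ^+ k)%:E)%E.
  pose D j i om := W (dyadic_point a tau k j.+1) om 0 i - W (dyadic_point a tau k j) om 0 i.
  have mD j i : measurable_fun setT (fun om => ((D j i om) ^+ (2 * m))%:E).
    have [h1 h2] := dyadic_point_bounds k j a0 tau0.
    apply/measurable_EFinP; apply: measurable_funX.
    by apply: measurable_increment => //; exact: le_trans (ltW h2).
  have D0 j i om : (0 <= ((D j i om) ^+ (2 * m))%:E)%E.
    by rewrite lee_fin exprM exprn_ge0// sqr_ge0.
  pose S j om := (\sum_(i < d) ((D j i om) ^+ (2 * m))%:E)%E.
  have S0 j om : (0 <= S j om)%E by apply: sume_ge0.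
  have mS j : measurable_fun setT (S j) by apply: emeasurable_sum => i; exact: mD.
  have c0 : 0 <= (2 `^ (- ga)) ^- (2 * m * k) by rewrite invr_ge0 exprn_ge0// ltW.
  under eq_integral => om _.
    rewrite /energy_term (_ : (_ * _)%:E = ((2 `^ (- ga)) ^- (2 * m * k))%:E *
       \sum_(j < 2 ^ k) S j om)%E; last first.
      rewrite EFinM -sumEFin; congr (_ * _)%E; apply: eq_bigr => j _.
      by rewrite -sumEFin.
    over.
  rewrite ge0_integralZl_EFin//; first last.
  - by apply: emeasurable_sum => j; exact: mS.
  - by move=> om _; apply: sume_ge0.
  rewrite ge0_integral_sum//.
  apply: (@le_trans _ _ (((2 `^ (- ga)) ^- (2 * m * k))%:E *
      \sum_(j < 2 ^ k) \sum_(i < d) (C * (tau / 2 ^+ k) ^+ m)%:E)%E).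
    rewrite lee_wpmul2l ?lee_fin//; apply: lee_sum => j _; rewrite ge0_integral_sum//.
    apply: lee_sum => i _; have [h1 h2] := dyadic_point_bounds k j a0 tau0.
    by have := hC _ _ i h1 h2; rewrite dyadic_point_step.
  rewrite !sumEFin -EFinM lee_fin !sumr_const !card_ord.
  rewrite -[_ *+ d]mulr_natl -[_ *+ _ ^ k]mulr_natl natrX.
  have -> : z ^+ k = (2 `^ (- ga)) ^- (2 * m * k) * 2 ^+ k * (2 ^+ k) ^- m.
    rewrite /z exprMn -exprM exprMn -!exprVn -!exprM exprMn -!exprM (mulnC k m).
    by ring.
  rewrite exprMn -exprVn.
  have : 0 <= tau ^+ m * ((2 `^ (- ga)) ^- (2 * m * k) * 2 ^+ k * (2 ^+ k) ^- m).
    by rewrite !mulr_ge0// ?exprn_ge0 ?invr_ge0 ?(ltW tau0)// !exprn_ge0.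
  by rewrite -!exprVn; set u := tau ^+ m; set v := _ ^+ (2 * m * k); nra.
apply: le_trans (lee_nneseries _ (fun k _ => term k)) _.
  by move=> k _ _; apply: integral_ge0 => om _; rewrite lee_fin energy_term_ge0.
apply: lime_le; first by apply: is_cvg_nneseries => k _ _; rewrite lee_fin mulr_ge0// exprn_ge0// ltW.
apply: nearW => n; rewrite sumEFin lee_fin.
have := @geometric_le_lim _ n ((d%:R * C + 1) * tau ^+ m) z K0 z0.
by rewrite ger0_norm ?(ltW z0)// => /(_ z1); rewrite mulrAC.
Qed.

End energy_expectation.

(** The base of the power is 2^(2 ga - 1), below 1 exactly because ga < 1/2; a large m then beats
    the factor 2. *)
Lemma small_dyadic_rate (R : realType) (ga : R) : ga < 1 / 2 -> exists m0 : nat, forall m,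
  (m0 <= m)%N -> 2 * ((2 `^ (- ga)) ^- 2 / 2) ^+ m < 1.
Proof.
move=> ga2; set r := _ / 2.
have r0 : 0 <= r by rewrite divr_ge0// invr_ge0 exprn_ge0// powR_ge0.
have r1 : r < 1.
  have -> : r = 2 `^ (2 * ga - 1).
    rewrite powRD; last by rewrite pnatr_eq0 implybT.
    by rewrite /r powR_inv1// powRN -exprVn invrK -powR_mulrn ?powR_ge0// -powRrM (mulrC ga).
  by rewrite (_ : 2 * ga - 1 = - (1 - 2 * ga)); [apply: powR2N_lt1; lra|ring].
have := @cvg_geometric _ 1 r; rewrite ger0_norm// => /(_ r1) /cvgrPdist_lt /(_ (1/2)).
case=> [|m0 _ hm]; first by lra.
exists m0 => m mm; have := hm m mm; rewrite /geometric/= sub0r normrN ger0_norm; last by rewrite mul1r exprn_ge0.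
by lra.
Qed.

Section wiener_paths.
Context {R : realType} {disp : measure_display} {Omega : measurableType disp}.
Context {P : probability Omega R} {d : nat} {F : R -> set (set Omega)}.
Context {W : @process R disp Omega d} (hF : filtration F) (hW : wiener P F W).

Lemma energy_ae_fin m (ga : R) a tau : 2 * ((2 `^ (- ga)) ^- 2 / 2) ^+ m < 1 ->
  0 <= a -> 0 < tau -> {ae P, forall om, (energy m ga (W^~ om) a tau < +oo)%E}.
Proof.
move=> z1 a0 tau0; have [C C0 hC] := energy_moment hF hW z1.
have int : P.-integrable setT (fun om => energy m ga (W^~ om) a tau).
  apply/integrableP; split; first exact: (measurable_energy hF hW).
  under eq_integral do rewrite gee0_abs ?energy_ge0//.
  by apply: le_lt_trans (hC a tau a0 tau0) _; exact: ltry.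
have := integrable_ae measurableT int; apply: filterS => om /(_ I).
by rewrite ge0_fin_numE// energy_ge0.
Qed.

(** The summand 1 provides the condition H >= 1 of all path estimates. Dropping the division by N >=
    1 only enlarges the bound. *)
Lemma holder_path_energy (th : R) m (N : nat) (w : R -> 'rV[R]_d) :
  0 < th -> (0 < m)%N -> (0 < N)%N -> w 0 = 0 ->
  {within `[0, +oo[, continuous w} -> (energy m th^-1 w 0 N%:R < +oo)%E ->
  holder_path th N (1 + @chaining_const R d th^-1 * energy_root m th^-1 w 0 N%:R) w.
Proof.
move=> th0 m0 N0 w0 cw fin; split=> // s t s0 st tN.
have a0 : 0 < th^-1 by rewrite invr_gt0.
have NR : 0 < N%:R :> R by rewrite ltr0n.
have cwN : {within `[0, 0 + N%:R], continuous w}.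
  by apply: continuous_subspaceW cw => u; rewrite /= !in_itv/= andbT => /andP[].
have := energy_modulus m0 a0 NR cwN fin s0 st; rewrite add0r => /(_ tN) /le_trans; apply.
have K0 : 0 <= @chaining_const R d th^-1 * energy_root m th^-1 w 0 N%:R.
  by rewrite mulr_ge0 ?chaining_const_ge0 ?energy_root_ge0.
apply: (@le_trans _ _ (@chaining_const R d th^-1 * energy_root m th^-1 w 0 N%:R * (t - s) `^ th^-1)).
  rewrite ler_wpM2l// ge0_ler_powR ?nnegrE ?(ltW a0) ?divr_ge0 ?subr_ge0//.
  by rewrite ler_pdivrMr// ler_peMr ?subr_ge0// ler1n.
by rewrite ler_wpM2r ?powR_ge0// lerDr.
Qed.

Lemma wiener_holder_ae (th : R) : 2 < th ->
  {ae P, forall om, W 0 om = 0 /\ forall N, (0 < N)%N ->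
     exists2 H, 1 <= H & holder_path th N H (W^~ om)}.
Proof.
move=> th2; have th0 : 0 < th by lra.
have a0 : 0 < th^-1 by rewrite invr_gt0.
have ga2 : th^-1 < 1 / 2 by rewrite div1r ltf_pV2 ?posrE.
have [m0 hm] := small_dyadic_rate ga2.
have := hm (maxn m0 1) (leq_maxl _ _); set m := maxn _ _ => z1.
have m1 : (0 < m)%N by rewrite leq_max orbT.
have fin (N : nat) : {ae P, forall om, (0 < N)%N -> (energy m th^-1 (W^~ om) 0 N%:R < +oo)%E}.
  case: N => [|N]; first by apply: aeW.
  have := @energy_ae_fin m th^-1 0 N.+1%:R z1 (lexx 0) (ltr0n _ _).
  by apply: filterS => om ->.
have := ae_foralln fin; move: (wiener0 hW); apply: filterS2 => om w0 hfin; split=> // N N0.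
exists (1 + @chaining_const R d th^-1 * energy_root m th^-1 (W^~ om) 0 N%:R).
  by rewrite lerDl mulr_ge0 ?chaining_const_ge0 ?energy_root_ge0.
by apply: holder_path_energy => //; [exact: (wiener_continuous hW)|exact: hfin].
Qed.

End wiener_paths.

(** * Strong solutions of the equation and of the scheme *)

Section strong_solutions.
Context {R : realType} {disp : measure_display} {Omega : measurableType disp}.
Context {P : probability Omega R} {d : nat} {F : R -> set (set Omega)}.
Context {W : @process R disp Omega d} (hF : filtration F) (hW : wiener P F W).

Lemma borel_cutoff (v : 'rV[R]_d) tau (b : 'rV[R]_d -> 'rV[R]_d) :
  fnorm v = 1 -> borel_fun b -> borel_fun (cutoff v tau b).
Proof.
move=> v1 bb A bA.
have bL : borel [set x | dotp v x < tau].
  apply: borel_open; rewrite (_ : [set x | _] = [set x | - tau < - dotp v x]); last first.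
    by apply/seteqP; split => x /=; rewrite ltrN2.
  apply: (@open_gt_lip R d (fun x => - dotp v x)) => x y.
  by rewrite -opprD normrN -dotpBr normr_dotp_unit.
have -> : cutoff v tau b @^-1` A = (~` [set x | dotp v x < tau] `&` b @^-1` A) `|`
    ([set x | dotp v x < tau] `&` [set _ | A 0]).
  apply/seteqP; split => x; rewrite /cutoff /= ?leNgt.
    by case: ifPn => [h Ab|/negPn h A0]; [left; split=> //; exact/negP|right].
  by case=> -[h hA]; [rewrite ifT//; exact/negP|rewrite h].
apply: borel_setU; apply: borel_setI => //; first exact: borel_setC.
  exact: bb.
have [A0|A0] := pselect (A 0).
  have -> : [set _ : 'rV[R]_d | A 0] = setT by apply/seteqP; split.
  by apply: borel_open; exact: openT.
have -> : [set _ : 'rV[R]_d | A 0] = set0 by apply/seteqP; split.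
by apply: borel_open; exact: open0.
Qed.

Lemma euler_strong_solution (b : 'rV[R]_d -> 'rV[R]_d) x0 n : (0 < n)%N -> borel_fun b ->
  unique_strong_solution P F W x0 (euler_drift n b)
    (fun t om => euler_path b x0 (W^~ om) n t).
Proof.
move=> n0 bb; split; first split.
- exact: adapted_euler_path.
- by move=> om; apply: euler_path_continuous => //; exact: (wiener_continuous hW).
- move: (wiener0 hW); apply: filterS => om w0 t t0 i.
  exact: (euler_path_ode_solution b x0 n0 w0 (introT andP (conj t0 (lexx t)))).
move=> Y [_ _ sol]; move: (wiener0 hW) sol; apply: filterS2 => om w0 sol t t0.
apply: (euler_path_unique (Y := Y^~ om) n0 w0) => // T u /andP[u0 _] i; exact: sol.
Qed.

Context {v : 'rV[R]_d} {b : 'rV[R]_d -> 'rV[R]_d} {x0 : 'rV[R]_d} {c l al eta kap : R}.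
Context (hb : repulsive_drift v b x0 c l al eta kap) (bb : borel_fun b).
Context (th : R) (th2 : 2 < th) (th3 : th <= 3).
Context (c0 : R) (q : nat) (c00 : 0 < c0) (q0 : (0 < q)%N).
Context (c0m : c0 <= Num.min (eta / 3) (dotp v x0 / 2)).
Context (noc : forall H u : R, 1 <= H -> 0 < u ->
  H * u `^ th^-1 < c0 * H ^- q + kap * (3 * (c0 * H ^- q)) `^ (- al) * u).

Notation estimates := (scheme_estimates (v := v) (b := b) (x0 := x0) (l := l) (c := c) th c0 q).
Notation lprops := (limit_props (v := v) (b := b) (x0 := x0) (l := l) th c0 q).

(** One admissible pair with w > 0 is enough to construct the solution: [path_rate] compares every
    scheme with any path that satisfies [limit_props]. The definition involves no horizon N. *)
Definition reference_limit (w : R -> 'rV[R]_d) : R -> 'rV[R]_d :=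
  path_limit (fun n => euler_path (cutoff v (level 1 (1 / (3 * l)) n) b) x0 w n).

Definition good_path (w : R -> 'rV[R]_d) : Prop :=
  forall N, (0 < N)%N -> exists2 H, 1 <= H & holder_path th N H w.

Lemma scheme_estimatesP (delta om : R) N : (0 < N)%N -> 0 < delta -> 0 < om <= 1 / (3 * l) ->
  exists C A (Q : nat), estimates N delta om C A Q.
Proof. by move=> N0 *; apply: (euler_path_estimates hb). Qed.

Let om0 : 0 < 1 / (3 * l) <= 1 / (3 * l).
Proof. by rewrite lexx andbT divr_gt0// mulr_gt0//; exact: rd_l hb. Qed.

Lemma reference_limitP N : (0 < N)%N -> exists2 C, 0 < C & forall H w, 1 <= H ->
  holder_path th N H w -> lprops N C H w (reference_limit w).
Proof.
move=> N0; have [C [A [Q est]]] := scheme_estimatesP N0 ltr01 om0.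
exists C => [|H w H1 hw]; first by case: est.
exact: (path_limitP hb th2 c00 est H1 hw).
Qed.

Lemma horizon (t : R) : 0 <= t -> exists2 N : nat, (0 < N)%N & 0 <= t <= N%:R /\ t + 1 <= N%:R.
Proof.
move=> t0; have [N hN] := exists_nat_ge (t + 1).
exists N; first by rewrite -(ltr0n R) (lt_le_trans _ hN)// ltr_wpDl.
by split=> //; rewrite t0/=; lra.
Qed.

Lemma reference_limit_sol w t : good_path w -> 0 <= t ->
  ode_solution w x0 (fun t => b (reference_limit w t)) (reference_limit w) t.
Proof.
move=> gw t0 s /andP[s0 st] i; have [N N0 [/andP[_ tN] _]] := horizon t0; have [H H1 hw] := gw N N0.
have [C C0 hC] := reference_limitP N0.
apply: (lp_sol (hC H w H1 hw)); by rewrite s0 (le_trans st).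
Qed.

Lemma reference_limit_continuous w : good_path w ->
  {within `[0, +oo[, continuous (reference_limit w)}.
Proof.
move=> gw; apply/within_continuousP => s; rewrite /= in_itv/= andbT => s0 e e0.
have [N N0 [sN s1]] := horizon s0; have [H H1 hw] := gw N N0.
have [C C0 hC] := reference_limitP N0; have lp := hC H w H1 hw.
have a0 : 0 < th^-1 by rewrite invr_gt0; move: th2; lra.
have [m [m0 hm]] := exists_inv_powR_le (d%:R * drift_bound (l := l) c0 q C H + H) e0 a0.
exists (Num.min 1 m%:R^-1); first by rewrite lt_min ltr01 invr_gt0 ltr0n.
move=> t; rewrite /= in_itv/= andbT => t0; rewrite lt_min => /andP[ts tsm].
apply: (le_trans (mx_norm_le_fnorm _)); apply: le_trans (hm m (leqnn m)).
apply: (lp_modulus lp) => //; last by rewrite ltW.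
by move: ts; rewrite t0 ltr_norml => /andP[_]; lra.
Qed.

(** The index is shifted because [adapted_limit] asks every term of the sequence to be measurable,
    and the scheme is adapted for n >= 1. *)
Lemma reference_limit_cvg w t i : good_path w -> 0 <= t ->
  (fun n => euler_path (cutoff v (level 1 (1 / (3 * l)) n.+1) b) x0 w n.+1 t 0 i) @ \oo
    --> reference_limit w t 0 i.
Proof.
move=> gw t0; have [N N0 [tN _]] := horizon t0; have [H H1 hw] := gw N N0.
have [C [A [Q est]]] := scheme_estimatesP N0 ltr01 om0.
have [n0 [n00 hn]] := euler_path_limit hb th2 c00 est H1 hw.
have a0 : 0 < th^-1 by rewrite invr_gt0; move: th2; lra.
apply/cvgrPdist_le => e e0.
have [m [m0 hm]] := exists_inv_powR_le (d%:R * compare_const (d := d) (c := c) (l := l) c0 q N C H) e0 a0.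
exists (maxn n0 m) => // n /=; rewrite geq_max => /andP[n0n mn].
have [_ h] := hn n.+1 (leqW n0n); have := h t tN; rewrite fnormB => /le_trans => h'.
have := h' _ (hm n.+1 (leqW mn)); apply: le_trans.
by have := normr_coord_le (reference_limit w t - euler_path (cutoff v (level 1 (1 / (3 * l)) n.+1) b) x0 w n.+1 t) i;
  rewrite !mxE.
Qed.

Lemma reference_limit_unique w Y : good_path w ->
  (forall t, 0 <= t -> ode_solution w x0 (fun t => b (Y t)) Y t) ->
  {within `[0, +oo[, continuous Y} -> forall t, 0 <= t -> Y t = reference_limit w t.
Proof.
move=> gw sol cY t t0; have [N N0 [tN _]] := horizon t0; have [H H1 hw] := gw N N0.
have [C [A [Q est]]] := scheme_estimatesP N0 ltr01 om0.
apply: (path_unique hb th2 c00 q0 est H1 hw) => //; first exact: sol.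
by apply: continuous_subspaceW cY => u; rewrite /= !in_itv/= andbT => /andP[].
Qed.

Lemma strong_solution : exists X : @process R disp Omega d,
  unique_strong_solution P F W x0 (sde_drift b) X /\
  {ae P, forall om, forall t, X t om = reference_limit (W^~ om) t}.
Proof.
have gae : {ae P, forall om, good_path (W^~ om)}.
  by have := wiener_holder_ae hF hW th2; apply: filterS => om [].
have [M [mM M0 hM]] := gae.
(* Paths must be continuous for every outcome, so on the null set M the path is frozen at x0. *)
pose X t om := if om \in M then x0 else reference_limit (W^~ om) t.
have gM om : ~ M om -> good_path (W^~ om) by move=> Mo; apply: contrapT => /hM.
have XM : {ae P, forall om, forall t, X t om = reference_limit (W^~ om) t}.
  exists M; split => // om /= h; apply: contrapT => nM; apply: h => t.
  by rewrite /X memNset.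
exists X; split=> //; split; first split.
- apply: (adapted_limit (Xn := fun n t om => euler_path (cutoff v (level 1 (1 / (3 * l)) n.+1) b) x0 (W^~ om) n.+1 t)
    (x0 := x0) mM M0).
  + move=> n t i t0; apply: measurable_euler_path => //; apply: borel_cutoff => //; exact: rd_unit hb.
  + by move=> t om Mo; rewrite /X mem_set.
  + move=> t om i t0 Mo; rewrite /X memNset//.
    by apply: reference_limit_cvg => //; exact: gM.
- move=> om; have [Mo|Mo] := pselect (M om).
    by rewrite (_ : (fun t => X t om) = cst x0);
      [exact: cst_continuous|apply/funext => t; rewrite /X mem_set].
  rewrite (_ : (fun t => X t om) = reference_limit (W^~ om)).
    by apply: reference_limit_continuous; exact: gM.
  by apply/funext => t; rewrite /X memNset.
- move: XM gae; apply: filterS2 => om XE gw t t0 i.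
  have := reference_limit_sol gw t0 (introT andP (conj t0 (lexx t))) i.
  by rewrite (_ : reference_limit (W^~ om) = X^~ om)//; apply/funext => s; rewrite XE.
move=> Y [_ cY sol]; move: sol; apply: filterS3 XM gae => om XE gw sol t t0.
rewrite XE; apply: (reference_limit_unique (Y := Y^~ om)) => // s s0 u /andP[u0 us] i; exact: sol.
Qed.

End strong_solutions.

(** Tangent of the convex function x^(n+1) at b; the induction step leaves (n+1) b^n (a - b)^2 >=
    0. *)
Lemma expr_tangent (R : realType) (a b : R) n : 0 <= a -> 0 <= b ->
  b ^+ n.+1 + n.+1%:R * b ^+ n * (a - b) <= a ^+ n.+1.
Proof.
move=> a0 b0; elim: n => [|n IH]; first by rewrite !expr1 expr0; lra.
have := ler_wpM2l a0 IH; rewrite -exprS; apply: le_trans.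
rewrite -subr_ge0.
have -> : a * (b ^+ n.+1 + n.+1%:R * b ^+ n * (a - b)) - (b ^+ n.+2 + n.+2%:R * b ^+ n.+1 * (a - b))
    = n.+1%:R * b ^+ n * (a - b) ^+ 2.
  by rewrite !exprS -(natr1 n.+1); ring.
by rewrite mulr_ge0 ?sqr_ge0// mulr_ge0// exprn_ge0.
Qed.

(** The tangent inequalities at the mean are summed; their linear parts cancel. *)
Lemma power_mean (R : realType) (K r : nat) (a : nat -> R) : (0 < K)%N ->
  (forall j, 0 <= a j) ->
  (\sum_(j < K) a j) ^+ r.+1 <= K%:R ^+ r * \sum_(j < K) a j ^+ r.+1.
Proof.
move=> K0 a0; have KR : 0 < K%:R :> R by rewrite ltr0n.
set s := \sum_(j < K) a j; have s0 : 0 <= s by exact: sumr_ge0.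
have h : \sum_(j < K) ((s / K%:R) ^+ r.+1 + r.+1%:R * (s / K%:R) ^+ r * (a j - s / K%:R))
    <= \sum_(j < K) a j ^+ r.+1.
  by apply: ler_sum => j _; apply: expr_tangent; rewrite ?divr_ge0.
have := ler_wpM2l (exprn_ge0 r (ltW KR)) h; apply: le_trans.
set u := s / K%:R; have uK : u * K%:R = s by rewrite divfK// gt_eqF.
rewrite big_split/= -mulr_sumr sumrB -/s !sumr_const card_ord.
rewrite -[u *+ K]mulr_natr uK subrr mulr0 addr0 -[u ^+ _ *+ K]mulr_natr -uK exprMn.
by rewrite (mulrC (K%:R ^+ r)) -mulrA -exprS.
Qed.

Lemma expr_add_le (R : realType) (a b : R) r : 0 <= a -> 0 <= b ->
  (a + b) ^+ r <= 2 ^+ r * (a ^+ r + b ^+ r).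
Proof.
move=> a0 b0; have [ab|/ltW ba] := leP a b.
  apply: (@le_trans _ _ ((2 * b) ^+ r)); first by rewrite lerXn2r ?nnegrE ?addr_ge0 ?mulr_ge0//; lra.
  by rewrite exprMn ler_wpM2l ?exprn_ge0// lerDr exprn_ge0.
apply: (@le_trans _ _ ((2 * a) ^+ r)); first by rewrite lerXn2r ?nnegrE ?addr_ge0 ?mulr_ge0//; lra.
by rewrite exprMn ler_wpM2l ?exprn_ge0// lerDl exprn_ge0.
Qed.

Lemma powR_le_expr (R : realType) (x p : R) (m : nat) : 1 <= x -> p <= m%:R -> x `^ p <= x ^+ m.
Proof.
by move=> x1 pm; rewrite -powR_mulrn ?(le_trans ler01)// ler_powR.
Qed.

(* To be applied to a supremum over uncountably many times, whose measurability is not known. *)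
Lemma integral_le_ae {d} {T : measurableType d} {R : realType} (P : probability T R)
    (f g : T -> \bar R) :
  (forall x, 0 <= f x)%E -> (forall x, 0 <= g x)%E -> measurable_fun setT g ->
  {ae P, forall x, (f x <= g x)%E} -> (\int[P]_x f x <= \int[P]_x g x)%E.
Proof.
move=> f0 g0 mg [M [mM M0 hM]].
(* Raising g to +oo on the null set M keeps its integral and makes the inequality hold
   everywhere. *)
pose g' x := if x \in M then +oo%E else g x.
have g'0 x : (0 <= g' x)%E by rewrite /g'; case: ifP => // _; rewrite leey.
have mg' : measurable_fun setT g'.
  apply: measurable_fun_ifT => //.
  apply: (measurable_fun_bool true); rewrite setTI.
  by rewrite (_ : _ @^-1` _ = M)//; apply/seteqP; split => x /= h; [exact: set_mem|exact: mem_set].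
have -> : (\int[P]_x g x = \int[P]_x g' x)%E.
  apply: ge0_ae_eq_integral => //; exists M; split => // x /= h; apply: contrapT => Mx; apply: h => _.
  by rewrite /g' memNset.
(* Both integrals are suprema over simple functions, and those below f are also below g'. *)
rewrite !ge0_integralTE//; apply: ereal_sup_le => _ [h hf <-]; exists h => // x.
apply: le_trans (hf x) _; rewrite /g'; case: ifPn => [_|]; first exact: leey.
by rewrite notin_setE => Mx; apply: contrapT => h'; apply: Mx; exact: hM.
Qed.

(** With h = n^(-1/2) and S the sum of the M j, the bound reads C2 h (1 + y)^Q2 (1 + h S). The
    inequality A B <= A^2 + B^2 separates the two factors and the power mean splits S^(2m), so only
    2m-th powers of y and of the M j are left to integrate. *)
Lemma rate_power_bound (R : realType) (C2 y p x : R) (n K Q2 m : nat) (M : nat -> R) :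
  0 < C2 -> 0 <= y -> 0 < p -> p <= m%:R -> Q2%:R * p <= m%:R -> (0 < m)%N -> (0 < n)%N -> (0 < K)%N ->
  (forall j, 0 <= M j) -> 0 <= x ->
  x <= C2 * (1 + y) ^+ Q2 * (n%:R^-1 `^ 2^-1 + n%:R^-1 * \sum_(j < K) M j) ->
  x `^ p <= C2 `^ p * 4 ^+ m * n%:R `^ (- (p / 2)) *
    (2 + y ^+ (2 * m) + n%:R ^- m * (K%:R ^+ (2 * m).-1 * \sum_(j < K) M j ^+ (2 * m))).
Proof.
move=> C20 y0 p0 pm Qpm m0 n0 K0 M0 x0 xle.
have nR : 0 < n%:R :> R by rewrite ltr0n.
set h := n%:R^-1 `^ 2^-1 in xle; have h0 : 0 < h by rewrite powR_gt0// invr_gt0.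
have hh : h * h = n%:R^-1.
  by rewrite -expr2 -powR_mulrn ?ltW// -powRrM mulVf// powRr1// invr_ge0 ltW.
set S := \sum_(j < K) M j in xle; have S0 : 0 <= S by exact: sumr_ge0.
set H := 1 + y in xle; have H1 : 1 <= H by rewrite lerDl.
pose G := 1 + h * S; have G1 : 1 <= G by rewrite lerDl mulr_ge0// ltW.
have H0 : 0 <= H by exact: le_trans H1.
have G0 : 0 <= G by exact: le_trans G1.
have -> : n%:R `^ (- (p / 2)) = h `^ p.
  by rewrite /h -powRrM -[n%:R^-1]powR_inv1 ?ltW// -powRrM mulN1r mulrC.
have {}xle : x <= C2 * h * (H ^+ Q2 * G) by apply: le_trans xle _; rewrite -hh /G le_eqVlt; apply/orP; left; apply/eqP; ring.
have HQ : 0 <= H ^+ Q2 by rewrite exprn_ge0.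
have xp : x `^ p <= C2 `^ p * h `^ p * (H ^+ m * G ^+ m).
  apply: (@le_trans _ _ ((C2 * h * (H ^+ Q2 * G)) `^ p)).
    by rewrite ge0_ler_powR ?nnegrE ?(ltW p0)// !mulr_ge0// ltW.
  rewrite powRM; [|by rewrite mulr_ge0// ltW|by rewrite mulr_ge0].
  rewrite (powRM _ (ltW C20) (ltW h0)) (powRM _ HQ G0) ler_wpM2l ?mulr_ge0 ?powR_ge0//.
  apply: ler_pM; rewrite ?powR_ge0//; last exact: powR_le_expr.
  by rewrite -powR_mulrn// -powRrM; exact: powR_le_expr.
apply: (le_trans xp).
have -> : C2 `^ p * 4 ^+ m * h `^ p = C2 `^ p * h `^ p * 4 ^+ m by rewrite mulrAC.
rewrite -[leRHS]mulrA ler_wpM2l ?mulr_ge0 ?powR_ge0//.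
have HG : H ^+ m * G ^+ m <= H ^+ (2 * m) + G ^+ (2 * m).
  rewrite mulnC !exprM; have := sqr_ge0 (H ^+ m - G ^+ m).
  have := mulr_ge0 (exprn_ge0 m H0) (exprn_ge0 m G0).
  by move: (H ^+ m) (G ^+ m) => r1 r2; rewrite !expr2; nra.
apply: (le_trans HG).
have two : 2 ^+ (2 * m) = 4 ^+ m :> R by rewrite exprM; congr (_ ^+ _); rewrite expr2; ring.
have Hb : H ^+ (2 * m) <= 4 ^+ m * (1 + y ^+ (2 * m)).
  by have := expr_add_le (2 * m) ler01 y0; rewrite expr1n two.
have Gb : G ^+ (2 * m) <= 4 ^+ m * (1 + n%:R ^- m * (K%:R ^+ (2 * m).-1 * \sum_(j < K) M j ^+ (2 * m))).
  have := expr_add_le (2 * m) ler01 (mulr_ge0 (ltW h0) S0); rewrite expr1n two.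
  move/le_trans; apply; rewrite ler_wpM2l ?exprn_ge0// lerD2l exprMn exprM expr2 hh -exprVn.
  rewrite ler_wpM2l ?exprn_ge0 ?invr_ge0//.
  have e : (2 * m)%N = (2 * m).-1.+1 by rewrite prednK// muln_gt0.
  by rewrite {1 3}e; exact: power_mean.
rewrite (le_trans (lerD Hb Gb))// -mulrDr ler_wpM2l ?exprn_ge0//; lra.
Qed.

(** * Convergence rate in L^p *)

Section rate.
Context {R : realType} {disp : measure_display} {Omega : measurableType disp}.
Context {P : probability Omega R} {d : nat} {F : R -> set (set Omega)}.
Context {W : @process R disp Omega d} (hF : filtration F) (hW : wiener P F W).
Context {v : 'rV[R]_d} {b : 'rV[R]_d -> 'rV[R]_d} {x0 : 'rV[R]_d} {c l al eta kap : R}.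
Context (hb : repulsive_drift v b x0 c l al eta kap) (bb : borel_fun b).
Context (th : R) (th2 : 2 < th) (th3 : th <= 3).
Context (c0 : R) (q : nat) (c00 : 0 < c0) (q0 : (0 < q)%N).
Context (c0m : c0 <= Num.min (eta / 3) (dotp v x0 / 2)).
Context (noc : forall H u : R, 1 <= H -> 0 < u ->
  H * u `^ th^-1 < c0 * H ^- q + kap * (3 * (c0 * H ^- q)) `^ (- al) * u).

Lemma scheme_rate (X : @process R disp Omega d) (delta om T p : R) :
  {ae P, forall o, forall t,
     X t o = reference_limit (v := v) (b := b) (x0 := x0) (l := l) (W^~ o) t} ->
  0 < delta -> 0 < om <= 1 / (3 * l) -> 0 < T -> 0 < p ->
  exists2 C : R, 0 < C & forall n, (1 <= n)%N ->
    (\int[P]_o ereal_sup [set (fnorm (euler_path (cutoff v (level delta om n) b) x0 (W^~ o) n t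
        - X t o) `^ p)%:E | t in `[0%R, T]] <= (C * n%:R `^ (- (p / 2)))%:E)%E.
Proof.
move=> XE delta0 omb T0 p0.
have a0 : 0 < th^-1 by rewrite invr_gt0; move: th2; lra.
have [N N0 [/andP[_ TN] _]] := horizon (ltW T0).
have NR : 0 < N%:R :> R by rewrite ltr0n.
have [C [A [Q est]]] := scheme_estimatesP hb th2 th3 c00 c0m noc N0 delta0 omb.
have [C' C'0 hC'] := reference_limitP hb th2 th3 c00 c0m noc N0.
have [C2 [Q2 [C20 hR]]] := path_rate hb c00 N0 est C'0.
have [m1 hm1] := exists_nat_ge p.
have [m2 hm2] := exists_nat_ge (Q2%:R * p).
have ga2 : th^-1 < 1 / 2 by rewrite div1r ltf_pV2 ?posrE//; move: th2; lra.
have [m3 hm3] := small_dyadic_rate ga2.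
(* m dominates p and Q2 p, so that powers with exponent p become m-th powers, and is large enough
   for [energy_moment]. *)
pose m := maxn (maxn m1 m2) (maxn m3 1).
have m1m : (m1 <= m)%N by rewrite !leq_max leqnn.
have m2m : (m2 <= m)%N by rewrite !leq_max leqnn !orbT.
have m3m : (m3 <= m)%N by rewrite !leq_max leqnn !orbT.
have m0 : (0 < m)%N by rewrite !leq_max !orbT.
have pm : p <= m%:R by rewrite (le_trans hm1)// ler_nat.
have Qpm : Q2%:R * p <= m%:R by rewrite (le_trans hm2)// ler_nat.
have z1 := hm3 m m3m.
clearbody m; clear m1 m2 m3 hm1 hm2 hm3 m1m m2m m3m.
have [Cm Cm0 hCm] := energy_moment hF hW z1.
pose ka := @chaining_const R d th^-1; have ka0 : 0 <= ka by exact: chaining_const_ge0.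
pose ka2 := ka ^+ (2 * m); have ka20 : 0 <= ka2 by exact: exprn_ge0.
have B0 : 0 <= ka2 * Cm * (N%:R ^+ m + N%:R ^+ (2 * m)).
  by rewrite mulr_ge0 ?addr_ge0 ?exprn_ge0// mulr_ge0// ltW.
exists (C2 `^ p * 4 ^+ m * (2 + ka2 * Cm * (N%:R ^+ m + N%:R ^+ (2 * m)))) => [|n n1].
  by rewrite !mulr_gt0 ?powR_gt0 ?exprn_gt0// ltr_wpDr.
have nR : 0 < n%:R :> R by rewrite ltr0n.
have K0 : (0 < n * N)%N by rewrite muln_gt0 n1.
set K := (n * N)%N in K0; have KR : 0 < K%:R :> R by rewrite ltr0n.
pose e0 o := energy m th^-1 (W^~ o) 0 N%:R.
pose e j o := energy m th^-1 (W^~ o) (j%:R / n%:R) n%:R^-1.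
have jn0 (j : nat) : 0 <= j%:R / n%:R :> R by rewrite divr_ge0.
have n10 : 0 < n%:R^-1 :> R by rewrite invr_gt0.
pose c1 := C2 `^ p * 4 ^+ m * n%:R `^ (- (p / 2)).
have c10 : 0 <= c1 by rewrite !mulr_ge0 ?powR_ge0 ?exprn_ge0.
pose c2 := n%:R ^- m * K%:R ^+ (2 * m).-1 * ka2.
have c20 : 0 <= c2 by rewrite !mulr_ge0 ?invr_ge0 ?exprn_ge0.
(* The bound of [rate_power_bound] with y^(2m) and M_j^(2m) written as energies: it is measurable
   and affine in them. *)
pose Z o := (c1%:E * (2%:E + ka2%:E * e0 o + c2%:E * \sum_(j < K) e j o))%E.
have e00 o : (0 <= e0 o)%E by exact: energy_ge0.
have ej0 j o : (0 <= e j o)%E by exact: energy_ge0.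
have me0 : measurable_fun setT e0 by exact: (measurable_energy hF hW).
have mej j : measurable_fun setT (e j) by exact: (measurable_energy hF hW).
have S0 o : (0 <= \sum_(j < K) e j o)%E by exact: sume_ge0.
have mS : measurable_fun setT (fun o => \sum_(j < K) e j o)%E by apply: emeasurable_sum.
have t10 o : (0 <= ka2%:E * e0 o)%E by rewrite mule_ge0.
have t20 o : (0 <= c2%:E * \sum_(j < K) e j o)%E by rewrite mule_ge0.
have mt1 : measurable_fun setT (fun o => ka2%:E * e0 o)%E by exact: measurable_funeM.
have mt2 : measurable_fun setT (fun o => c2%:E * \sum_(j < K) e j o)%E by exact: measurable_funeM.
have t30 o : (0 <= 2%:E + ka2%:E * e0 o)%E by rewrite adde_ge0// lee_fin.
have mt3 : measurable_fun setT (fun o => 2%:E + ka2%:E * e0 o)%E by exact: emeasurable_funD.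
have mt4 : measurable_fun setT (fun o => 2%:E + ka2%:E * e0 o + c2%:E * \sum_(j < K) e j o)%E.
  exact: emeasurable_funD.
have t40 o : (0 <= 2%:E + ka2%:E * e0 o + c2%:E * \sum_(j < K) e j o)%E by rewrite adde_ge0.
have intZ : (\int[P]_o Z o <= (C2 `^ p * 4 ^+ m * (2 + ka2 * Cm * (N%:R ^+ m + N%:R ^+ (2 * m)))
    * n%:R `^ (- (p / 2)))%:E)%E.
  rewrite /Z ge0_integralZl_EFin//.
  rewrite ge0_integralD// ge0_integralD//.
  rewrite !ge0_integralZl_EFin// ge0_integral_sum//.
  have -> : (\int[P]_(o in setT) 2%:E = 2%:E :> \bar R)%E.
    rewrite (integral_cst P measurableT) -[RHS]mule1; congr (_ * _)%E; exact: probability_setT.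
  apply: (@le_trans _ _ (c1%:E * (2%:E + ka2%:E * (Cm * N%:R ^+ m)%:E +
      c2%:E * \sum_(j < K) (Cm * n%:R^-1 ^+ m)%:E))%E).
    rewrite lee_wpmul2l ?lee_fin// leeD//.
      by rewrite leeD2l// lee_wpmul2l ?lee_fin//; exact: hCm.
    by rewrite lee_wpmul2l ?lee_fin//; apply: lee_sum => j _; exact: hCm.
  rewrite sumEFin sumr_const card_ord -[(Cm * _) *+ K]mulr_natr.
  apply: (@le_trans _ _ (c1 * (2 + ka2 * (Cm * N%:R ^+ m) + c2 * (Cm * n%:R^-1 ^+ m * K%:R)))%:E).
    exact: lexx.
  rewrite lee_fin.
  (* The energy of a step has expectation of order n^(-m). With K = n N steps and the factor n^(-m)
     K^(2m-1), all powers of n cancel. *)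
  have -> : c2 * (Cm * n%:R^-1 ^+ m * K%:R) = ka2 * Cm * N%:R ^+ (2 * m).
    have e1 : K%:R ^+ (2 * m).-1 * K%:R = n%:R ^+ m * n%:R ^+ m * N%:R ^+ (2 * m) :> R.
      by rewrite -exprSr prednK ?muln_gt0// natrM exprMn mul2n -addnn exprD.
    have e2 : c2 * (Cm * n%:R^-1 ^+ m * K%:R) =
        n%:R ^- m * n%:R ^- m * ka2 * Cm * (K%:R ^+ (2 * m).-1 * K%:R) :> R.
      by rewrite /c2 exprVn; ring.
    by rewrite e2 e1; field; rewrite expf_neq0// gt_eqF.
  by rewrite /c1 le_eqVlt; apply/orP; left; apply/eqP; ring.
apply: le_trans intZ; apply: integral_le_ae => //.
- move=> o; apply: le_trans (_ : ((fnorm (euler_path (cutoff v (level delta om n) b) x0 (W^~ o) n 0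
        - X 0 o) `^ p)%:E <= _)%E); first by rewrite lee_fin powR_ge0.
  by apply: ereal_sup_ubound; exists 0 => //=; rewrite in_itv/= lexx ltW.
- by move=> o; rewrite /Z mule_ge0.
- exact: measurable_funeM.
have fin0 : {ae P, forall o, (e0 o < +oo)%E} by exact: (energy_ae_fin hF hW).
have finj : {ae P, forall o, forall j, (e j o < +oo)%E}.
  by apply: ae_foralln => j; exact: (energy_ae_fin hF hW).
have fin : {ae P, forall o, [/\ W 0 o = 0, (e0 o < +oo)%E & forall j, (e j o < +oo)%E]}.
  by move: (wiener0 hW) fin0 finj; apply: filterS3.
move: XE fin; apply: filterS2 => o XE [w0 f0 fj].
apply: ge_ereal_sup => _ [t tT <-].
have tN : 0 <= t <= N%:R by move: tT; rewrite /= in_itv/= => /andP[-> tT]; exact: le_trans tT TN.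
have cw : {within `[0, +oo[, continuous (W^~ o)} by exact: (wiener_continuous hW).
have th0 : 0 < th by move: th2; lra.
have hw := holder_path_energy th0 m0 N0 w0 cw f0.
pose y := ka * energy_root m th^-1 (W^~ o) 0 N%:R.
pose M j := ka * energy_root m th^-1 (W^~ o) (j%:R / n%:R) n%:R^-1.
have y0 : 0 <= y by rewrite mulr_ge0// energy_root_ge0.
have M0 j : 0 <= M j by rewrite mulr_ge0// energy_root_ge0.
have H1 : 1 <= 1 + y by rewrite lerDl.
have modM j u : j%:R / n%:R <= u <= j.+1%:R / n%:R -> u <= N%:R ->
    fnorm (W u o - W (j%:R / n%:R) o) <= M j.
  move=> /andP[ju uj] _.
  have cwj : {within `[j%:R / n%:R, j%:R / n%:R + n%:R^-1], continuous (W^~ o)}.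
    apply: continuous_subspaceW cw => r; rewrite /= !in_itv/= andbT => /andP[jr _].
    exact: le_trans (jn0 j) jr.
  have uj' : u <= j%:R / n%:R + n%:R^-1 by move: uj; rewrite grid_succ.
  have le1 : ((u - j%:R / n%:R) / n%:R^-1) `^ th^-1 <= 1.
    apply: (@le_trans _ _ (1 `^ th^-1)); last by rewrite powR1.
    rewrite ge0_ler_powR ?nnegrE ?(ltW a0)//.
      by rewrite divr_ge0 ?subr_ge0// ltW.
    by rewrite ler_pdivrMr// mul1r lerBlDl.
  have := energy_modulus m0 a0 n10 cwj (fj j) (lexx _) ju uj'.
  move=> /le_trans; apply; apply: (le_trans (ler_wpM2l (M0 j) le1)).
  rewrite mulr1; exact: lexx.
have ey : y ^+ (2 * m) = ka2 * fine (e0 o) by rewrite /y exprMn (energy_rootX _ m0).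
have eM : \sum_(j < K) M j ^+ (2 * m) = ka2 * \sum_(j < K) fine (e j o).
  by rewrite mulr_sumr; apply: eq_bigr => j _; rewrite /M exprMn (energy_rootX _ m0).
move: hw; rewrite -/y => hw; clearbody y M.
have := hR (1 + y) (W^~ o) _ n M H1 hw (hC' _ _ H1 hw) n1 M0 modM t tN.
rewrite -XE => /(rate_power_bound C20 y0 p0 pm Qpm m0 n1 K0 M0 (fnorm_ge0 _)) bound.
have ff0 : e0 o \is a fin_num by rewrite ge0_fin_numE.
have ffj j : e j o \is a fin_num by rewrite ge0_fin_numE.
have -> : Z o = (c1 * (2 + ka2 * fine (e0 o) + c2 * \sum_(j < K) fine (e j o)))%:E.
  have eS : (\sum_(j < K) e j o = (\sum_(j < K) fine (e j o))%:E)%E.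
    by rewrite -sumEFin; apply: eq_bigr => j _; rewrite fineK.
  rewrite /Z eS -(fineK ff0); exact: erefl.
rewrite lee_fin; apply: le_trans bound _.
have alg r1 r2 : c1 * (2 + ka2 * r1 + n%:R ^- m * (K%:R ^+ (2 * m).-1 * (ka2 * r2))) =
    c1 * (2 + ka2 * r1 + c2 * r2) by rewrite /c2; ring.
rewrite ey eM alg; exact: lexx.
Qed.

End rate.

(** Differentiability at x depends on the germ of f only; this is wanted because [dist S] is known
    to be linear on D and not elsewhere. *)
Lemma near_differentiable (R : numFieldType) (V W : normedModType R) (f g : V -> W) (x : V) :
  (\forall y \near x, f y = g y) -> differentiable g x -> differentiable f x.
Proof.
move=> fg [[cg eg]]; have fx : f x = g x by exact: (nbhs_singleton fg).
have ef : f = cst (f (lim (nbhs x))) + 'd g x \o center (lim (nbhs x)) +o_ (nbhs x) (center (lim (nbhs x))).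
  apply/eqaddoP => e e0; move/eqaddoP: eg => /(_ e e0).
  have -> : f (lim (nbhs x)) = g (lim (nbhs x)) by rewrite lim_id.
  by move: fg; apply: filterS2 => y fgy; rewrite !fctE fgy.
have ex : exists df : {linear V -> W}, continuous df /\ forall y,
    f y = f (lim (nbhs x)) + df (y - lim (nbhs x)) +o_(y \near nbhs x) (y - lim (nbhs x)).
  by exists ('d g x); split=> // y; rewrite {1}ef.
have [cf hf] := getPex ex; apply/diffP; split; first exact: cf.
exact: hf.
Qed.

Section locally_affine.
Context {R : realType} {d : nat}.
Implicit Types (f : 'rV[R]_d -> R) (v x : 'rV[R]_d) (a : R).

Lemma differentiable_affine v a x : differentiable (fun y => a + dotp v y) x.
Proof.
have -> : (fun y => a + dotp v y) = cst a + \sum_(i < d) (fun y : 'rV[R]_d => v 0 i *: (y 0 i : R)).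
  by apply/funext => y; rewrite fctE fct_sumE.
apply: differentiableD; first exact: differentiable_cst.
apply: differentiable_sum => i; apply: differentiableZ; exact: differentiable_coord.
Qed.

Lemma derive_locally_affine f v a x u :
  (\forall y \near x, f y = a + dotp v y) -> 'D_u f x = dotp v u.
Proof.
move=> fE; apply: cvg_lim => //.
have shift_cvg : (fun h : R => h *: u + x) @ 0 --> x.
  rewrite -[X in _ --> X]add0r -(scale0r u).
  by apply: cvgD; [apply: cvgZr_tmp; exact: cvg_id|exact: cvg_cst].
have near0 : \forall h \near (0 : R), f (h *: u + x) = a + dotp v (h *: u + x) by exact: (shift_cvg [set y | f y = a + dotp v y] fE).
have fx : f x = a + dotp v x by exact: (nbhs_singleton fE).
have eqF : {near 0^', cst (dotp v u) =1 (fun h : R => h^-1 *: ((f \o shift x) (h *: u) - f x))}.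
  near=> h; rewrite /= fx.
  have -> : f (h *: u + x) = a + dotp v (h *: u + x) by near: h; exact: cvg_within near0.
  have h0 : h != 0 by near: h; exact: nbhs_dnbhs_neq.
  rewrite dotpDr dotpZr (_ : a + _ - _ = h * dotp v u); last by ring.
  by rewrite /GRing.scale/= mulrA mulVf// mul1r.
exact: cvg_trans (near_eq_cvg eqF) (cvg_cst _).
Unshelve. all: by end_near. Qed.

End locally_affine.

(** * Distance to the boundary of a half-space *)

Section half_space.
Context {R : realType} {d : nat} {v : 'rV[R]_d} (v1 : fnorm v = 1).

Definition half_space : set 'rV[R]_d := [set x | 0 < dotp v x].

Lemma open_half_space : open half_space.
Proof.
apply: (@open_gt_lip R d (dotp v) 0) => x y.
by rewrite -dotpBr normr_dotp_unit.
Qed.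

Let dotpvv : dotp v v = 1.
Proof. by rewrite -sqr_fnorm v1 expr1n. Qed.

Lemma boundary_half_space x : dotp v x = 0 -> boundary half_space x.
Proof.
move=> vx; split; last by move=> /interior_subset; rewrite /half_space/= vx ltxx.
move=> B /nbhs_ballP[e /= e0 he]; exists (x + (e / 2) *: v); split.
  by rewrite /half_space/= dotpDr vx add0r dotpZr dotpvv mulr1 divr_gt0.
apply: he; rewrite -ball_normE /ball_ /= opprD addrA subrr add0r normrN.
apply: (le_lt_trans (mx_norm_le_fnorm _)); rewrite fnormZ v1 mulr1 ger0_norm.
  by lra.
by lra.
Qed.

(** Besides the foot of the perpendicular a lower bound is needed: S avoids D, so dotp v y <= 0 on S
    and |x - y| >= dotp v (x - y) >= dotp v x. *)
Lemma dist_half_space (S : set 'rV[R]_d) x : half_space `&` S = set0 ->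
  boundary half_space `<=` S -> half_space x -> dist S x = dotp v x.
Proof.
move=> dis bd Dx; have x0 : 0 < dotp v x := Dx.
pose y0 := x - dotp v x *: v.
have Sy0 : S y0.
  by apply: bd; apply: boundary_half_space; rewrite dotpBr dotpZr dotpvv mulr1 subrr.
have lb y : S y -> dotp v x <= fnorm (x - y).
  move=> Sy; have : ~ half_space y by move=> Dy; have : (half_space `&` S) y by []; rewrite dis.
  move/negP; rewrite -leNgt => vy.
  have := normr_dotp_unit (x - y) v1; rewrite dotpBr ler_norml => /andP[_]; lra.
have mem0 : [set fnorm (x - y) | y in S] (fnorm (x - y0)) by exists y0.
apply/eqP; rewrite eq_le; apply/andP; split.
  apply: (@le_trans _ _ (fnorm (x - y0))).
    by apply: ge_inf => //; exists (dotp v x) => _ [y Sy <-]; exact: lb.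
  by rewrite opprB addrCA subrr addr0 fnormZ v1 mulr1 gtr0_norm.
by apply: lb_le_inf; [exists (fnorm (x - y0))|move=> _ [y Sy <-]; exact: lb].
Qed.

Section on_half_space.
Context {f : 'rV[R]_d -> R} (fE : forall x, half_space x -> f x = dotp v x).

Let near_half_space x (Q : 'rV[R]_d -> Prop) : half_space x ->
  (forall y, half_space y -> Q y) -> \forall y \near x, Q y.
Proof.
move=> Dx hQ; have := open_half_space; rewrite openE => /(_ x Dx).
by apply: filterS.
Qed.

Lemma partial_half_space x i : half_space x -> partial f i x = v 0 i.
Proof.
move=> Dx; rewrite /partial (@derive_locally_affine _ _ f v 0).
  rewrite /dotp (bigD1 i)//= big1 ?addr0 => [|j ji]; rewrite mxE eqxx /= ?eqxx ?mulr1//.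
  by rewrite (negPf ji) mulr0.
by apply: near_half_space => // y Dy; rewrite add0r fE.
Qed.

Lemma partial2_half_space x i j : half_space x -> partial (partial f i) j x = 0.
Proof.
move=> Dx; rewrite [LHS](@derive_locally_affine _ _ _ 0 (v 0 i)).
  by rewrite /dotp big1// => k _; rewrite mxE mul0r.
apply: near_half_space => // y Dy; rewrite partial_half_space//.
by rewrite /dotp big1 ?addr0// => k _; rewrite mxE mul0r.
Qed.

Lemma grad_half_space x : half_space x -> grad f x = v.
Proof. by move=> Dx; apply/rowP => i; rewrite mxE partial_half_space. Qed.

Lemma hess_half_space x : half_space x -> hess f x = 0.
Proof. by move=> Dx; apply/matrixP => i j; rewrite !mxE partial2_half_space. Qed.

Let C1_locally_affine (g : 'rV[R]_d -> R) u a :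
  (forall x, half_space x -> g x = a + dotp u x) ->
  (forall x i, half_space x -> partial g i x = u 0 i) -> C1_on half_space g.
Proof.
move=> gE pE x Dx; split.
  apply: (near_differentiable _ (differentiable_affine u a x)).
  exact: near_half_space.
move=> i; rewrite /prop_for /continuous_at pE//.
have h : {near x, cst (u 0 i) =1 partial g i} by apply: near_half_space => // y Dy; rewrite pE.
exact: cvg_trans (near_eq_cvg h) (cvg_cst _).
Qed.

Lemma C2_half_space : C2_on half_space f.
Proof.
split=> [|i].
  apply: (@C1_locally_affine f v 0) => [x Dx|x i Dx]; first by rewrite add0r fE.
  exact: partial_half_space.
apply: (@C1_locally_affine (partial f i) 0 (v 0 i)) => [x Dx|x j Dx].
  by rewrite partial_half_space// /dotp big1 ?addr0// => k _; rewrite mxE mul0r.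
by rewrite partial2_half_space// mxE.
Qed.

End on_half_space.

Lemma truncated_half_space (b : 'rV[R]_d -> 'rV[R]_d) (S : set 'rV[R]_d) delta w n :
  half_space `&` S = set0 -> boundary half_space `<=` S -> 0 < delta -> (0 < n)%N ->
  truncated_drift b half_space S delta w n = cutoff v (level delta w n) b.
Proof.
move=> dis bd delta0 n0; apply/funext => x; rewrite /truncated_drift /cutoff indicE.
have [Dx|Dx] := pselect (half_space x).
  rewrite -(dist_half_space dis bd Dx).
  case: ifPn => h; first by rewrite mem_set// scale1r.
  by rewrite memNset ?scale0r// => -[_ h']; rewrite /level h' in h.
rewrite memNset; last by case.
rewrite scale0r ifF//; apply/negP => h; apply: Dx; apply: lt_le_trans h.
by rewrite mulr_gt0// powR_gt0// ltr0n.
Qed.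

Lemma repulsive_of_singular b x0 S c al be l h1 h2 h3 h4 :
  singular_drift b x0 half_space S c al be l h1 h2 h3 h4 ->
  exists eta kap, repulsive_drift v b x0 c l al eta kap.
Proof.
case=> _ _ _ _ Dx0 dis bd _ [[c0 al0 l0] [h10 h20 h30 h40]] /andP[be1 beal] osl rep _ lip.
have dE x : half_space x -> dist S x = dotp v x by exact: dist_half_space.
pose s := h2 + h3 + h4; have s0 : 0 < s by rewrite !addr_gt0.
have r0 : 0 < h1 / 2 / s by rewrite !divr_gt0.
have g0 : 0 < al - be by rewrite subr_gt0.
(* For r <= 1 the lower-order terms are at most s r^-be, and r^(al - be) <= h1 / (2 s) makes this at
   most half of h1 r^-al. The other half is the repulsion that remains. *)
pose eta := Num.min 1 ((h1 / 2 / s) `^ (al - be)^-1).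
have eta0 : 0 < eta by rewrite lt_min ltr01 powR_gt0.
exists eta, (h1 / 2); split=> //.
- by rewrite divr_gt0.
- exact: lt_trans be1 beal.
- move=> x /andP[x0' xeta]; have Dx : half_space x := x0'.
  have := rep x Dx; rewrite dE// (grad_half_space dE)//; apply: le_trans.
  set r := dotp v x in x0' xeta *.
  move: xeta; rewrite le_min => /andP[r1 reta].
  have rb1 : 1 <= r `^ (- be).
    by rewrite -[leLHS](powRr0 r) ger_powR ?x0'//; move: be1; lra.
  have rbe : s * r `^ (- be) <= h1 / 2 * r `^ (- al).
    have -> : r `^ (- be) = r `^ (al - be) * r `^ (- al).
      by rewrite -powRD_gt0//; congr (_ `^ _); ring.
    rewrite mulrA ler_wpM2r ?powR_ge0// mulrC -ler_pdivlMr//.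
    apply: (@le_trans _ _ (((h1 / 2 / s) `^ (al - be)^-1) `^ (al - be))); last first.
      by rewrite -powRrM mulVf ?lt0r_neq0// powRr1// ltW.
    by rewrite ge0_ler_powR ?nnegrE ?powR_ge0 ?(ltW g0) ?(ltW x0').
  have := ltW h20; have := ltW h30; have := ltW h40; rewrite /s in rbe.
  by move: (r `^ (- be)) (r `^ (- al)) rb1 rbe => B A; nra.
- by move=> x y Dx Dy; have := lip x y Dx Dy; rewrite !dE.
Qed.

End half_space.

Lemma repulsive_convergence (R : realType) (disp : measure_display) (Omega : measurableType disp)
    (P : probability Omega R) d (F : R -> set (set Omega)) (W : @process R disp Omega d)
    (v : 'rV[R]_d) (b : 'rV[R]_d -> 'rV[R]_d) (x0 : 'rV[R]_d) (c l al eta kap : R) :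
  filtration F -> wiener P F W -> borel_fun b -> repulsive_drift v b x0 c l al eta kap ->
  exists X : @process R disp Omega d, unique_strong_solution P F W x0 (sde_drift b) X /\
    forall delta om : R, 0 < delta -> 0 <= om <= 1 / (3 * l) ->
    exists Xn : nat -> @process R disp Omega d,
      (forall n, (1 <= n)%N -> unique_strong_solution P F W x0
         (euler_drift n (cutoff v (level delta om n) b)) (Xn n)) /\
      (0 < om -> forall T p : R, 0 < T -> 0 < p -> exists2 C : R, 0 < C & forall n, (1 <= n)%N ->
        (\int[P]_o ereal_sup [set (fnorm (Xn n t o - X t o) `^ p)%:E | t in `[0%R, T]]
          <= (C * n%:R `^ (- (p / 2)))%:E)%E).
Proof.
move=> hF hW bb hb; have al1 := rd_al hb.
(* (3 + al) / 2 is the midpoint of 2 and 1 + al, and al > 1 puts it strictly between them. *)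
pose th := Num.min 3 ((3 + al) / 2).
have th2 : 2 < th by rewrite lt_min; apply/andP; split; lra.
have th3 : th <= 3 by rewrite ge_min lexx.
have thal : th < 1 + al by rewrite gt_min; apply/orP; right; lra.
have th1 : 1 < th by lra.
have m0 : 0 < Num.min (eta / 3) (dotp v x0 / 2).
  by rewrite lt_min !divr_gt0// ?(rd_eta hb) ?(rd_x0 hb).
have [c0 [q [c00 q0 c0m noc]]] := no_crossing th1 thal (rd_kap hb) m0.
have [X [solX XE]] := strong_solution hF hW hb bb th2 th3 c00 q0 c0m noc.
exists X; split=> // delta om delta0 /andP[om0 oml].
exists (fun n t o => euler_path (cutoff v (level delta om n) b) x0 (W^~ o) n t); split.
  move=> n n1; apply: (euler_strong_solution hW) => //.
  by apply: borel_cutoff => //; exact: rd_unit hb.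
move=> om0' T p T0 p0.
exact: (scheme_rate hF hW hb th2 th3 c00 c0m noc XE delta0 (introT andP (conj om0' oml)) T0 p0).
Qed.

(** * The two-particle system *)

Section two_particles.
Context {R : realType}.
Notation s2 := (Num.sqrt 2 : R).

Lemma ord2_1 : lift ord0 ord0 = 1 :> 'I_2. Proof. exact/val_inj. Qed.

Lemma dotp2 (x y : 'rV[R]_2) : dotp x y = x 0 0 * y 0 0 + x 0 1 * y 0 1.
Proof. by rewrite /dotp big_ord_recl big_ord1 ord2_1. Qed.

Lemma vec2_0 (u w : R) : vec2 u w 0 0 = u. Proof. by rewrite mxE. Qed.
Lemma vec2_1 (u w : R) : vec2 u w 0 1 = w. Proof. by rewrite mxE. Qed.

Let s20 : 0 < s2. Proof. by rewrite sqrtr_gt0. Qed.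
Let s2s2 : s2 * s2 = 2. Proof. by rewrite -expr2 sqr_sqrtr. Qed.

Definition diagonal_normal : 'rV[R]_2 := vec2 (- s2^-1) s2^-1.
Notation v := diagonal_normal.

Lemma dotp_diagonal_normal x : dotp v x = (x 0 1 - x 0 0) / s2.
Proof. by rewrite dotp2 vec2_0 vec2_1; ring. Qed.

Lemma fnorm_diagonal_normal : fnorm v = 1.
Proof.
rewrite fnormE dotp2 vec2_0 vec2_1 mulrNN -invfM s2s2 (_ : 2^-1 + 2^-1 = 1) ?sqrtr1//.
by lra.
Qed.

Lemma half_space_diagonal : half_space (v := v) = [set x | x 0 0 < x 0 1].
Proof.
apply/seteqP; split => x; rewrite /half_space/= dotp_diagonal_normal.
  by rewrite pmulr_lgt0 ?invr_gt0// subr_gt0.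
by move=> h; rewrite pmulr_lgt0 ?invr_gt0// subr_gt0.
Qed.

Lemma fnorm2_sqr (x : 'rV[R]_2) : fnorm x ^+ 2 = x 0 0 ^+ 2 + x 0 1 ^+ 2.
Proof. by rewrite sqr_fnorm dotp2 !expr2. Qed.

Context {Q K : R -> R} {c l h1 h2 h3 h4 alpha beta L : R} {b : 'rV[R]_2 -> 'rV[R]_2}.
Context (hQ : forall x y, `|Q x - Q y| <= L * `|x - y|) (L0 : 0 <= L).
Context (hc : 0 < c) (hl : 0 < l).
Context (hK_onesided : forall x y : R, 0 < x -> 0 < y -> (K x - K y) * (x - y) <= c * `|x - y| ^+ 2).
Context (hK_local : forall x y : R, 0 < x -> 0 < y ->
  `|K x - K y| <= c * (1 + x `^ (- l) + y `^ (- l)) * `|x - y|).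
Context (hh1 : 0 < h1) (hh2 : 0 < h2) (hh3 : 0 < h3) (hh4 : 0 < h4).
Context (hbeta : 0 < beta) (hbeta_alpha : beta < alpha - 1).
Context (hK_repulsive : forall x : R, 0 < x ->
  h1 * x `^ (- alpha) - h2 * x `^ (- beta) - h3 - h4 * x <= K x).
Context (hb : forall x : 'rV[R]_2, x 0 0 < x 0 1 ->
  b x = vec2 (Q (x 0 0) - K (x 0 1 - x 0 0)) (Q (x 0 1) + K (x 0 1 - x 0 0))).

(** Dictated by the local Lipschitz bound: each of the two coordinates contains Q once and K once,
    and the gaps differ by at most 2 |x - y|. *)
Let c' := 2 * L + 4 * c.

(** K enters the coordinates with opposite signs, so it contributes (K u - K u') (u - u') for the
    gaps u and u', which is the form of the hypothesis on K; and (u - u')^2 <= 2 |x - y|^2. *)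
Lemma particles_one_sided (x y : 'rV[R]_2) : x 0 0 < x 0 1 -> y 0 0 < y 0 1 ->
  dotp (b x - b y) (x - y) <= c' * fnorm (x - y) ^+ 2.
Proof.
move=> Dx Dy; rewrite !hb// fnorm2_sqr dotp2 !mxE /=.
set x1 := x 0 0 in Dx *; set x2 := x 0 1 in Dx *; set y1 := y 0 0 in Dy *; set y2 := y 0 1 in Dy *.
have qb r1 r2 : (Q r1 - Q r2) * (r1 - r2) <= L * (r1 - r2) ^+ 2.
  apply: (le_trans (ler_norm _)); rewrite normrM -[X in _ <= _ * X]real_normK ?num_real//.
  by rewrite expr2 mulrA ler_wpM2r.
have k := hK_onesided (ltac:(by rewrite subr_gt0) : 0 < x2 - x1) (ltac:(by rewrite subr_gt0) : 0 < y2 - y1).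
rewrite real_normK ?num_real// in k.
have q1 := qb x1 y1; have q2 := qb x2 y2.
rewrite /c'; move: (K _) (K _) (Q x1) (Q x2) (Q y1) (Q y2) k q1 q2 => k1 k2 a1 a2 b1 b2 k q1 q2.
have cs : c * (x2 - x1 - (y2 - y1)) ^+ 2 <= 2 * c * ((x1 - y1) ^+ 2 + (x2 - y2) ^+ 2).
  rewrite (mulrC 2) -mulrA ler_wpM2l ?(ltW hc)//.
  by have := sqr_ge0 (x1 - y1 + (x2 - y2)); rewrite !expr2; lra.
have p1 : 0 <= L * ((x1 - y1) ^+ 2 + (x2 - y2) ^+ 2) by rewrite mulr_ge0// addr_ge0// sqr_ge0.
have p2 : 0 <= c * ((x1 - y1) ^+ 2 + (x2 - y2) ^+ 2) by rewrite mulr_ge0 ?(ltW hc)// addr_ge0// sqr_ge0.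
by rewrite !expr2 in k q1 q2 cs p1 p2 *; lra.
Qed.

Lemma gap_eq (x : 'rV[R]_2) : x 0 1 - x 0 0 = s2 * dotp v x.
Proof. by rewrite dotp_diagonal_normal mulrC divfK// gt_eqF. Qed.

Lemma powR_gap_le (r e : R) : 0 < r -> 0 < e -> (s2 * r) `^ (- e) <= r `^ (- e).
Proof.
move=> r0 e0; rewrite !powRN lef_pV2 ?posrE ?powR_gt0 ?mulr_gt0//.
rewrite ge0_ler_powR ?nnegrE ?(ltW e0) ?(ltW r0) ?mulr_ge0 ?(ltW s20) ?(ltW r0)//.
rewrite ler_peMl ?(ltW r0)// -[leLHS]sqrtr1 ler_sqrt; lra.
Qed.

Lemma particles_local_lipschitz (x y : 'rV[R]_2) : x 0 0 < x 0 1 -> y 0 0 < y 0 1 ->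
  fnorm (b x - b y) <= c' * (1 + dotp v x `^ (- l) + dotp v y `^ (- l)) * fnorm (x - y).
Proof.
move=> Dx Dy; have gx : 0 < dotp v x by rewrite -(pmulr_rgt0 _ s20) -gap_eq subr_gt0.
have gy : 0 < dotp v y by rewrite -(pmulr_rgt0 _ s20) -gap_eq subr_gt0.
apply: (le_trans (fnorm_le_sum _)); rewrite big_ord_recl big_ord1 ord2_1 !hb// !mxE /=.
have kb : `|K (x 0 1 - x 0 0) - K (y 0 1 - y 0 0)| <=
    c * (1 + dotp v x `^ (- l) + dotp v y `^ (- l)) * (2 * fnorm (x - y)).
  apply: (le_trans (hK_local _ _)); rewrite ?subr_gt0//.
  have g1 := powR_gap_le gx hl; have g2 := powR_gap_le gy hl; rewrite -!gap_eq in g1 g2.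
  apply: ler_pM => //.
  - by rewrite mulr_ge0 ?(ltW hc)// addr_ge0 ?powR_ge0// addr_ge0 ?powR_ge0.
  - by rewrite ler_wpM2l ?(ltW hc)// lerD// lerD2l.
  - have := normr_coord_le (x - y) 0; have := normr_coord_le (x - y) 1; rewrite !mxE.
    rewrite (_ : x 0 1 - x 0 0 - (y 0 1 - y 0 0) = x 0 1 - y 0 1 - (x 0 0 - y 0 0)); last by ring.
    by have := ler_normB (x 0 1 - y 0 1) (x 0 0 - y 0 0); lra.
have q1 : `|Q (x 0 0) - Q (y 0 0)| <= L * fnorm (x - y).
  apply: (le_trans (hQ _ _)); rewrite ler_wpM2l//.
  by have := normr_coord_le (x - y) 0; rewrite !mxE.
have q2 : `|Q (x 0 1) - Q (y 0 1)| <= L * fnorm (x - y).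
  apply: (le_trans (hQ _ _)); rewrite ler_wpM2l//.
  by have := normr_coord_le (x - y) 1; rewrite !mxE.
have t1 := ler_normB (Q (x 0 0) - Q (y 0 0)) (K (x 0 1 - x 0 0) - K (y 0 1 - y 0 0)).
have t2 := ler_normD (Q (x 0 1) - Q (y 0 1)) (K (x 0 1 - x 0 0) - K (y 0 1 - y 0 0)).
rewrite (_ : _ - _ - (_ - _) = Q (x 0 0) - Q (y 0 0) - (K (x 0 1 - x 0 0) - K (y 0 1 - y 0 0))); last by ring.
rewrite [X in _ + `|X|](_ : _ = Q (x 0 1) - Q (y 0 1) + (K (x 0 1 - x 0 0) - K (y 0 1 - y 0 0))); last by ring.
have e1 := powR_ge0 (dotp v x) (- l); have e2 := powR_ge0 (dotp v y) (- l).
have f0 := fnorm_ge0 (x - y).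
have : 0 <= L * fnorm (x - y) * (dotp v x `^ (- l) + dotp v y `^ (- l)).
  by rewrite !mulr_ge0// addr_ge0.
by rewrite /c'; lra.
Qed.

(** The given beta may be at most 1, whereas an exponent in ]1, alpha[ is required. Raising the
    exponent costs only a constant, and alpha > 1 + beta leaves room. *)
Let beta' := (Num.max beta 1 + alpha) / 2.

Lemma beta'_bounds : [/\ 1 < beta', beta <= beta' & beta' < alpha].
Proof.
have : Num.max beta 1 < alpha by rewrite gt_max; apply/andP; split; move: hbeta_alpha hbeta; lra.
have : beta <= Num.max beta 1 by rewrite le_max lexx.
have : 1 <= Num.max beta 1 by rewrite le_max lexx orbT.
have : 1 < alpha by move: hbeta_alpha hbeta; lra.
by rewrite /beta'; move: (Num.max beta 1) => m ? ? ? ?; split; lra.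
Qed.

(** In direction v the drift is (Q x2 - Q x1 + 2 K u) / sqrt 2, with gap u = sqrt 2 r and r = dotp v
    x: this accounts for the powers of sqrt 2 and for L + 2 h4. *)
Lemma particles_repulsion (x : 'rV[R]_2) : x 0 0 < x 0 1 ->
  s2 * h1 * s2 `^ (- alpha) * dotp v x `^ (- alpha) - s2 * h2 * dotp v x `^ (- beta')
   - s2 * (h2 + h3) - (L + 2 * h4) * dotp v x <= dotp v (b x).
Proof.
move=> Dx; have gx : 0 < dotp v x by rewrite -(pmulr_rgt0 _ s20) -gap_eq subr_gt0.
have [b1 bb' ba] := beta'_bounds.
rewrite [leRHS]dotp_diagonal_normal hb// vec2_0 vec2_1.
set u := x 0 1 - x 0 0; set r := dotp v x in gx *.
have ur : u = s2 * r by exact: gap_eq.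
have u0 : 0 < u by rewrite subr_gt0.
have q : - (L * u) <= Q (x 0 1) - Q (x 0 0).
  have := hQ (x 0 1) (x 0 0); rewrite -/u (gtr0_norm u0) ler_norml => /andP[]//.
have k := hK_repulsive u0.
have pa : u `^ (- alpha) = s2 `^ (- alpha) * r `^ (- alpha) by rewrite ur powRM// ltW.
(* The summand 1 covers r >= 1, where the larger exponent gives the smaller power; it becomes the
   extra h2 in the constant term. *)
have pb : u `^ (- beta) <= 1 + r `^ (- beta').
  apply: (le_trans (_ : _ <= r `^ (- beta))); first by rewrite ur; exact: powR_gap_le.
  have [r1|r1] := leP 1 r.
    apply: (@le_trans _ _ 1); last by rewrite lerDl powR_ge0.
    rewrite powRN invf_le1 ?powR_gt0// -[leLHS](powRr0 r) ler_powR// ltW//.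
  apply: (@le_trans _ _ (r `^ (- beta'))); last by rewrite lerDr.
  by rewrite ger_powR ?lerN2 ?gx ?(ltW r1).
rewrite ler_pdivlMr//.
have -> : (s2 * h1 * s2 `^ (- alpha) * r `^ (- alpha) - s2 * h2 * r `^ (- beta') - s2 * (h2 + h3)
   - (L + 2 * h4) * r) * s2 = 2 * (h1 * u `^ (- alpha)) - 2 * (h2 * r `^ (- beta')) - 2 * (h2 + h3) - (L + 2 * h4) * u.
  rewrite pa ur -!mulrBr; move: s2s2; move: s2 => z zz.
  apply: (@etrans _ _ (z * z * (h1 * (z `^ (- alpha) * r `^ (- alpha)) - h2 * r `^ (- beta') - (h2 + h3))
    - (L + 2 * h4) * (z * r))); last by rewrite zz; ring.
  by ring.
have := ler_wpM2l (ltW hh2) pb; lra.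
Qed.

(** The complement of D is the largest admissible S. As rho is linear on D, the Hessian bound has
    left side 0. *)
Lemma particles_singular_drift (x0 : 'rV[R]_2) : borel_fun b -> x0 0 0 < x0 0 1 ->
  singular_drift b x0 (half_space (v := v)) (~` half_space (v := v)) c' alpha beta' l
    (s2 * h1 * s2 `^ (- alpha)) (s2 * h2) (s2 * (h2 + h3)) (L + 2 * h4).
Proof.
move=> bb Dx0; have [b1 bb' ba] := beta'_bounds.
have oD := open_half_space fnorm_diagonal_normal.
have dis : half_space (v := v) `&` ~` half_space (v := v) = set0 by rewrite setICr.
have bd : boundary (half_space (v := v)) `<=` ~` half_space (v := v).
  move=> x [_ ni] Dx; apply: ni; move: oD; rewrite openE; exact.
have dE x : half_space (v := v) x -> dist (~` half_space (v := v)) x = dotp v x.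
  exact: (dist_half_space fnorm_diagonal_normal dis bd).
have Dgap x : half_space (v := v) x -> x 0 0 < x 0 1 by rewrite half_space_diagonal.
have c'0 : 0 < c' by rewrite /c' ltr_wpDl ?mulr_ge0 ?mulr_gt0.
split=> //.
- by apply: borel_setC; exact: borel_open.
- by exists 0; rewrite /half_space /setC /= dotpr0 ltxx.
- by rewrite half_space_diagonal.
- exact: (C2_half_space fnorm_diagonal_normal dE).
- split; split=> //; first by rewrite (lt_trans _ ba)// (lt_trans _ b1).
  + by rewrite !mulr_gt0// powR_gt0.
  + by rewrite mulr_gt0.
  + by rewrite mulr_gt0// addr_gt0.
  + by rewrite ltr_wpDl// mulr_gt0.
- by rewrite b1 ba.
- by move=> x y /Dgap Dx /Dgap Dy; exact: particles_one_sided.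
- move=> x Dx; rewrite dE// (grad_half_space fnorm_diagonal_normal dE)//.
  by apply: particles_repulsion; exact: Dgap.
- move=> x Dx; rewrite (hess_half_space fnorm_diagonal_normal dE)//.
  rewrite /fnorm big1 ?sqrtr0 => [|i _]; last by rewrite big1// => j _; rewrite mxE expr0n.
  by rewrite mulr_ge0 ?(ltW c'0)// addr_ge0 ?powR_ge0.
- move=> x y Dx Dy; rewrite !dE//; apply: particles_local_lipschitz; exact: Dgap.
Qed.

End two_particles.

Theorem corollary1 (R : realType) (Q K : R -> R) (x0 : 'rV[R]_2)
    (c l h1 h2 h3 h4 alpha beta : R) (b : 'rV[R]_2 -> 'rV[R]_2)
    (hx0 : x0 0 0 < x0 0 1)
    (hQ : exists L : R, L.-lipschitz (Q : R^o -> R^o))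
    (hc : 0 < c) (hl : 0 < l)
    (hK_onesided : forall x y : R, 0 < x -> 0 < y ->
      (K x - K y) * (x - y) <= c * `|x - y| ^+ 2)
    (hK_local : forall x y : R, 0 < x -> 0 < y ->
      `|K x - K y| <= c * (1 + x `^ (- l) + y `^ (- l)) * `|x - y|)
    (hh1 : 0 < h1) (hh2 : 0 < h2) (hh3 : 0 < h3) (hh4 : 0 < h4)
    (hbeta : 0 < beta) (hbeta_alpha : beta < alpha - 1)
    (hK_repulsive : forall x : R, 0 < x ->
      h1 * x `^ (- alpha) - h2 * x `^ (- beta) - h3 - h4 * x <= K x)
    (hb_borel : borel_fun b)
    (hb : forall x : 'rV[R]_2, x 0 0 < x 0 1 ->
      b x = vec2 (Q (x 0 0) - K (x 0 1 - x 0 0))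
                 (Q (x 0 1) + K (x 0 1 - x 0 0))) :
  exists D : set 'rV[R]_2,
    (exists (S : set 'rV[R]_2) (c' alpha' beta' l' h1' h2' h3' h4' : R),
      singular_drift b x0 D S c' alpha' beta' l' h1' h2' h3' h4') /\
    (forall (S : set 'rV[R]_2) (c' alpha' beta' l' h1' h2' h3' h4' : R),
      singular_drift b x0 D S c' alpha' beta' l' h1' h2' h3' h4' ->
      euler_convergence b x0 D S l').
Proof.
exists (half_space (v := @diagonal_normal R)); split.
  have [L hL] := hQ.
  have hQ' x y : `|Q x - Q y| <= `|L| * `|x - y|.
    have /= := hL (x, y) (conj I I); move=> /le_trans; apply.
    by rewrite ler_wpM2r// ler_norm.
  do 9 eexists; exact: (particles_singular_drift hQ' (normr_ge0 L) hc hl hK_onesided hK_local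
    hh1 hh2 hh3 hh4 hbeta hbeta_alpha hK_repulsive hb hb_borel hx0).
(* Only D is fixed now; S and the constants are arbitrary. [repulsive_of_singular] extracts the
   repulsive drift from the assumptions with the given exponent l', which is the one in the range of
   w. *)
move=> S c' alpha' beta' l' h1' h2' h3' h4' sd disp Omega P F W hF hW.
have v1 := @fnorm_diagonal_normal R.
have [eta [kap rep]] := repulsive_of_singular v1 sd.
have [X [solX hX]] := repulsive_convergence hF hW hb_borel rep.
exists X; split=> // delta w delta0 wl; have [Xn [solXn rate]] := hX delta w delta0 wl.
exists Xn; split=> // n n1.
by rewrite (truncated_half_space v1 _ _ (DS_disjoint sd) (boundary_D_S sd))//; exact: solXn.
Qed.
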